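(* Let $n\ge2$ be an integer, let $K,L\subset\mathbb{R}^n$ be origin-symmetric $C^2_+$ convex bodies, and suppose $$\widetilde C_{1,n+2}(K,\cdot)=\widetilde C_{1,n+2}(L,\cdot).$$ Then $K=L$.
   Context: A convex body in $\mathbb{R}^n$ is a compact convex set with nonempty interior. It is origin-symmetric if $K=-K$, and $C^2_+$ if its boundary is $C^2$ with everywhere positive Gauss curvature. For a convex body $K$ with the origin in its interior, $h_K(u)=\max_{x\in K}\langle x,u\rangle$ is its support function and $\rho_K(u)=\max\{\lambda>0:\lambda u\in K\}$ its radial function ($u\in\mathbb{S}^{n-1}$). The $q$-th dual curvature measure of $K$ is the Borel measure on $\mathbb{S}^{n-1}$ $$\widetilde C_q(K,\eta)=\frac1n\int_{\{u\in\mathbb{S}^{n-1}:\ \rho_K(u)u\text{ has an outer unit normal of }K\text{ in }\eta\}}\rho_K(u)^q\,du ,$$ and the $(1,q)$-th dual curvature measure is $d\widetilde C_{1,q}(K,u)=h_K(u)^{-1}\,d\widetilde C_q(K,u)$; here $q=n+2$. *)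

(* Defs.v *)
From HB Require Import structures.
From mathcomp Require Import all_boot all_order all_algebra.
From mathcomp Require Import all_classical all_reals all_analysis.

Set Implicit Arguments.
Unset Strict Implicit.
Unset Printing Implicit Defensive.
Import Order.TTheory GRing.Theory Num.Theory.
Import numFieldNormedType.Exports.
Local Open Scope classical_set_scope.
Local Open Scope ring_scope.

(* The norm `|x| of 'rV[R]_n is the max norm; it induces the usual topology,
   but lengths and angles are taken from the inner product below. *)
Definition dotv (R : realType) (n : nat) (x y : 'rV[R]_n) : R :=
  \sum_i x 0 i * y 0 i.

Definition enorm (R : realType) (n : nat) (x : 'rV[R]_n) : R :=
  Num.sqrt (dotv x x).

Definition usphere (R : realType) (n : nat) : set 'rV[R]_n :=
  [set u | enorm u = 1].
Arguments usphere : clear implicits.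

Definition convex_body (R : realType) (n : nat) (K : set 'rV[R]_n) : Prop :=
  [/\ compact K, convex_set K & K° !=set0].

Definition origin_symmetric (R : realType) (n : nat) (K : set 'rV[R]_n) :
  Prop := K = [set - x | x in K].

Definition boundary (R : realType) (n : nat) (K : set 'rV[R]_n) :
  set 'rV[R]_n := closure K `\` K°.

Definition partial (R : realType) (n : nat) (i : 'I_n) (f : 'rV[R]_n -> R) :
  'rV[R]_n -> R := fun x => 'D_(delta_mx 0 i) f x.

Definition C1_on (R : realType) (n : nat) (U : set 'rV[R]_n)
    (f : 'rV[R]_n -> R) : Prop :=
  forall (i : 'I_n) (x : 'rV[R]_n), U x ->
    derivable f x (delta_mx 0 i) /\ {for x, continuous (partial i f)}.

Definition C2_on (R : realType) (n : nat) (U : set 'rV[R]_n)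
    (f : 'rV[R]_n -> R) : Prop :=
  C1_on U f /\ forall i : 'I_n, C1_on U (partial i f).

Definition gradient (R : realType) (n : nat) (f : 'rV[R]_n -> R)
    (x : 'rV[R]_n) : 'rV[R]_n :=
  \row_i partial i f x.

(* The outer unit normal field of the level sets of f, hence the Gauss map of
   a hypersurface {f = 0} bounding {f <= 0}. *)
Definition unit_normal (R : realType) (n : nat) (f : 'rV[R]_n -> R)
    (x : 'rV[R]_n) : 'rV[R]_n :=
  (enorm (gradient f x))^-1 *: gradient f x.

(* Determinant of the shape operator, i.e. of the differential of the Gauss
   map N restricted to the tangent space N(x)^\perp. The differential acts on
   row vectors by v |-> v *m 'J N x and takes its values in N(x)^\perp, so the
   matrix below is the shape operator on N(x)^\perp and the identity on the
   line spanned by N(x), and has the same determinant. *)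
Definition gauss_curvature (R : realType) (n : nat) (f : 'rV[R]_n -> R)
    (x : 'rV[R]_n) : R :=
  let N := unit_normal f in
  let Q := (N x)^T *m N x in
  \det ((1%:M - Q) *m jacobian N x + Q).

Definition local_C2_defining_function (R : realType) (n : nat)
    (K : set 'rV[R]_n) (U : set 'rV[R]_n) (f : 'rV[R]_n -> R) : Prop :=
  [/\ C2_on U f,
      forall y, U y -> gradient f y != 0 &
      forall y, U y -> (K y <-> f y <= 0)].

(* The sign condition in local_C2_defining_function orients N outward, which
   makes the Gauss curvature independent of the choice of f. *)
Definition C2_plus (R : realType) (n : nat) (K : set 'rV[R]_n) : Prop :=
  forall x, boundary K x ->
    exists (U : set 'rV[R]_n) (f : 'rV[R]_n -> R),
      [/\ open_nbhs x U, local_C2_defining_function K U f &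
          0 < gauss_curvature f x].

Definition support_fun (R : realType) (n : nat) (K : set 'rV[R]_n)
    (u : 'rV[R]_n) : R :=
  sup [set dotv x u | x in K].

Definition radial_fun (R : realType) (n : nat) (K : set 'rV[R]_n)
    (u : 'rV[R]_n) : R :=
  sup [set l | 0 < l /\ K (l *: u)].

Definition outer_unit_normal (R : realType) (n : nat) (K : set 'rV[R]_n)
    (x v : 'rV[R]_n) : Prop :=
  [/\ usphere R n v, boundary K x & forall y, K y -> dotv y v <= dotv x v].

(* R^n with its Borel sigma-algebra. The Borel sets of the sphere are the
   Borel sets of R^n contained in it, and measures on the sphere are given as
   functions of such sets. *)
Definition borelRV (R : realType) (n : nat) : measurableType _ :=
  g_sigma_algebraType (@open 'rV[R]_n).

Fixpoint tuple_lebesgue (R : realType) (n : nat) :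
    set (n.-tuple (measurableTypeR R)) -> \bar R :=
  match n with
  | 0 => dirac [tuple]
  | m.+1 => pushforward (product_measure1 (@lebesgue_measure R)
                                          (@tuple_lebesgue R m))
              (fun p => [tuple of p.1 :: p.2])
  end.

Definition volume (R : realType) (n : nat) (A : set 'rV[R]_n) : \bar R :=
  tuple_lebesgue [set t : n.-tuple (measurableTypeR R) |
                   A (\row_i tnth t i)].

(* Spherical Lebesgue measure: n times the volume of the cone over A cut by
   the unit ball. The origin is sent to 0, which is not on the sphere. *)
Definition sphere_measure (R : realType) (n : nat) (A : set (borelRV R n)) :
    \bar R :=
  (n%:R%:E *
   volume [set x : 'rV[R]_n | (enorm x <= 1)%R /\ A ((enorm x)^-1 *: x)%R])%E.

Definition dual_curvature (R : realType) (n : nat) (q : R)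
    (K : set 'rV[R]_n) (eta : set (borelRV R n)) : \bar R :=
  (n%:R^-1%:E *
   \int[@sphere_measure R n]_(u in [set u : borelRV R n | usphere R n u /\
          exists2 v, eta v & outer_unit_normal K (radial_fun K u *: u)%R v])
     (radial_fun K u `^ q)%:E)%E.

(* Library integrals take an arbitrary set function; dual_curvature q K is
   countably additive on Borel sets when K is a convex body with the origin in its
   interior. *)
Definition dual_curvature1 (R : realType) (n : nat) (q : R)
    (K : set 'rV[R]_n) (eta : set (borelRV R n)) : \bar R :=
  (\int[dual_curvature q K]_(v in eta) ((support_fun K v)^-1)%:E)%E.

(* Main.v *)
(* Write rho, h, alpha for the radial function, support function and Gauss map of a body and N = n + 2.
   In polar coordinates the moment of inertia Gamma(K) = int_K |x|^2 dx is a constant times int rho_K^N, so equality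
   of the measures says that int (G(alpha_K) / h_K(alpha_K)) rho_K^N takes the same value for K and L, for every G >= 0.
   The Prekopa-Leindler inequality, applied to <x,v>_+^2 1_K along a Parseval frame chosen so that the second moments of
   K and L in its directions are in a fixed ratio, gives Gamma(K) Gamma(L) <= Gamma((K+L)/2)^2.
   Comparing Gamma(K) with Gamma((1-t)K + tV), t = 2^-j -> 0, turns this into a Minkowski inequality:
   Gamma(V) >= Gamma(K) implies int (h_V/h_K)(alpha_K) rho_K^N >= int rho_K^N.
   Applied to dilates of L, and then of (K+L)/2, it forces Gamma(K) = Gamma(L) = Gamma((K+L)/2).
   Equality in Prekopa-Leindler then lowers the exponent of <x,v> from 2 to 0, so that K, L and (K+L)/2 have
   the same volume; passing to slices reduces the equality case of Brunn-Minkowski to dimension one. *)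
Require Import Defs.
From HB Require Import structures.
From mathcomp Require Import all_boot all_order all_algebra.
From mathcomp Require Import all_classical all_reals all_analysis.
From mathcomp Require Import measurable_realfun.
From mathcomp Require Import ring lra.

Set Implicit Arguments.
Unset Strict Implicit.
Unset Printing Implicit Defensive.
Import Order.TTheory GRing.Theory Num.Theory.
Import numFieldNormedType.Exports.
Import HBNNSimple.
Local Open Scope classical_set_scope.
Local Open Scope ring_scope.

(** * Lebesgue measure on row vectors *)

(** Prekopa-Leindler is proved at midpoints only, which is why the interpolation runs through t =
    2^-j. The half-space in <x,v>_+ is forced: <x,v>^2 is not midpoint log-concave across <x,v> = 0,
    while on one side this is the arithmetic-geometric mean inequality. Summing the directional
    inequalities over an arbitrary frame loses by Cauchy-Schwarz; proportional second moments are
    exactly the case without loss. No derivative of Gamma is computed: the half-space with normal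
    alpha_K(u) bounds the radial function of (1-t)K + tV by an affine function of t, and an upper
    bound for Gamma is all the Minkowski inequality asks for. Equality is tractable because symmetry
    puts all maxima at 0: the one-dimensional inequality, kept in the additive form I/a + J/b with
    suprema a and b, forces equal values at 0. The bodies are replaced by their interiors, whose
    indicators are lower semicontinuous, so that a value at 0 is not lost to null sets. *)

Lemma measurable_compT d1 d2 d3 (T1 : measurableType d1) (T2 : measurableType d2)
    (T3 : measurableType d3) (f : T2 -> T3) (g : T1 -> T2) :
  measurable_fun setT f -> measurable_fun setT g ->
  measurable_fun setT (fun x => f (g x)).
Proof. exact: measurableT_comp. Qed.

Lemma eq_measurable_funT d1 d2 (T1 : measurableType d1) (T2 : measurableType d2)
    (f g : T1 -> T2) :
  (forall x, f x = g x) -> measurable_fun setT g -> measurable_fun setT f.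
Proof. by move=> /funext ->. Qed.

Section vectors.
Context {R : realType}.
Implicit Types n : nat.

Lemma rV_ballP n (x : 'rV[R]_n) (e : R) (y : 'rV[R]_n) : 0 < e ->
  ball x e y <-> forall i, `|x 0 i - y 0 i| < e.
Proof.
move=> e0; split=> [[_ h] i|h]; first exact: (h 0 i).
by split=> // i j; rewrite ord1; exact: h.
Qed.

Lemma rV_normP n (x : 'rV[R]_n) (i : 'I_n) : `|x 0 i| <= `|x|.
Proof.
rewrite [`|x|]/Num.norm/= mx_normrE.
exact: (le_bigmax _ (fun ij : 'I_1 * 'I_n => `|x ij.1 ij.2|) (0, i)).
Qed.

Lemma rV_norm_lt n (x : 'rV[R]_n) (e : R) : 0 < e ->
  (forall i, `|x 0 i| < e) -> `|x| < e.
Proof.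
move=> e0 h; rewrite [`|x|]/Num.norm/= mx_normrE; apply: bigmax_lt => //= -[i j] _ /=.
by rewrite ord1.
Qed.

Lemma measurable_open n (O : set 'rV[R]_n) :
  open O -> measurable (O : set (borelRV R n)).
Proof. by move=> oO; exact: sub_sigma_algebra. Qed.

Lemma measurable_closed n (C : set 'rV[R]_n) :
  closed C -> measurable (C : set (borelRV R n)).
Proof.
move=> cC; rewrite -[C]setCK; apply: measurableC; apply: measurable_open.
exact: closed_openC.
Qed.

Lemma measurable_coord n (i : 'I_n) :
  measurable_fun setT (fun x : borelRV R n => x 0 i : measurableTypeR R).
Proof.
apply: (measurability _ (RGenOpens.measurableE R)).
move=> _ [_ [a [b ->]] <-]; rewrite setTI; apply: measurable_open.
apply: (@open_comp _ _ (fun x : 'rV[R]_n => x 0 i) `]a, b[%classic).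
  by move=> x _; exact: coord_continuous.
exact: interval_open.
Qed.

(** An open set is a countable union of cubes with rational centres and radii [1/(k+1)], and the
    preimage of a cube is a finite intersection of coordinate conditions. *)
Lemma measurable_fun_rV d (T : measurableType d) n (f : T -> borelRV R n) :
  (forall i, measurable_fun setT (fun t => f t 0 i : measurableTypeR R)) ->
  measurable_fun setT f.
Proof.
move=> mf; apply: (@measurability _ _ T (borelRV R n) setT f (@open 'rV[R]_n)) => //.
move=> _ [U oU <-]; rewrite setTI.
pose B (p : 'rV[rat]_n * nat) := [set y : 'rV[R]_n | forall i, `|ratr (p.1 0 i) - y 0 i| < p.2.+1%:R^-1].
have -> : f @^-1` U = \bigcup_p (if `[< B p `<=` U >] then f @^-1` B p else set0).
  apply/seteqP; split => [t /= Uft|t [p _]]; last first.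
    by case: asboolP => // BO /BO.
  move: oU; rewrite openE => /(_ _ Uft) /nbhs_ballP [e /= e0 fe].
  (* Half of [e] bounds each of the two legs, from [f t] to the rational centre and from there to
     [y]. *)
  have [k ke] : exists k, 2 * k.+1%:R^-1 < e.
    have [k] := @ltr_add_invr R 0 (e / 2) (divr_gt0 e0 (ltr0Sn _ 1)).
    by rewrite add0r => hk; exists k; rewrite mulrC -ltr_pdivlMr.
  have /choice [q hq] : forall i, exists q, `|ratr q - f t 0 i| < k.+1%:R^-1.
    move=> i.
    have [q] := @rat_in_itvoo R (f t 0 i - k.+1%:R^-1) (f t 0 i + k.+1%:R^-1) ltac:(by rewrite ltrD2l gt0_cp// invr_gt0).
    by rewrite in_itv/= => /andP[q1 q2]; exists q; rewrite ltr_distl q1 q2.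
  exists (\row_i q i, k) => //; case: asboolP => [_ /= i|[]]; first by rewrite mxE.
  move=> y /= hy; apply: fe; apply/rV_ballP => // i.
  apply: le_lt_trans ke; rewrite mulr_natl mulr2n.
  have := hy i; rewrite mxE /= => h1; have h2 := hq i.
  have -> : f t 0 i - y 0 i = (ratr (q i) - y 0 i) - (ratr (q i) - f t 0 i) by ring.
  by rewrite (le_trans (ler_normB _ _))// lerD// ltW.
apply: countable_bigcupT_measurable; first exact: countableP.
move=> p; case: asboolP => // _.
have -> : f @^-1` B p = \bigcap_(i in [set: 'I_n]) [set t | `|ratr (p.1 0 i) - f t 0 i| < p.2.+1%:R^-1].
  by apply/seteqP; split => t /= h i; [move=> _|]; exact: h.
apply: fin_bigcap_measurable; first exact: finite_finset.
move=> i _; rewrite -[X in measurable X]setTI.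
have -> : [set: T] `&` [set t | `|ratr (p.1 0 i) - f t 0 i| < p.2.+1%:R^-1] =
    [set: T] `&` (fun t => f t 0 i) @^-1` (ball (ratr (p.1 0 i) : R) p.2.+1%:R^-1) by [].
by apply: mf => //; exact: measurable_ball.
Qed.

Lemma measurable_scaleV d (T : measurableType d) n (c : T -> R) (f : T -> borelRV R n) :
  measurable_fun setT c -> measurable_fun setT f ->
  measurable_fun setT (fun t => c t *: f t : borelRV R n).
Proof.
move=> mc mf; apply: measurable_fun_rV => i.
rewrite (_ : (fun _ => _) = (fun t => c t * f t 0 i)); last first.
  by apply/funext => t; rewrite mxE.
apply: measurable_funM => //.
apply: (measurableT_comp (measurable_coord i) mf).
Qed.

Lemma measurable_dotv d (T : measurableType d) n (f g : T -> borelRV R n) :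
  measurable_fun setT f -> measurable_fun setT g ->
  measurable_fun setT (fun t => dotv (f t) (g t)).
Proof.
move=> mf mg; apply: measurable_sum => i; apply: measurable_funM.
  exact: (measurableT_comp (measurable_coord i) mf).
exact: (measurableT_comp (measurable_coord i) mg).
Qed.

Lemma measurable_enorm n : measurable_fun setT (fun x : borelRV R n => enorm x).
Proof.
apply: (@measurableT_comp _ _ _ _ _ _ (@Num.sqrt R)).
  apply: continuous_measurable_fun; exact: sqrt_continuous.
by apply: measurable_dotv.
Qed.

Definition rowt n (t : n.-tuple (measurableTypeR R)) : borelRV R n :=
  \row_i tnth t i.

Definition tupv n (x : borelRV R n) : n.-tuple (measurableTypeR R) :=
  [tuple (x 0 i : measurableTypeR R) | i < n].

Lemma rowtK n : cancel (@rowt n) (@tupv n).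
Proof. by move=> t; apply: eq_from_tnth => i; rewrite tnth_mktuple mxE. Qed.

Lemma measurable_rowt n : measurable_fun setT (@rowt n).
Proof.
apply: measurable_fun_rV => i.
rewrite (_ : (fun _ => _) = (fun t : n.-tuple (measurableTypeR R) => tnth t i)).
  exact: measurable_tnth.
by apply/funext => t; rewrite mxE.
Qed.

Lemma measurable_tupv n : measurable_fun setT (@tupv n).
Proof.
apply/measurable_fun_tnthP => i.
rewrite (_ : _ \o _ = fun x : borelRV R n => x 0 i); first exact: measurable_coord.
by apply/funext => x /=; rewrite tnth_mktuple.
Qed.

(** The left inverse [g] carries a sigma-finite cover of [T1] to one of [T2] with the same measures.
    Sigma-finiteness must survive because Tonelli is applied to the image measures. *)
Lemma pushforward_sfm d d' (T1 : measurableType d) (T2 : measurableType d')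
   (m : {measure set T1 -> \bar R}) (f : T1 -> T2) (g : T2 -> T1) :
  sigma_finite setT m ->
  measurable_fun setT f -> measurable_fun setT g -> cancel f g ->
  exists m' : {sigma_finite_measure set T2 -> \bar R},
    (m' : set _ -> \bar R) = pushforward m f.
Proof.
move=> sfm mf mg fK.
pose mu : {measure set T2 -> \bar R} := measure_function_pushforward__canonical__measure_function_Measure m mf.
have sf : sigma_finite setT mu.
  have /sigma_finiteP[F [F_T F_nd F_oo]] := sfm.
  exists (fun k => g @^-1` F k).
    rewrite -preimage_bigcup -F_T preimage_setT//.
  move=> k; have [mF Foo] := F_oo k; split.
    by rewrite -[X in measurable X]setTI; exact: mg.
  rewrite /mu /= /pushforward.
  by rewrite (_ : f @^-1` _ = F k)//; apply/seteqP; split => x; rewrite /= fK.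
pose s := Measure_isSigmaFinite.Build _ _ _ mu sf.
pose m' : {sigma_finite_measure set T2 -> \bar R} := HB.pack (Measure.sort mu) mu s.
by exists m'.
Qed.

Lemma product_sigma_finite d d' (T1 : measurableType d) (T2 : measurableType d')
   (m1 : {sigma_finite_measure set T1 -> \bar R})
   (m2 : {sigma_finite_measure set T2 -> \bar R}) :
  sigma_finite setT (product_measure1 m1 m2).
Proof.
have /sigma_finiteP[F [TF ndF Foo]] := sigma_finiteT m1.
have /sigma_finiteP[G [TG ndG Goo]] := sigma_finiteT m2.
exists (fun k => F k `*` G k) => [|k]; last first.
  have [[mF Fk] [mG Gk]] := (Foo k, Goo k); split; first exact: measurableX.
  by rewrite product_measure1E// lte_mul_pinfty// ge0_fin_numE.
apply/esym; rewrite -subTset => -[x y] _.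
have [i _ Fx] : (\bigcup_i F i) x by rewrite -TF.
have [j _ Gy] : (\bigcup_i G i) y by rewrite -TG.
exists (i + j)%N => //; split => /=.
  by have /subsetPset := ndF _ _ (leq_addr j i); exact.
by have /subsetPset := ndG _ _ (leq_addl i j); exact.
Qed.

(** [tuple_lebesgue] and [volume] are bare set functions; a bundled sigma-finite measure with the
    same values opens them to Tonelli and monotone convergence. *)
Lemma tuple_lebesgue_measure n :
  exists m : {sigma_finite_measure set (n.-tuple (measurableTypeR R)) -> \bar R},
    (m : set _ -> \bar R) = @tuple_lebesgue R n.
Proof.
elim: n => [|n [m mE]].
  by exists (dirac (R := R) ([tuple] : 0.-tuple (measurableTypeR R))).
pose la : {sigma_finite_measure set (measurableTypeR R) -> \bar R} := @lebesgue_measure R.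
pose pr : {measure set (measurableTypeR R * n.-tuple (measurableTypeR R))%type -> \bar R} := product_measure1 la m.
have [||||m' m'E] := @pushforward_sfm _ _ (measurableTypeR R * n.-tuple (measurableTypeR R))%type _ pr
   (fun p : measurableTypeR R * n.-tuple (measurableTypeR R) => [tuple of p.1 :: p.2])
   (fun t => (thead t, [tuple of behead t])).
- exact: product_sigma_finite.
- exact: measurable_cons.
- apply: measurable_fun_pair; last exact: measurable_behead.
  exact: measurable_tnth.
- move=> [x t] /=; congr pair; apply: val_inj => //=.
- by exists m'; rewrite m'E /= -mE.
Qed.

Lemma lebV_exists n :
  exists m : {sigma_finite_measure set (borelRV R n) -> \bar R},
    (m : set _ -> \bar R) = @volume R n.
Proof.
have [m mE] := tuple_lebesgue_measure n.
have [m' m'E] := @pushforward_sfm _ _ _ _ m _ _ (sigma_finiteT m) (@measurable_rowt n) (@measurable_tupv n) (@rowtK n).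
by exists m'; rewrite m'E /volume -mE.
Qed.

Definition lebV n : {sigma_finite_measure set (borelRV R n) -> \bar R} :=
  projT1 (cid (lebV_exists n)).

Lemma lebVE n : (lebV n : set _ -> \bar R) = @volume R n.
Proof. by rewrite /lebV; case: cid. Qed.

Definition consv n (t : R) (x : 'rV[R]_n) : 'rV[R]_n.+1 :=
  \row_i (if unlift ord0 i is Some j then x 0 j else t).

Lemma consv0 n t (x : 'rV[R]_n) : consv t x 0 ord0 = t.
Proof. by rewrite mxE unlift_none. Qed.

Lemma consvS n t (x : 'rV[R]_n) j : consv t x 0 (lift ord0 j) = x 0 j.
Proof. by rewrite mxE liftK. Qed.

Lemma measurable_consv n :
  measurable_fun setT (fun p : measurableTypeR R * borelRV R n => consv p.1 p.2 : borelRV R n.+1).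
Proof.
apply: measurable_fun_rV => i; case: (unliftP ord0 i) => [j ->|->].
  rewrite (_ : (fun _ => _) = (fun p : measurableTypeR R * borelRV R n => p.2 0 j)); last first.
    by apply/funext => p; rewrite consvS.
  exact: (measurableT_comp (measurable_coord j)).
by apply: (@eq_measurable_funT _ _ _ _ _ fst) => // p; rewrite consv0.
Qed.

Lemma lebV_fubini n (F : borelRV R n.+1 -> \bar R) :
  measurable_fun setT F -> (forall x, 0 <= F x)%E ->
  (\int[lebV n.+1]_x F x = \int[@lebesgue_measure R]_t \int[lebV n]_x F (consv t x))%E.
Proof.
move=> mF F0.
have [m mE] := tuple_lebesgue_measure n.
have mphi : measurable_fun setT (fun p : measurableTypeR R * n.-tuple (measurableTypeR R) => consv p.1 (rowt p.2) : borelRV R n.+1).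
  have h : measurable_fun setT (fun p : measurableTypeR R * n.-tuple (measurableTypeR R) => (p.1, rowt p.2)).
    apply: measurable_fun_pair => //; exact: (measurable_compT (@measurable_rowt n) measurable_snd).
  exact: (measurable_compT (@measurable_consv n) h).
(* [volume] is built on tuples, so the product structure has to be carried through [rowt] first. *)
have -> : (lebV n.+1 : set _ -> \bar R) = pushforward (product_measure1 (@lebesgue_measure R) m) (fun p : measurableTypeR R * n.-tuple (measurableTypeR R) => consv p.1 (rowt p.2) : borelRV R n.+1).
  rewrite lebVE /volume; apply/funext => A /=; rewrite -mE; congr (product_measure1 _ _ _).
  apply/seteqP; split => -[t s] /=; congr (A _); apply/rowP => i; rewrite !mxE;
    (case: (unliftP ord0 i) => [j ->|->]; rewrite ?tnth0 ?tnthS ?mxE//).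
rewrite ge0_integral_pushforward//=; last first.
rewrite preimage_setT fubini_tonelli1//=.
- apply: eq_integral => t _; rewrite /fubini_F /=.
  have -> : (lebV n : set _ -> \bar R) = pushforward m (@rowt n).
    by rewrite lebVE /volume mE.
  rewrite ge0_integral_pushforward//=; first exact: measurable_rowt.
  have h : measurable_fun setT (fun x : borelRV R n => ((t : measurableTypeR R), x)) by exact: measurable_pair1.
  exact: (measurable_compT mF (measurable_compT (@measurable_consv n) h)).
- exact: (measurable_compT mF mphi).
Qed.

End vectors.

Lemma measure_indicE d (T : measurableType d) (R : realType)
    (m : {measure set T -> \bar R}) (A : set T) :
  measurable A -> m A = (\int[m]_x (\1_A x)%:E)%E.
Proof. by move=> mA; rewrite integral_indic// setIT. Qed.

Lemma indic_iff (R : realType) T U (A : set T) (B : set U) x y :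
  (A x <-> B y) -> \1_A x = \1_B y :> R.
Proof.
move=> h; rewrite !indicE; congr (nat_of_bool _)%:R.
exact: asbool_equiv_eq.
Qed.

(** * Changes of variables: dilations, reflections, shears, and null hyperplanes *)

Section change.
Context {R : realType}.
Local Notation la := (@lebesgue_measure R).

(** Multiplied by [c], the image measure agrees with Lebesgue measure on half-open intervals, and
    these determine it. *)
Lemma lebesgue_measure_affine (c b : R) (A : set R) : 0 < c ->
  measurable (A : set (measurableTypeR R)) ->
  la ((fun x => c * x + b) @^-1` A) = ((c^-1)%:E * la A)%E.
Proof.
move=> c0 mA.
have mf : measurable_fun setT (fun x : measurableTypeR R => c * x + b : measurableTypeR R).
  by apply: measurable_funD => //; apply: measurable_funM.
pose mu0 : {measure set (measurableTypeR R) -> \bar R} :=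
  measure_function_pushforward__canonical__measure_function_Measure la mf.
have cn0 : (0 <= c) by exact: ltW.
pose mu : {measure set (measurableTypeR R) -> \bar R} := mscale (NngNum cn0) mu0.
have -> : la A = mu A.
  apply: lebesgue_measure_unique => // _ [[x y]] _ <-.
  have pE : (fun x => c * x + b) @^-1` `]x, y] = `](x - b) / c, (y - b) / c]%classic.
    by apply/seteqP; split => z; rewrite /= !in_itv/= ltr_pdivrMr// ler_pdivlMr// ltrBlDr lerBrDr mulrC.
  rewrite (_ : mu _ = c%:E * la ((fun x => (c * x + b)%R) @^-1` `]x, y]))%E// pE.
  rewrite !lebesgue_measure_itv/= !lte_fin ltr_pM2r ?invr_gt0// ltrD2r.
  case: ifP => _; last by rewrite mule0.
  by rewrite -!EFinB -EFinM; congr EFin; field; rewrite gt_eqF.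
by rewrite /mu /mscale /= muleA -EFinM mulVf ?gt_eqF// mul1e.
Qed.

Lemma integral_affine (c b : R) (F : measurableTypeR R -> \bar R) : 0 < c ->
  measurable_fun setT F -> (forall x, 0 <= F x)%E ->
  (\int[la]_x F (c * x + b)%R = (c^-1)%:E * \int[la]_x F x)%E.
Proof.
move=> c0 mF F0.
have mf : measurable_fun setT (fun x : measurableTypeR R => c * x + b : measurableTypeR R).
  by apply: measurable_funD => //; apply: measurable_funM.
have cn0 : (0 <= c^-1) by rewrite invr_ge0 ltW.
rewrite -[RHS]/((NngNum cn0)%:num%:E * \int[la]_x F x)%E -ge0_integral_mscale//.
transitivity (\int[pushforward la ((fun x => (c * x + b)%R) : measurableTypeR R -> measurableTypeR R)]_x F x)%E.
  by rewrite ge0_integral_pushforward.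
by apply: eq_measure_integral => A mA _; rewrite /= /pushforward lebesgue_measure_affine.
Qed.

Lemma integral_opp (F : measurableTypeR R -> \bar R) :
  measurable_fun setT F -> (forall x, 0 <= F x)%E ->
  (\int[la]_x F (- x)%R = \int[la]_x F x)%E.
Proof.
move=> mF F0.
have mf : measurable_fun setT (fun x : measurableTypeR R => - x : measurableTypeR R) by exact: oppr_measurable.
transitivity (\int[pushforward la ((fun x => (- x)%R) : measurableTypeR R -> measurableTypeR R)]_x F x)%E.
  by rewrite ge0_integral_pushforward.
by apply: eq_measure_integral => A mA _; exact: lebesgue_measureN.
Qed.

Lemma lebV_fubini2 n (F : borelRV R n.+1 -> \bar R) :
  measurable_fun setT F -> (forall x, 0 <= F x)%E ->
  (\int[lebV n.+1]_x F x = \int[lebV n]_x \int[la]_t F (consv t x))%E.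
Proof.
move=> mF F0; rewrite lebV_fubini//.
rewrite (@fubini_tonelli _ _ _ _ _ la (lebV n) (fun p => F (consv p.1 p.2)))//.
exact: (measurable_compT mF (@measurable_consv R n)).
Qed.

Lemma measurable_consv1 n (t : R) : measurable_fun setT (fun x : borelRV R n => consv t x : borelRV R n.+1).
Proof.
have h : measurable_fun setT (fun x : borelRV R n => ((t : measurableTypeR R), x)) by exact: measurable_pair1.
exact: (measurable_compT (@measurable_consv R n) h).
Qed.

Lemma measurable_consv2 n (x : borelRV R n) : measurable_fun setT (fun t : measurableTypeR R => consv t x : borelRV R n.+1).
Proof.
have h : measurable_fun setT (fun t : measurableTypeR R => (t, x)) by exact: measurable_pair2.
exact: (measurable_compT (@measurable_consv R n) h).
Qed.

Lemma measurable_fiber n (F : borelRV R n.+1 -> \bar R) :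
  measurable_fun setT F -> (forall x, 0 <= F x)%E ->
  measurable_fun setT (fun t : measurableTypeR R => \int[lebV n]_x F (consv t x))%E.
Proof.
move=> mF F0.
by apply: (@measurable_fun_fubini_tonelli_F _ _ _ _ _ (lebV n) (fun p => F (consv p.1 p.2))) => //; exact: (measurable_compT mF (@measurable_consv R n)).
Qed.

Lemma lebV0 (F : borelRV R 0 -> \bar R) : measurable_fun setT F ->
  (\int[lebV 0]_x F x = F (0%R : 'rV[R]_0))%E.
Proof.
move=> mF.
have -> : F (0%R : 'rV[R]_0) = (\int[dirac ((0%R : 'rV[R]_0) : borelRV R 0)]_(x in [set: borelRV R 0]) F x)%E.
  by rewrite integral_dirac// diracE in_setT mul1e.
apply: eq_measure_integral => A mA _.
rewrite -[LHS]/((lebV 0 : set _ -> \bar R) A) lebVE /volume /= /dirac /=.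
congr EFin; apply: indic_iff => /=.
by rewrite (_ : \row_i _ = 0)//; apply/rowP => -[].
Qed.

Lemma lebV_scale n (c : R) (F : borelRV R n -> \bar R) : 0 < c ->
  measurable_fun setT F -> (forall x, 0 <= F x)%E ->
  (\int[lebV n]_x F (c *: x)%R = ((c ^+ n)^-1)%:E * \int[lebV n]_x F x)%E.
Proof.
move=> c0; elim: n F => [|n IH] F mF F0.
  rewrite expr0 invr1 mul1e !lebV0//; first by rewrite scaler0.
  by apply: (measurable_compT mF); apply: measurable_scaleV => //; exact: measurable_id.
have mS m : measurable_fun setT (fun x : borelRV R m => c *: x : borelRV R m).
  by apply: measurable_scaleV => //; exact: measurable_id.
rewrite lebV_fubini//; last exact: (measurable_compT mF (mS _)).
have cE t x : c *: consv t x = consv (c * t) (c *: x) :> 'rV[R]_n.+1.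
  by apply/rowP => i; rewrite !mxE; case: (unlift ord0 i) => [j|]; rewrite ?mxE.
under eq_integral => t _.
  under eq_integral => x _ do rewrite cE.
  rewrite (IH (fun x => F (consv (c * t) x)))//; last exact: (measurable_compT mF (measurable_consv1 _)).
  over.
rewrite ge0_integralZl//; last 3 first.
- have h : measurable_fun setT (fun t : measurableTypeR R => c * t : measurableTypeR R) by apply: measurable_funM.
  exact: (measurable_compT (measurable_fiber mF F0) h).
- by move=> t _; exact: integral_ge0.
- by rewrite lee_fin invr_ge0 exprn_ge0// ltW.
rewrite (_ : \int[_]_t _ = (c^-1)%:E * \int[la]_t \int[lebV n]_x F (consv t x))%E; last first.
  rewrite -(integral_affine 0 c0 (measurable_fiber mF F0)) => [|t]; last exact: integral_ge0.
  by apply: eq_integral => t _; rewrite addr0.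
by rewrite muleA -EFinM lebV_fubini// exprS invfM mulrC.
Qed.

Lemma measurable_oppV m : measurable_fun setT (fun x : borelRV R m => - x : borelRV R m).
Proof.
apply: measurable_fun_rV => i.
apply: (@eq_measurable_funT _ _ (borelRV R m) (measurableTypeR R) _ (fun x => - (x 0 i))) => [x|]; first by rewrite mxE.
by apply: (measurable_compT (@oppr_measurable R _) (@measurable_coord R m i)).
Qed.

Lemma lebV_opp n (F : borelRV R n -> \bar R) :
  measurable_fun setT F -> (forall x, 0 <= F x)%E ->
  (\int[lebV n]_x F (- x)%R = \int[lebV n]_x F x)%E.
Proof.
elim: n F => [|n IH] F mF F0.
  rewrite !lebV0//; first by rewrite oppr0.
  exact: (measurable_compT mF (@measurable_oppV _)).
have mS := measurable_oppV.
rewrite lebV_fubini//; last exact: (measurable_compT mF (mS _)).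
have cE t x : - consv t x = consv (- t) (- x) :> 'rV[R]_n.+1.
  by apply/rowP => i; rewrite !mxE; case: (unlift ord0 i) => [j|]; rewrite ?mxE.
under eq_integral => t _.
  under eq_integral => x _ do rewrite cE.
  rewrite (IH (fun x => F (consv (- t) x)))//; last exact: (measurable_compT mF (measurable_consv1 _)).
  over.
rewrite (integral_opp (measurable_fiber mF F0)); last by move=> t; exact: integral_ge0.
by rewrite lebV_fubini.
Qed.

(** For fixed [x] the shift by [phi x] is a translation in [t]. This evaluates volumes by slices
    along tilted hyperplanes. *)
Lemma lebV_shear n (phi : borelRV R n -> R) (F : borelRV R n.+1 -> \bar R) :
  measurable_fun setT phi ->
  measurable_fun setT F -> (forall x, 0 <= F x)%E ->
  (\int[la]_t \int[lebV n]_x F (consv (t + phi x) x) = \int[lebV n.+1]_x F x)%E.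
Proof.
move=> mphi mF F0.
have h : measurable_fun setT (fun p : measurableTypeR R * borelRV R n => consv (p.1 + phi p.2) p.2 : borelRV R n.+1).
  have h : measurable_fun setT (fun p : measurableTypeR R * borelRV R n => ((p.1 + phi p.2 : measurableTypeR R), p.2)).
    apply: measurable_fun_pair => //; apply: measurable_funD => //.
    exact: (measurable_compT mphi measurable_snd).
  exact: (measurable_compT (@measurable_consv R n) h).
rewrite (@fubini_tonelli _ _ _ _ _ la (lebV n) (fun p => F (consv (p.1 + phi p.2) p.2)))//; last first.
  exact: (measurable_compT mF h).
rewrite (lebV_fubini2 mF F0); apply: eq_integral => x _.
have := integral_affine (phi x) ltr01 (measurable_compT mF (@measurable_consv2 _ x)) (fun t => F0 _).
by rewrite invr1 mul1e => <-; apply: eq_integral => t _; rewrite mul1r.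
Qed.

(** If the first coordinate of [v] is nonzero, lines in that direction meet the hyperplane in one
    point; otherwise the slices are hyperplanes one dimension lower. *)
Lemma lebV_hyperplane n (v : 'rV[R]_n) (c : R) : v != 0 ->
  lebV n [set x | dotv x v = c] = 0%E.
Proof.
elim: n v c => [v c|n IH v c v0]; first by rewrite (_ : v = 0) ?eqxx//; apply/rowP => -[].
have mD m (w : 'rV[R]_m) : measurable_fun setT (fun x : borelRV R m => dotv x w).
  by apply: measurable_dotv; [exact: measurable_id|exact: measurable_cst].
have mH m (w : 'rV[R]_m) b : measurable ([set x | dotv x w = b] : set (borelRV R m)).
  by have := mD m w measurableT _ (measurable_set1 b); rewrite setTI.
pose w : 'rV[R]_n := \row_j v 0 (lift ord0 j).
have dE t x : dotv (consv t x) v = t * v 0 ord0 + dotv x w.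
  by rewrite /dotv big_ord_recl consv0; congr (_ + _); apply: eq_bigr => i _; rewrite consvS mxE.
rewrite measure_indicE//.
have mI : measurable_fun setT (fun x : borelRV R n.+1 => (\1_[set x | dotv x v = c] x : R)%:E).
  exact/measurable_EFinP/measurable_indic.
have [v00|v00] := eqVneq (v 0 ord0) 0.
  have w0 : w != 0.
    apply: contraNneq v0 => /rowP w0; apply/eqP/rowP => i; rewrite mxE.
    by case: (unliftP ord0 i) => [j ->|-> //]; have := w0 j; rewrite !mxE.
  rewrite lebV_fubini//.
  apply: integral0_eq => t _; rewrite -(IH w c w0) measure_indicE//.
  by apply: eq_integral => x _; congr EFin; apply: indic_iff => /=; rewrite dE v00 mulr0 add0r.
rewrite lebV_fubini2//.
apply: integral0_eq => x _.
rewrite -(lebesgue_measure_set1 ((c - dotv x w) / v 0 ord0)) measure_indicE//.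
apply: eq_integral => t _; congr EFin; apply: indic_iff => /=; rewrite dE.
by split => [<-|->]; rewrite ?addrK ?mulfK// divfK// subrK.
Qed.
End change.

(** * The Prekopa-Leindler inequality *)

Section oneD.
Context {R : realType}.
Local Notation la := (@lebesgue_measure R).
Local Notation mR := (measurableTypeR R).

Lemma measurable_ray_ge (r : R) : measurable ([set x | r <= x] : set mR).
Proof.
rewrite (_ : [set x | r <= x] = `[r, +oo[%classic); first exact: measurable_itv.
by apply/seteqP; split => x; rewrite /= in_itv/= andbT.
Qed.

(** Lets [A] be replaced by its part below one of its own points, as if it had a maximum. Continuity
    from below, along levels increasing to the supremum of [A], finite or not, recovers [A]. *)
Lemma le_measure_below (A : set R) (M : \bar R) :
  measurable (A : set mR) -> A !=set0 ->
  (forall a, A a -> (la (A `&` [set x | x < a]%R) <= M)%E) -> (la A <= M)%E.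
Proof.
move=> mA [a0 Aa0] hA.
have mB (r : R) : measurable ([set x | x <= r] : set mR) by rewrite -set_itvNyc; exact: measurable_itv.
have mB' (r : R) : measurable ([set x | x < r] : set mR) by rewrite -set_itvNyo; exact: measurable_itv.
have key (u : nat -> R) : {homo u : n m / (n <= m)%N >-> n <= m} ->
    (forall k, exists2 a, A a & u k < a) ->
    (la (\bigcup_k (A `&` [set x | x <= u k]%R)) <= M)%E.
  move=> undec hu.
  have cv : (la \o (fun k => A `&` [set x | x <= u k]))%R @ \oo --> la (\bigcup_k (A `&` [set x | x <= u k]%R)).
    apply: nondecreasing_cvg_mu => [k||i j ij].
    - exact: measurableI.
    - by apply: bigcupT_measurable => k; exact: measurableI.
    - by apply/subsetPset => x [Ax /= xi]; split => //=; exact: le_trans xi (undec _ _ ij).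
  rewrite -(cvg_lim _ cv)//; apply: lime_le; first by apply/cvg_ex; eexists; exact: cv.
  apply: nearW => k /=; have [a Aa ua] := hu k; apply: le_trans (hA a Aa).
  apply: le_measure; rewrite ?inE; [exact: measurableI|exact: measurableI|].
  by move=> x [Ax /= xu]; split => //=; exact: le_lt_trans ua.
have mK (u : nat -> R) : measurable (\bigcup_k (A `&` [set x | x <= u k]%R) : set mR).
  by apply: bigcupT_measurable => k; exact: measurableI.
have [/= ubA|nubA] := pselect (has_ubound A).
  have supA : has_sup A by split => //; exists a0.
  pose u k := sup A - k.+1%:R^-1.
  have := key u _ _; set B := \bigcup_k _ => hB.
  (* [sup A] may belong to [A] while lying above every [u k]; a single point is null. *)
  have -> : la A = la (B `|` (A `&` [set sup A])).
    congr (la _); apply/seteqP; split => [x Ax|x [[k _ []]//|[]//]].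
    have : x <= sup A by exact: ub_le_sup.
    have [xs _|xns] := eqVneq (x : R) (sup A); first by right; split.
    rewrite le_eqVlt (negbTE xns)/= => xs.
    left; have [k] := @ltr_add_invr R 0 (sup A - x) ltac:(by rewrite subr_gt0).
    by rewrite add0r => hk; exists k => //; split => //=; rewrite /u lerBrDr -lerBrDl ltW.
  have mAs : measurable (A `&` [set sup A] : set mR) by apply: measurableI => //; exact: measurable_set1.
  have mBB : measurable (B : set mR) by exact: mK.
  apply: le_trans (measureU2 la mBB mAs) _.
  rewrite [X in (_ + X)%E](_ : _ = 0)%E ?adde0; last first.
    apply/eqP; rewrite eq_le measure_ge0 andbT -(lebesgue_measure_set1 (sup A)).
    by apply: le_measure; rewrite ?inE.
  apply: hB => [i j ij|k].
    by rewrite /u lerD2l lerN2 lef_pV2 ?posrE// ler_nat.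
  have [|a Aa ha] := @sup_adherent R A k.+1%:R^-1 _ supA; first by rewrite invr_gt0.
  by exists a.
rewrite (_ : A = \bigcup_k (A `&` [set x | x <= k%:R]%R)).
  apply: key => [i j ij|k]; first by rewrite ler_nat.
  apply: contrapT => h; apply: nubA; exists k%:R => x Ax.
  by rewrite leNgt; apply/negP => kx; apply: h; exists x.
apply/seteqP; split => [x Ax|x [k _ []]//].
by exists (Num.truncn `|x|).+1 => //; split => //=; rewrite (le_trans (ler_norm x))// ltW// truncnS_gt.
Qed.

Lemma le_measure_above (A : set R) (M : \bar R) :
  measurable (A : set mR) -> A !=set0 ->
  (forall a, A a -> (la (A `&` [set x | a <= x]%R) <= M)%E) -> (la A <= M)%E.
Proof.
move=> mA [a0 Aa0] hA.
have mo : measurable_fun setT (-%R : mR -> mR) by exact: oppr_measurable.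
have mN (B : set R) : measurable (B : set mR) -> measurable (-%R @^-1` B : set mR).
  by move=> mB; rewrite -[X in measurable X]setTI; exact: mo.
have laN (B : set R) : measurable (B : set mR) -> la (-%R @^-1` B) = la B.
  by move=> mB; exact: lebesgue_measureN.
rewrite -laN//; apply: le_measure_below; [exact: mN|by exists (- a0); rewrite /= opprK|].
move=> a /= Aa; apply: le_trans (hA _ Aa).
have mB := measurable_ray_ge.
have mB' (r : R) : measurable ([set x | x < r] : set mR) by rewrite -set_itvNyo; exact: measurable_itv.
rewrite -[leRHS]laN; last by apply: measurableI.
apply: le_measure; rewrite ?inE; [by apply: measurableI => //; exact: mN|by apply: mN; exact: measurableI|].
by move=> x [/= Ax xa]; split => //=; rewrite lerN2 ltW.
Qed.

(** Let [A'] be the part of [A] below [a] and [B'] the part of [B] from [b] on. The sets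
    [(A' + b) / 2] and [(a + B') / 2] both lie in [C] and are separated by [(a + b) / 2], so their
    measures add up. Letting [a] and [b] vary then removes the truncations. *)
Lemma brunn_minkowski1 (A B C : set R) :
  measurable (A : set mR) -> measurable (B : set mR) -> measurable (C : set mR) ->
  A !=set0 -> B !=set0 ->
  (forall a b, A a -> B b -> C ((a + b) / 2)) ->
  (la A + la B <= 2%:E * la C)%E.
Proof.
move=> mA mB mC A0 B0 ABC.
have mge := measurable_ray_ge.
have mlt (r : R) : measurable ([set x | x < r] : set mR) by rewrite -set_itvNyo; exact: measurable_itv.
have [Coo|Cfin] := eqVneq (la C) +oo%E.
  by rewrite Coo gt0_muley ?leey// lte_fin.
have {}Cfin : la C \is a fin_num by rewrite ge0_fin_numE// lt_neqAle Cfin leey.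
have half a b : A a -> B b ->
    (la (A `&` [set x | x < a]%R) + la (B `&` [set x | b <= x]%R) <= 2%:E * la C)%E.
  move=> Aa Bb.
  set A' := A `&` _; set B' := B `&` _.
  have mA' : measurable (A' : set mR) by exact: measurableI.
  have mB' : measurable (B' : set mR) by exact: measurableI.
  have c0 : 0 < 2 :> R by [].
  have eA := lebesgue_measure_affine (- b) c0 mA'.
  have eB := lebesgue_measure_affine (- a) c0 mB'.
  have mf c : measurable_fun setT (fun x : mR => 2 * x + c : mR).
    by apply: measurable_funD => //; apply: measurable_funM.
  have mpA : measurable ((fun x => 2 * x - b) @^-1` A' : set mR).
    by rewrite -[X in measurable X]setTI; exact: mf.
  have mpB : measurable ((fun x => 2 * x - a) @^-1` B' : set mR).
    by rewrite -[X in measurable X]setTI; exact: mf.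
  move: eA eB mpA mpB; set pA := _ @^-1` A'; set pB := _ @^-1` B' => eA eB mpA mpB.
  have : (la pA + la pB <= la C)%E.
    rewrite -measureU//; last first.
      by rewrite -subset0 => x [[/= _ h1] [/= _ h2]]; lra.
    apply: le_measure; rewrite ?inE//; first exact: measurableU.
    move=> x [[/= h _]|[/= h _]].
      by have := ABC _ _ h Bb; rewrite subrK mulrC mulKf// gt_eqF.
    by have := ABC _ _ Aa h; rewrite addrC subrK mulrC mulKf// gt_eqF.
  rewrite eA eB -ge0_muleDr// => h.
  have := @lee_wpmul2l R 2%:E ltac:(by rewrite lee_fin) _ _ h.
  by rewrite muleA -EFinM mulfV ?gt_eqF// mul1e.
(* The truncations are removed one at a time, each with the other term moved across by subtraction,
   and this requires finiteness. *)
have Bfin b : B b -> la (B `&` [set x | b <= x]%R) \is a fin_num.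
  move=> Bb; have [a Aa] := A0; rewrite ge0_fin_numE//.
  have : (la (B `&` [set x | b <= x]%R) <= 2%:E * la C)%E.
    by apply: le_trans (half _ _ Aa Bb); rewrite leeDr.
  by move=> /le_lt_trans; apply; rewrite ltey_eq fin_numM.
have hA b : B b -> (la A <= 2%:E * la C - la (B `&` [set x | b <= x]%R))%E.
  move=> Bb; apply: le_measure_below => // a Aa.
  by rewrite leeBrDr ?Bfin//; exact: half.
have [b Bb] := B0.
have Afin : la A \is a fin_num.
  rewrite ge0_fin_numE//; apply: le_lt_trans (hA _ Bb) _.
  by rewrite ltey_eq fin_numB fin_numM// Bfin.
rewrite addeC -leeBrDr//; apply: le_measure_above => // b' Bb'.
by rewrite leeBrDr// addeC -leeBrDr ?Bfin//; exact: hA.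
Qed.


(** Tonelli on the region under the graph; the levels stop at 1 because [F] does. *)
Lemma layer_cake1 (F : mR -> \bar R) :
  measurable_fun setT F -> (forall x, 0 <= F x <= 1)%E ->
  (\int[la]_x F x = \int[la]_(l in `]0%R, 1%R[) la [set x | l%:E < F x])%E.
Proof.
move=> mF F01.
pose S := [set p : mR * mR | (0 < p.2 < 1)%R /\ (p.2%:E < F p.1)%E].
have m2 : measurable_fun setT (fun p : mR * mR => p.2%:E) by apply/measurable_EFinP; exact: measurable_snd.
have mS : measurable (S : set (mR * mR)).
  rewrite (_ : S = (setT `*` `]0%R, 1%R[) `&` (setT `&` [set p | (p.2%:E < F p.1)%E])).
    apply: measurableI; first by apply: measurableX => //; exact: measurable_itv.
    by apply: measurable_lte => //; exact: (measurable_compT mF measurable_fst).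
  by apply/seteqP; split => [[x l]/= [h1 h2]|[x l]/= [[_ h1] [_ h2]]]; split => //; rewrite /= in_itv in h1 *.
have mI : measurable_fun setT (fun p : mR * mR => (\1_S p : R)%:E).
  exact/measurable_EFinP/measurable_indic.
transitivity (\int[la]_x \int[la]_l (\1_S (x, l) : R)%:E)%E.
  apply: eq_integral => x _.
  have := F01 x => /andP[F0 F1].
  have Ff : F x \is a fin_num by rewrite ge0_fin_numE// (le_lt_trans F1)// ltey.
  rewrite -[in LHS](fineK Ff); have := F0; have := F1; rewrite -{1 2}(fineK Ff) !lee_fin => fF1 fF0.
  transitivity (la `]0%R, (fine (F x))%R[); first by rewrite lebesgue_measure_itv/= lte_fin sube0; case: ltP => // h; congr EFin; apply: le_anti; rewrite h fF0.
  rewrite measure_indicE//; apply: eq_integral => l _; congr EFin; apply: indic_iff.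
  have e : (l%:E < F x)%E = (l < fine (F x)) by rewrite -lte_fin fineK.
  rewrite /S /= in_itv/= e; split => [/andP[h1 h2]|[/andP[h1 _] ->]]; last by rewrite h1.
  by rewrite h1 h2 (lt_le_trans h2).
rewrite (@fubini_tonelli _ _ _ _ _ la la (fun p => (\1_S p)%:E))//.
rewrite [RHS]integral_mkcond; apply: eq_integral => l _; rewrite patchE.
case: ifPn => [|/negP]; rewrite inE /= in_itv/= => hl.
  rewrite measure_indicE; last by rewrite -[X in measurable X]setTI; apply: measurable_lte.
  by apply: eq_integral => x _; congr EFin; apply: indic_iff; rewrite /S /=; split => [[]|].
apply: integral0_eq => x _; rewrite indicE memNset// => -[h _].
exact: hl.
Qed.

Lemma layer_cake_measurable (F : mR -> \bar R) :
  measurable_fun setT F -> measurable_fun setT (fun l : mR => la [set x | l%:E < F x]%E).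
Proof.
move=> mF.
pose S := [set p : mR * mR | (p.2%:E < F p.1)%E].
have m2 : measurable_fun setT (fun p : mR * mR => p.2%:E) by apply/measurable_EFinP; exact: measurable_snd.
have mS : measurable (S : set (mR * mR)).
  rewrite -[S]setTI; apply: measurable_lte => //; exact: (measurable_compT mF measurable_fst).
apply: (@eq_measurable_funT _ _ _ _ _ (fun l => la (ysection S l))); last exact: measurable_fun_ysection.
by move=> l; congr (la _); apply/seteqP; split => x; rewrite /ysection /= ?inE.
Qed.

(** Every level set below 1 of [f] and of [g] is nonempty, so one-dimensional Brunn-Minkowski
    applies at each level. The sum on the left is stronger than the product form and is what decides
    the equality case. *)
Lemma prekopa_leindler_normalized (f g h : mR -> \bar R) :
  measurable_fun setT f -> measurable_fun setT g -> measurable_fun setT h ->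
  (forall x, 0 <= f x <= 1)%E -> (forall x, 0 <= g x <= 1)%E -> (forall x, 0 <= h x)%E ->
  (forall l : R, l < 1 -> exists x, (l%:E < f x)%E) ->
  (forall l : R, l < 1 -> exists x, (l%:E < g x)%E) ->
  (forall x y, f x * g y <= h ((x + y) / 2)%R * h ((x + y) / 2)%R)%E ->
  (\int[la]_x f x + \int[la]_x g x <= 2%:E * \int[la]_x mine (h x) 1)%E.
Proof.
move=> mf mg mh f01 g01 h0 supf supg fgh.
have mh1 : measurable_fun setT (fun x => mine (h x) 1%E) by apply: measurable_mine.
have h01 x : (0 <= mine (h x) 1 <= 1)%E by rewrite le_min h0 lee01/= ge_min lexx orbT.
have mset (F : mR -> \bar R) l : measurable_fun setT F -> measurable ([set x | l%:E < F x]%E : set mR).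
  by move=> mF; rewrite -[X in measurable X]setTI; apply: measurable_lte.
rewrite !layer_cake1// -ge0_integralD//=; last 2 first.
- by apply: measurable_funTS; exact: layer_cake_measurable.
- by apply: measurable_funTS; exact: layer_cake_measurable.
rewrite -ge0_integralZl//; last by apply: measurable_funTS; exact: layer_cake_measurable.
apply: ge0_le_integral => //.
- by move=> l _; rewrite adde_ge0.
- by apply: measurable_funTS; apply: emeasurable_funD; exact: layer_cake_measurable.
- by apply: measurable_funTS; apply: measurable_funeM; exact: layer_cake_measurable.
move=> l /=; rewrite in_itv/= => /andP[l0 l1].
apply: brunn_minkowski1; [exact: mset..|have [x hx] := supf _ l1; by exists x|have [x hx] := supg _ l1; by exists x|].
(* At a midpoint with [h <= l] the hypothesis would give [f a * g b <= l * l], although both factors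
   exceed [l]. *)
move=> a b /= fa gb; rewrite lt_min lte_fin l1 andbT ltNge; apply/negP => hl.
have := fgh a b; rewrite leNgt => /negP; apply.
apply: (@le_lt_trans _ _ (l%:E * l%:E)%E).
  by apply: lee_pmul.
apply: (@lt_trans _ _ (f a * l%:E)%E).
  by rewrite lte_pmul2r// lte_fin.
have fa0 : (0 < f a)%E by apply: lt_trans fa; rewrite lte_fin.
rewrite lte_pmul2l//.
by rewrite ge0_fin_numE ?ltW//; apply: (@le_lt_trans _ _ 1%E); [by case/andP: (f01 a)|exact: ltry].
Qed.

End oneD.

Section PL.
Context {R : realType}.
Local Notation la := (@lebesgue_measure R).
Local Notation mR := (measurableTypeR R).

(** Dividing [f] and [g] by their suprema, and [h] by the geometric mean of these, keeps the
    midpoint hypothesis. *)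
Lemma prekopa_leindler_sup (f g h : mR -> \bar R) (a b : R) : 0 < a -> 0 < b ->
  measurable_fun setT f -> measurable_fun setT g -> measurable_fun setT h ->
  (forall x, 0 <= f x <= a%:E)%E -> (forall x, 0 <= g x <= b%:E)%E -> (forall x, 0 <= h x)%E ->
  (forall l : R, l < a -> exists x, (l%:E < f x)%E) ->
  (forall l : R, l < b -> exists x, (l%:E < g x)%E) ->
  (forall x y, f x * g y <= h ((x + y) / 2)%R * h ((x + y) / 2)%R)%E ->
  (a^-1%:E * \int[la]_x f x + b^-1%:E * \int[la]_x g x
    <= 2%:E * \int[la]_x mine ((Num.sqrt (a * b))^-1%:E * h x) 1)%E.
Proof.
move=> a0 b0 mf mg mh f0 g0 h0 supf supg fgh.
set s := Num.sqrt (a * b).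
have s0 : 0 < s by rewrite sqrtr_gt0 mulr_gt0.
have ss : s^-1 * s^-1 = a^-1 * b^-1 by rewrite -invfM -expr2 sqr_sqrtr ?mulr_ge0 ?ltW// invfM.
have inv0 c : 0 < c -> (0 <= c^-1%:E :> \bar R)%E by move=> c0; rewrite lee_fin invr_ge0 ltW.
rewrite -(ge0_integralZl _ _ mf) ?inv0// -?(ge0_integralZl _ _ mg) ?inv0//; last 2 first.
- by move=> x _; case/andP: (g0 x).
- by move=> x _; case/andP: (f0 x).
have nrm (c : R) (F : mR -> \bar R) : 0 < c -> (forall x, 0 <= F x <= c%:E)%E -> forall x, (0 <= c^-1%:E * F x <= 1)%E.
  move=> c0 F0 x; have /andP[F1 F2] := F0 x; rewrite mule_ge0 ?inv0//=.
  by have := lee_wpmul2l (inv0 _ c0) F2; rewrite -EFinM mulVf ?gt_eqF.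
have snrm (c : R) (F : mR -> \bar R) : 0 < c -> (forall x, 0 <= F x <= c%:E)%E ->
   (forall l : R, l < c -> exists x, (l%:E < F x)%E) -> forall l : R, l < 1 -> exists x, (l%:E < c^-1%:E * F x)%E.
  move=> c0 F0 supF l l1; have [|x hx] := supF (c * l); first by rewrite gtr_pMr.
  exists x; have Ff : F x \is a fin_num.
    by have /andP[F1 F2] := F0 x; rewrite ge0_fin_numE// (le_lt_trans F2)// ltry.
  by move: hx; rewrite -(fineK Ff) -EFinM !lte_fin ltr_pdivlMl.
apply: prekopa_leindler_normalized; try exact: measurable_funeM; try exact: nrm; try exact: snrm.
- by move=> x; rewrite mule_ge0// inv0.
move=> x y; set z := (x + y) / 2.
rewrite muleACA -EFinM [leRHS]muleACA -EFinM ss; apply: lee_wpmul2l; last exact: fgh.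
by rewrite lee_fin mulr_ge0 ?invr_ge0 ?ltW.
Qed.

(** The additive form and the arithmetic-geometric mean inequality give the product form. *)
Lemma prekopa_leindler_bounded (f g h : mR -> \bar R) (C : R) :
  measurable_fun setT f -> measurable_fun setT g -> measurable_fun setT h ->
  (forall x, 0 <= f x <= C%:E)%E -> (forall x, 0 <= g x <= C%:E)%E -> (forall x, 0 <= h x)%E ->
  (forall x y, f x * g y <= h ((x + y) / 2)%R * h ((x + y) / 2)%R)%E ->
  ((\int[la]_x f x) * (\int[la]_x g x) <= (\int[la]_x h x) * (\int[la]_x h x))%E.
Proof.
move=> mf mg mh fC gC h0 fgh.
have H0 : (0 <= \int[la]_x h x)%E by exact: integral_ge0.
(* Splits off the functions with supremum 0, which cannot be normalised. *)
have supE (F : mR -> \bar R) : (forall x, 0 <= F x <= C%:E)%E ->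
    (\int[la]_x F x = 0)%E \/ exists2 a : R, 0 < a & (forall x, 0 <= F x <= a%:E)%E /\ (forall l : R, l < a -> exists x, (l%:E < F x)%E).
  move=> FC; pose s := ereal_sup (range F).
  have sC : (s <= C%:E)%E by apply: ge_ereal_sup => _ [x _ <-]; case/andP: (FC x).
  have s0 : (0 <= s)%E.
    by apply: (@le_trans _ _ (F 0)); [by case/andP: (FC 0)|apply: ereal_sup_ubound; exists 0].
  have sf : s \is a fin_num by rewrite ge0_fin_numE// (le_lt_trans sC)// ltry.
  have Fs x : (F x <= s)%E by apply: ereal_sup_ubound; exists x.
  have [s00|sn0] := eqVneq s 0%E.
    left; apply: integral0_eq => x _; apply/eqP; rewrite eq_le; case/andP: (FC x) => -> _.
    by rewrite -s00 Fs.
  right; exists (fine s); first by rewrite fine_gt0// lt_neqAle eq_sym sn0 s0 ltey_eq sf.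
  split => [x|l]; first by rewrite fineK// Fs; case/andP: (FC x) => ->.
  rewrite -lte_fin fineK// => /ereal_sup_gt [_ [x _ <-] hx]; by exists x.
have [->|[a a0 [fa supf]]] := supE f fC; first by rewrite mul0e mule_ge0.
have [->|[b b0 [gb supg]]] := supE g gC; first by rewrite mule0 mule_ge0.
have := prekopa_leindler_sup a0 b0 mf mg mh fa gb h0 supf supg fgh.
set s := Num.sqrt (a * b).
have s0 : 0 < s by rewrite sqrtr_gt0 mulr_gt0.
have [->|Hn] := eqVneq (\int[la]_x h x)%E +oo%E; first by move=> _; rewrite mulyy leey.
have Hf : (\int[la]_x h x)%E \is a fin_num by rewrite ge0_fin_numE// ltey.
have le1 : (\int[la]_x mine (s^-1%:E * h x) 1 <= s^-1%:E * \int[la]_x h x)%E.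
  rewrite -ge0_integralZl//; last by rewrite lee_fin invr_ge0 ltW.
  have s00 : (0 <= s^-1%:E)%E by rewrite lee_fin invr_ge0 ltW.
  apply: ge0_le_integral => //.
  - by move=> x _; rewrite le_min lee01 mule_ge0.
  - by apply: measurable_mine => //; exact: measurable_funeM.
  - exact: measurable_funeM.
  - by move=> x _; rewrite ge_min lexx.
move=> le2; have {le1 le2} := le_trans le2 (lee_wpmul2l (ltac:(by rewrite lee_fin) : (0 <= 2%:E)%E) le1).
have F0 : (0 <= \int[la]_x f x)%E by apply: integral_ge0 => x _; case/andP: (fC x).
have G0 : (0 <= \int[la]_x g x)%E by apply: integral_ge0 => x _; case/andP: (gC x).
set F := (\int[la]_x f x)%E in F0 *; set G := (\int[la]_x g x)%E in G0 *; set H := (\int[la]_x h x)%E in H0 Hf *.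
have c2 : (2%:E * (s^-1%:E * H) < +oo)%E by rewrite ltey_eq !fin_numM.
have Gge : (0 <= b^-1%:E * G)%E by rewrite mule_ge0// lee_fin invr_ge0 ltW.
have Fge : (0 <= a^-1%:E * F)%E by rewrite mule_ge0// lee_fin invr_ge0 ltW.
move=> hle; have {c2} := le_lt_trans hle c2.
case: F F0 Fge hle => [F| |]// F0 Fge hle; last first.
  by rewrite gt0_muley ?lte_fin ?invr_gt0// addye// ?ltxx// -ltNye (lt_le_trans _ Gge).
case: G G0 Gge hle => [G| |]// G0 Gge hle; last first.
  by rewrite (gt0_muley (x := b^-1%:E)) ?lte_fin ?invr_gt0// addey// ltxx.
move=> _; move: Hf hle; case: H H0 => [H| |]// H0 _.
rewrite -!EFinM -EFinD !lee_fin => hle; rewrite !lee_fin in F0 G0 H0.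
have ss : s ^+ 2 = a * b by rewrite sqr_sqrtr// mulr_ge0// ltW.
have e1 : s * (a^-1 * F + b^-1 * G) <= 2 * H.
  by have := ler_wpM2l (ltW s0) hle; rewrite (_ : s * (2 * _) = 2 * H)//; field; rewrite gt_eqF.
have e2 : (s * (a^-1 * F + b^-1 * G)) ^+ 2 <= (2 * H) ^+ 2.
  by rewrite ler_sqr ?nnegrE ?mulr_ge0// ?addr_ge0// ?mulr_ge0// ?invr_ge0 ltW.
(* This is [(p + q) ^+ 2 = 4 * p * q + (p - q) ^+ 2], in which [s ^+ 2 = a * b] cancels the
   normalisation. *)
have e3 : (s * (a^-1 * F + b^-1 * G)) ^+ 2 = 4 * (F * G) + s ^+ 2 * (a^-1 * F - b^-1 * G) ^+ 2.
  rewrite [LHS]exprMn [in LHS]ss [in RHS]ss; field; by rewrite !gt_eqF.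
have : 0 <= s ^+ 2 * (a^-1 * F - b^-1 * G) ^+ 2 by rewrite mulr_ge0 ?sqr_ge0.
nra.
Qed.

Lemma cvg_integral_trunc d (T : measurableType d) (m : {measure set T -> \bar R}) (f : T -> \bar R) :
  measurable_fun setT f -> (forall x, 0 <= f x)%E ->
  (\int[m]_x mine (f x) k%:R%:E @[k --> \oo] --> \int[m]_x f x)%E.
Proof.
move=> mf f0.
have cv x : (mine (f x) k%:R%:E @[k --> \oo] --> f x)%E.
  have := f0 x; case: (f x) => [r| |]// r0.
    apply: cvg_near_cst; exists (Num.truncn r).+1 => // k /= hk; apply/eqP.
    rewrite eq_minl// lee_fin (le_trans (ltW (truncnS_gt r)))// ler_nat//.
  rewrite (_ : (fun k => _) = (fun k => k%:R%:E)); last by apply/funext => k; rewrite minye.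
  by apply/cvgeryP; exact: cvgr_idn.
rewrite (_ : \int[m]_x f x = \int[m]_x limn (fun k => mine (f x) k%:R%:E))%E; last first.
  by apply: eq_integral => x _; rewrite (cvg_lim _ (cv x)).
apply: cvg_monotone_convergence => //.
- by move=> k; apply: measurable_mine => //; exact: measurable_cst.
- by move=> k x _; rewrite le_min f0 lee_fin ler0n.
- by move=> x _ i j ij; rewrite le_min ge_min lexx/= ge_min lee_fin ler_nat ij orbT.
Qed.

(** Truncation at height [k] only decreases [f] and [g], so the bounded case applies before passing
    to the limit. *)
Lemma prekopa_leindler1 (f g h : mR -> \bar R) :
  measurable_fun setT f -> measurable_fun setT g -> measurable_fun setT h ->
  (forall x, 0 <= f x)%E -> (forall x, 0 <= g x)%E -> (forall x, 0 <= h x)%E ->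
  (forall x y, f x * g y <= h ((x + y) / 2)%R * h ((x + y) / 2)%R)%E ->
  ((\int[la]_x f x) * (\int[la]_x g x) <= (\int[la]_x h x) * (\int[la]_x h x))%E.
Proof.
move=> mf mg mh f0 g0 h0 fgh.
have H0 : (0 <= \int[la]_x h x)%E by exact: integral_ge0.
(* Zero integrals are set aside so that the limit of the product is not of the form [0 * +oo]. *)
have [->|F0] := eqVneq (\int[la]_x f x)%E 0%E; first by rewrite mul0e mule_ge0.
have [->|G0] := eqVneq (\int[la]_x g x)%E 0%E; first by rewrite mule0 mule_ge0.
have cv : ((\int[la]_x mine (f x) k%:R%:E) * (\int[la]_x mine (g x) k%:R%:E) @[k --> \oo] -->
   (\int[la]_x f x) * (\int[la]_x g x))%E.
  apply: cvgeM; [|exact: cvg_integral_trunc..].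
  by apply: neq0_mule_def; rewrite mule_neq0.
rewrite -(cvg_lim _ cv)//; apply: lime_le; first by apply/cvg_ex; eexists; exact: cv.
apply: nearW => k; apply: (@prekopa_leindler_bounded _ _ _ k%:R) => //.
- by apply: measurable_mine => //; exact: measurable_cst.
- by apply: measurable_mine => //; exact: measurable_cst.
- by move=> x; rewrite le_min f0 lee_fin ler0n/= ge_min lexx orbT.
- by move=> x; rewrite le_min g0 lee_fin ler0n/= ge_min lexx orbT.
move=> x y; apply: le_trans (fgh x y).
by apply: lee_pmul; rewrite ?le_min ?f0 ?g0 ?lee_fin ?ler0n// ge_min lexx.
Qed.

(** Induction on the dimension: by the case [n], the integrals over the slices satisfy the
    one-dimensional hypothesis. *)
Lemma prekopa_leindler n (f g h : borelRV R n -> \bar R) :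
  measurable_fun setT f -> measurable_fun setT g -> measurable_fun setT h ->
  (forall x, 0 <= f x)%E -> (forall x, 0 <= g x)%E -> (forall x, 0 <= h x)%E ->
  (forall x y, f x * g y <= h (2^-1 *: (x + y))%R * h (2^-1 *: (x + y))%R)%E ->
  ((\int[lebV n]_x f x) * (\int[lebV n]_x g x) <= (\int[lebV n]_x h x) * (\int[lebV n]_x h x))%E.
Proof.
elim: n f g h => [|n IH] f g h mf mg mh f0 g0 h0 fgh.
  by have := fgh 0 0; rewrite !lebV0// addr0 scaler0.
rewrite !lebV_fubini//; apply: prekopa_leindler1;
  [exact: measurable_fiber|exact: measurable_fiber|exact: measurable_fiber
  |by move=> x; exact: integral_ge0..|].
move=> s t; have mc := @measurable_consv1 R n.
apply: IH => //; [exact: (measurable_compT mf (mc _))|exact: (measurable_compT mg (mc _))|exact: (measurable_compT mh (mc _))|].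
move=> x y; have := fgh (consv s x) (consv t y).
rewrite (_ : 2^-1 *: _ = consv ((s + t) / 2) (2^-1 *: (x + y)))//.
by apply/rowP => i; rewrite !mxE; case: (unlift ord0 i) => [j|]; rewrite ?mxE// mulrC.
Qed.

End PL.

(** * Equality in the Prekopa-Leindler inequality *)

Section PLeq.
Context {R : realType}.
Local Notation la := (@lebesgue_measure R).
Local Notation mR := (measurableTypeR R).

Lemma limn_einfE (u : (\bar R)^nat) : limn_einf u = ereal_sup (range (einfs u)).
Proof. by rewrite limn_einf_lim (cvg_lim _ (@cvg_einfs_sup _ u)). Qed.

Lemma le_limn_einf (u : (\bar R)^nat) c :
  (\forall k \near \oo, (c <= u k)%E) -> (c <= limn_einf u)%E.
Proof.
move=> [N _ hN]; rewrite limn_einfE; apply: (@le_trans _ _ (einfs u N)).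
  by apply: le_ereal_inf_tmp => _ [k /= Nk <-]; exact: hN.
by apply: ereal_sup_ubound; exists N.
Qed.

Lemma limn_einf_le (u : (\bar R)^nat) c :
  (forall k, (u k <= c)%E) -> (limn_einf u <= c)%E.
Proof.
move=> uc; rewrite limn_einfE; apply: ge_ereal_sup => _ [N _ <-].
by apply: le_trans (uc N); apply: ereal_inf_lbound; exists N => /=.
Qed.

(** If the integrals stayed at most [c] along some sequence tending to 0, Fatou's lemma would bound
    the integral at 0 by [c]. The pointwise hypothesis is the one met by indicators of open sets. *)
Lemma integral_lsc d (T : measurableType d) (m : {measure set T -> \bar R})
    (F : R -> T -> \bar R) :
  (forall y, measurable_fun setT (F y)) -> (forall y x, 0 <= F y x)%E ->
  (forall x, \forall y \near 0%R, F 0%R x <= F y x)%E ->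
  forall c, (c < \int[m]_x F 0%R x)%E -> \forall y \near 0%R, (c < \int[m]_x F y x)%E.
Proof.
move=> mF F0 Fl c hc; apply: contrapT => nh.
have /choice [y hy] : forall k, exists y : R, `|y| < k.+1%:R^-1 /\ (\int[m]_x F y x <= c)%E.
  move=> k; apply: contrapT => h; apply: nh.
  apply/nbhs_ballP; exists k.+1%:R^-1 => /=; first by rewrite invr_gt0.
  move=> y; rewrite -ball_normE/= sub0r normrN => yk.
  by rewrite ltNge; apply/negP => hc'; apply: h; exists y.
have y0 : y @ \oo --> 0.
  apply/cvgrPdist_lt => e e0; have [N hN] := @ltr_add_invr R 0 e e0.
  exists N => // k /= Nk; rewrite sub0r normrN; have [yk _] := hy k.
  apply: lt_trans yk _; apply: le_lt_trans hN; rewrite add0r.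
  by rewrite lef_pV2 ?posrE// ler_nat.
have : (\int[m]_x F 0%R x <= c)%E.
  apply: (@le_trans _ _ (\int[m]_x limn_einf (fun k => F (y k) x))%E).
    apply: ge0_le_integral => //.
    - apply: (@eq_measurable_funT _ _ _ _ _ (fun x => - limn_esup (fun k => - F (y k) x))%E).
        by move=> x; rewrite -limn_einfN; congr limn_einf; apply/funext => k /=; rewrite oppeK.
      apply: measurableT_comp => //; apply: measurable_fun_limn_esup => k.
      exact: measurableT_comp.
    - by move=> x _; apply: le_limn_einf; exact: (y0 _ (Fl x)).
  apply: le_trans (fatou _ _ _ _) _ => //.
  by apply: limn_einf_le => k; have [] := hy k.
by rewrite leNgt hc.
Qed.

(** With maxima [a] and [b] at 0 and [s] their geometric mean, the additive form gives
    [I / a + I / b <= 2 * I / s], which forces [a = b]. Truncating [h / s] at 1 then loses no mass,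
    and lower semicontinuity turns this into [h 0 <= a]. *)
Lemma prekopa_leindler_equality (f g h : mR -> \bar R) (I : R) : 0 < I ->
  measurable_fun setT f -> measurable_fun setT g -> measurable_fun setT h ->
  (forall x, 0 <= f x <= f 0%R)%E -> (forall x, 0 <= g x <= g 0%R)%E -> (forall x, 0 <= h x)%E ->
  (f 0%R < +oo)%E -> (g 0%R < +oo)%E ->
  (forall x y, f x * g y <= h ((x + y) / 2)%R * h ((x + y) / 2)%R)%E ->
  (forall c, c < h 0%R -> \forall y \near 0%R, c < h y)%E ->
  (\int[la]_x f x = I%:E)%E -> (\int[la]_x g x = I%:E)%E -> (\int[la]_x h x = I%:E)%E ->
  f 0%R = g 0%R /\ h 0%R = f 0%R.
Proof.
move=> I0 mf mg mh f0 g0 h0 foo goo fgh hlsc fI gI hI.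
have pos (F : mR -> \bar R) : (forall x, 0 <= F x <= F 0%R)%E -> (F 0%R < +oo)%E ->
    (\int[la]_x F x = I%:E)%E -> exists2 a : R, 0 < a & F 0%R = a%:E.
  move=> F0 Foo FI; have /andP[F00 _] := F0 0.
  have Ff : F 0%R \is a fin_num by rewrite ge0_fin_numE.
  exists (fine (F 0%R)); last by rewrite fineK.
  rewrite lt0r fine_ge0// andbT; apply/negP => /eqP F0e.
  have : (\int[la]_x F x = 0)%E.
    apply: integral0_eq => x _; apply/eqP; rewrite eq_le.
    by have /andP[-> h1] := F0 x; rewrite andbT -[0%E]/(0%R%:E) -F0e fineK.
  by move/eqP; rewrite FI eqe gt_eqF.
have [a a0 fa] := pos f f0 foo fI; have [b b0 gb] := pos g g0 goo gI.
set s := Num.sqrt (a * b).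
have s0 : 0 < s by rewrite sqrtr_gt0 mulr_gt0.
have sinv : (0 <= s^-1%:E)%E by rewrite lee_fin invr_ge0 ltW.
pose H := (fun x => s^-1%:E * h x)%E.
have mH : measurable_fun setT H by exact: measurable_funeM.
have H0 x : (0 <= H x)%E by rewrite mule_ge0.
have mH1 : measurable_fun setT (fun x => mine (H x) 1%E) by exact: measurable_mine.
have H10 x : (0 <= mine (H x) 1)%E by rewrite le_min H0 lee01.
have HI : (\int[la]_x H x = (s^-1 * I)%:E)%E by rewrite ge0_integralZl// hI EFinM.
have le1 : ((a^-1 * I + b^-1 * I)%:E <= 2%:E * \int[la]_x mine (H x) 1)%E.
  rewrite EFinD !EFinM -{1}fI -gI; apply: prekopa_leindler_sup => //.
  - by move=> x; rewrite -fa.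
  - by move=> x; rewrite -gb.
  - by move=> l la1; exists 0; rewrite fa lte_fin.
  - by move=> l la1; exists 0; rewrite gb lte_fin.
have le2 : (\int[la]_x mine (H x) 1 <= (s^-1 * I)%:E)%E.
  rewrite -HI; apply: ge0_le_integral => // x _; first by rewrite ge_min lexx.
have ab : a = b.
  have : (2%:E * \int[la]_x mine (H x) 1 <= 2%:E * (s^-1 * I)%:E)%E by apply: lee_wpmul2l.
  move/(le_trans le1); rewrite -EFinM lee_fin => hle.
  have ss : s ^+ 2 = a * b by rewrite sqr_sqrtr// mulr_ge0// ltW.
  have h1 : a^-1 + b^-1 <= 2 * s^-1 by rewrite -(ler_pM2r I0) mulrDl -mulrA.
  have h2 : a + b <= 2 * s.
    have := ler_wpM2l (ltW (mulr_gt0 s0 s0)) h1; rewrite -expr2 [in leLHS]ss => h2.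
    have e1 : a * b * (a^-1 + b^-1) = a + b by field; rewrite !gt_eqF.
    have e2 : s ^+ 2 * (2 * s^-1) = 2 * s by field; rewrite gt_eqF.
    by rewrite -e1 -e2.
  have : (a - b) ^+ 2 <= 0.
    have : (a + b) ^+ 2 <= (2 * s) ^+ 2 by rewrite ler_sqr// nnegrE ?addr_ge0 ?mulr_ge0// ltW.
    by rewrite exprMn ss => h3; nra.
  by rewrite le_eqVlt sqrf_eq0 ltNge sqr_ge0 orbF subr_eq0 => /eqP.
split; first by rewrite fa gb ab.
have sa : s = a by rewrite /s -ab -expr2 sqrtr_sqr gtr0_norm.
have le3 : ((s^-1 * I)%:E <= \int[la]_x mine (H x) 1)%E.
  have Xf : (\int[la]_x mine (H x) 1)%E \is a fin_num.
    by rewrite ge0_fin_numE ?integral_ge0// (le_lt_trans le2)// ltry.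
  move: le1; rewrite -(fineK Xf) -EFinM !lee_fin -ab sa => le1; lra.
apply/eqP; rewrite eq_le; apply/andP; split; last first.
  have := fgh 0 0; rewrite addr0 mul0r fa gb -ab => h1.
  rewrite leNgt; apply/negP => h2.
  have hf : h 0%R \is a fin_num by rewrite ge0_fin_numE// (lt_trans h2)// ltry.
  move: h1 h2; rewrite -(fineK hf) -!EFinM lee_fin lte_fin => h1 h2.
  have : 0 <= fine (h 0%R) by rewrite fine_ge0.
  nra.
rewrite leNgt; apply/negP => ha.
have [c ac ch] : exists2 c : R, a < c & (c%:E < h 0%R)%E.
  rewrite fa in ha; case: (h 0%R) ha => [r| |]//.
  - rewrite lte_fin => ar; exists ((a + r) / 2); first by rewrite midf_lt.
    by rewrite lte_fin; rewrite midf_lt.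
  - by move=> _; exists (a + 1); rewrite ?ltry// ltrDl.
have /nbhs_ballP [e /= e0 he] := hlsc _ ch.
pose B0 : set R := ball 0 e.
(* On this ball [h / s] exceeds its truncation by at least [c / a - 1], a surplus of mass for which
   the equal integrals leave no room. *)
have : ((s^-1 * I)%:E + (c / a - 1)%:E * la B0 <= (s^-1 * I)%:E)%E.
  have mb : measurable (B0 : set mR) by exact: measurable_ball.
  apply: (@le_trans _ _ (\int[la]_x mine (H x) 1 + (c / a - 1)%:E * la B0)%E).
    by rewrite leeD2r.
  have ca0 : 0 <= c / a - 1 by rewrite subr_ge0 ler_pdivlMr// mul1r ltW.
  rewrite measure_indicE// -ge0_integralZl//; last exact/measurable_EFinP/measurable_indic.
  rewrite -ge0_integralD//; last 2 first.
  - by move=> x _; rewrite mule_ge0// lee_fin.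
  - by apply: measurable_funeM; exact/measurable_EFinP/measurable_indic.
  rewrite -HI; apply: ge0_le_integral => //.
  - by move=> x _; rewrite adde_ge0// mule_ge0// lee_fin.
  - by apply: emeasurable_funD => //; apply: measurable_funeM; exact/measurable_EFinP/measurable_indic.
  move=> x _; rewrite indicE; case: (boolP (x \in B0)) => [|_]; last first.
    by rewrite mule0 adde0 ge_min lexx.
  rewrite inE => /he hx; rewrite mule1.
  apply: (@le_trans _ _ (1 + (c / a - 1)%:E)%E); first by rewrite leeD2r// ge_min lexx orbT.
  rewrite -EFinD addrC subrK /H sa mulrC EFinM; apply: lee_wpmul2l; first by rewrite -sa.
  exact: ltW.
have -> : la B0 = (e *+ 2)%:E by apply: lebesgue_measure_ball; exact: ltW.
rewrite -EFinM -EFinD lee_fin gerDl.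
rewrite leNgt => /negP; apply; rewrite mulr_gt0//; first by rewrite subr_gt0 ltr_pdivlMr// mul1r.
by rewrite mulrn_wgt0.
Qed.


Lemma integral_indic_ball (c r : R) : 0 <= r ->
  (\int[la]_x (\1_(ball c r : set R) x)%:E = (r *+ 2)%:E)%E.
Proof.
move=> r0; rewrite -(lebesgue_measure_ball c r0) [RHS]measure_indicE//.
exact: measurable_ball.
Qed.

Definition boxV n (c : 'rV[R]_n) (r : R) : set (borelRV R n) :=
  [set x | forall i, `|c 0 i - x 0 i| < r].

Lemma boxVE n (c : 'rV[R]_n) (r : R) : 0 < r -> boxV c r = ball c r.
Proof. by move=> r0; apply/seteqP; split => x; rewrite rV_ballP. Qed.

Lemma measurable_boxV n (c : 'rV[R]_n) (r : R) : 0 < r -> measurable (boxV c r).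
Proof. by move=> r0; rewrite boxVE//; apply: measurable_open; exact: ball_open. Qed.

Lemma lebV_box n (c : 'rV[R]_n) (r : R) : 0 < r ->
  lebV n (boxV c r) = ((2 * r) ^+ n)%:E.
Proof.
move=> r0; have mB m (d : 'rV[R]_m) := measurable_boxV d r0.
have mI m (d : 'rV[R]_m) : measurable_fun setT (fun x : borelRV R m => (\1_(boxV d r) x : R)%:E).
  exact/measurable_EFinP/measurable_indic.
elim: n c => [|n IH] c.
  by rewrite measure_indicE// lebV0// expr0 indicE mem_set// => -[].
rewrite measure_indicE// lebV_fubini//.
pose d : 'rV[R]_n := \row_j c 0 (lift ord0 j).
pose B0 : set R := ball (c 0 ord0) r.
have mB0 : measurable (B0 : set mR) by exact: measurable_ball.
transitivity (\int[la]_t (((2 * r) ^+ n)%:E * (\1_B0 t)%:E))%E.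
  apply: eq_integral => t _; case: (pselect (B0 t)) => Bt.
    rewrite indicE mem_set// mule1 -(IH d) measure_indicE//; apply: eq_integral => x _.
    congr EFin; apply: indic_iff; split => /= h i.
      by have := h (lift ord0 i); rewrite consvS mxE.
    case: (unliftP ord0 i) => [j ->|->]; last by rewrite consv0.
    by have := h j; rewrite consvS mxE.
  rewrite indicE memNset// mule0; apply: integral0_eq => x _.
  by rewrite indicE memNset// => /(_ ord0); rewrite consv0.
rewrite ge0_integralZl//; last 2 first.
- exact/measurable_EFinP/measurable_indic.
- by rewrite lee_fin exprn_ge0// mulr_ge0// ltW.
rewrite integral_indic_ball ?ltW//.
by rewrite -EFinM exprSr mulr_natl.
Qed.

Definition boundedV n (U : set 'rV[R]_n) := exists2 C : R, 0 < C & forall x, U x -> forall i, `|x 0 i| < C.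

Lemma lebV_bounded n (U : set (borelRV R n)) : measurable U -> boundedV U ->
  (lebV n U < +oo)%E.
Proof.
move=> mU [C C0 UC]; apply: (@le_lt_trans _ _ (lebV n (boxV (0 : 'rV[R]_n) C))).
  apply: le_measure; rewrite ?inE//; first exact: measurable_boxV.
  by move=> x /UC h i; rewrite mxE sub0r normrN.
by rewrite lebV_box// ltry.
Qed.

Lemma lebV_open_gt0 n (U : set (borelRV R n)) (x0 : 'rV[R]_n) : open (U : set 'rV[R]_n) -> U x0 -> (0 < lebV n U)%E.
Proof.
move=> oU Ux; have mU := measurable_open oU.
have /nbhs_ballP [e /= e0 he] : nbhs x0 U by exact: open_nbhs_nbhs.
apply: (@lt_le_trans _ _ (lebV n (boxV x0 e))).
  by rewrite lebV_box// lte_fin exprn_gt0// mulr_gt0.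
apply: le_measure; rewrite ?inE//; first exact: measurable_boxV.
by rewrite boxVE.
Qed.

End PLeq.

(** * Half-space moments and their truncations *)

Section moments.
Context {R : realType} {n : nat}.
Local Notation Rn := (borelRV R n).
Local Notation la := (@lebesgue_measure R).
Local Notation mR := (measurableTypeR R).
Implicit Types U V M : set Rn.

Lemma dotvDl (x y v : 'rV[R]_n) : dotv (x + y) v = dotv x v + dotv y v.
Proof. by rewrite /dotv -big_split/=; apply: eq_bigr => i _; rewrite mxE mulrDl. Qed.

Lemma dotvZl (c : R) (x v : 'rV[R]_n) : dotv (c *: x) v = c * dotv x v.
Proof. by rewrite /dotv big_distrr/=; apply: eq_bigr => i _; rewrite mxE mulrA. Qed.

Lemma dotvC (x v : 'rV[R]_n) : dotv x v = dotv v x.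
Proof. by apply: eq_bigr => i _; rewrite mulrC. Qed.

Lemma dotvDr (x y v : 'rV[R]_n) : dotv v (x + y) = dotv v x + dotv v y.
Proof. by rewrite dotvC dotvDl !(dotvC v). Qed.

Lemma dotvZr (c : R) (x v : 'rV[R]_n) : dotv v (c *: x) = c * dotv v x.
Proof. by rewrite dotvC dotvZl (dotvC v). Qed.

Lemma dotvNl (x v : 'rV[R]_n) : dotv (- x) v = - dotv x v.
Proof. by rewrite -scaleN1r dotvZl mulN1r. Qed.

Lemma dotvNr (x v : 'rV[R]_n) : dotv x (- v) = - dotv x v.
Proof. by rewrite dotvC dotvNl dotvC. Qed.

Lemma dotvv_ge0 (x : 'rV[R]_n) : 0 <= dotv x x.
Proof. by apply: sumr_ge0 => i _; rewrite -expr2 sqr_ge0. Qed.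

Lemma dotvv_eq0 (x : 'rV[R]_n) : (dotv x x == 0) = (x == 0).
Proof.
apply/eqP/eqP => [h|->]; last by rewrite /dotv big1// => i _; rewrite mxE mul0r.
apply/rowP => i; rewrite mxE; apply/eqP; rewrite -sqrf_eq0 expr2; apply/eqP.
by have /psumr_eq0P := h; apply => // j _; rewrite -expr2 sqr_ge0.
Qed.

Lemma measurable_dotr (v : 'rV[R]_n) : measurable_fun setT (fun x : Rn => dotv x v).
Proof. by apply: measurable_dotv; [exact: measurable_id|exact: measurable_cst]. Qed.

(* Integrating over y raises the exponent j to j + 1, up to a factor 2 (momf_fubini), so that equality
   for the weight <x,v>^(j+1) becomes, through Prekopa-Leindler in y, equality for <x,v>^j. *)
Definition momf U (v : 'rV[R]_n) (j : nat) (y : R) (x : Rn) : R :=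
  \1_U x * \1_[set x | `|y| < dotv x v]%R x * dotv x v ^+ j.

Lemma momfE U v j y x : momf U v j y x = if `[< U x /\ `|y| < dotv x v >] then dotv x v ^+ j else 0.
Proof.
rewrite /momf !indicE; case: asboolP => [[Ux yx]|h]; first by rewrite !mem_set// !mul1r.
have [Ux|nUx] := pselect (U x); last by rewrite memNset// !mul0r.
by rewrite [X in _ * (nat_of_bool X)%:R]memNset ?mulr0 ?mul0r// => yx; apply: h.
Qed.

Lemma momf_ge0 U v j y x : 0 <= momf U v j y x.
Proof.
rewrite momfE; case: asboolP => // -[_ h]; rewrite exprn_ge0// ltW// (le_lt_trans _ h)//.
Qed.

Lemma measurable_momf U v j y : measurable U -> measurable_fun setT (fun x => (momf U v j y x)%:E).
Proof.
move=> mU; apply/measurable_EFinP; apply: measurable_funM.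
  apply: measurable_funM; first exact: measurable_indic.
  apply: measurable_indic; rewrite -[X in measurable X]setTI.
  by apply: (measurable_fun_ltr (f := fun=> `|y|)) => //; exact: measurable_dotr.
by apply: measurable_funX; exact: measurable_dotr.
Qed.

(** The constraint on [y] survives by the triangle inequality. The powers compare by the
    arithmetic-geometric mean inequality, since [<x,v>] and [<y,v>] are both positive there. *)
Lemma momf_mid U V M v j s t x y :
  (forall x y : 'rV[R]_n, U x -> V y -> M (2^-1 *: (x + y))) ->
  momf U v j s x * momf V v j t y <= momf M v j ((s + t) / 2) (2^-1 *: (x + y)) ^+ 2.
Proof.
move=> UVM; rewrite (momfE U); case: asboolP => [[Ux sx]|_]; last by rewrite mul0r sqr_ge0.
rewrite (momfE V); case: asboolP => [[Vy ty]|_]; last by rewrite mulr0 sqr_ge0.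
rewrite momfE asboolT; last first.
  split; first exact: UVM.
  rewrite dotvZl dotvDl normrM [`|2^-1|]gtr0_norm ?invr_gt0// mulrC ltr_pM2l ?invr_gt0//.
  by rewrite (le_lt_trans (ler_normD _ _))// ltrD.
rewrite -exprMn -exprM mulnC exprM; apply: lerXn2r; rewrite ?nnegrE ?sqr_ge0//.
  by rewrite mulr_ge0// ltW// (le_lt_trans (normr_ge0 _) sx, le_lt_trans (normr_ge0 _) ty).
rewrite dotvZl dotvDl; have := sqr_ge0 (dotv x v - dotv y v); nra.
Qed.

Lemma measurable_momf2 U v j : measurable U ->
  measurable_fun setT (fun p : mR * Rn => (momf U v j p.1 p.2)%:E).
Proof.
move=> mU.
apply/measurable_EFinP; apply: measurable_funM.
  apply: measurable_funM.
    exact: (measurable_compT (measurable_indic mU) measurable_snd).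
  rewrite (_ : (fun _ => _) = \1_[set p : mR * Rn | `|p.1| < dotv p.2 v]); last first.
    by apply/funext => p; exact: indic_iff.
  apply: measurable_indic; rewrite -[X in measurable X]setTI.
  apply: (measurable_fun_ltr (f := fun p : mR * Rn => `|p.1|)) => //.
    exact: (measurable_compT (@normr_measurable R setT) measurable_fst).
  exact: (measurable_compT (measurable_dotr v) measurable_snd).
by apply: measurable_funX; exact: (measurable_compT (measurable_dotr v) measurable_snd).
Qed.

(** For fixed [x] the admissible [y] form an interval of length [2 <x,v>]. *)
Lemma momf_fubini U v j : measurable U ->
  (\int[la]_y \int[lebV n]_x (momf U v j y x)%:E = 2%:E * \int[lebV n]_x (momf U v j.+1 0%R x)%:E)%E.
Proof.
move=> mU.
have mj := @measurable_momf2 U v j mU.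
rewrite (@fubini_tonelli _ _ _ _ _ la (lebV n) (fun p => (momf U v j p.1 p.2)%:E))//; last first.
  by move=> p; rewrite lee_fin momf_ge0.
rewrite -ge0_integralZl//; last 2 first.
- exact: measurable_momf.
- by move=> x _; rewrite lee_fin momf_ge0.
apply: eq_integral => x _.
have [w0|w0] := leP (dotv x v) 0.
  rewrite momfE asboolF ?mule0; last by rewrite normr0 => -[_]; rewrite ltNge w0.
  apply: integral0_eq => y _; rewrite momfE asboolF// => -[_].
  by rewrite ltNge (le_trans w0).
pose B0 : set mR := ball (0 : R) (dotv x v).
have mB0 : measurable B0 by exact: measurable_ball.
transitivity (\int[la]_y ((\1_U x * dotv x v ^+ j)%:E * (\1_B0 y)%:E))%E.
  apply: eq_integral => y _; rewrite -EFinM; congr EFin; rewrite /momf mulrAC; congr (_ * _).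
  by apply: indic_iff; rewrite /B0 -ball_normE/= sub0r normrN.
rewrite ge0_integralZl//; last 2 first.
- exact/measurable_EFinP/measurable_indic.
- by rewrite lee_fin mulr_ge0// exprn_ge0// ltW.
rewrite integral_indic_ball ?ltW//.
rewrite -!EFinM; congr EFin; rewrite /momf normr0 [X in _ * X * _]indicE mem_set//= exprS; ring.
Qed.

End moments.

(** * Symmetric open convex bodies *)

Section bodies.
Context {R : realType}.
Local Notation la := (@lebesgue_measure R).
Local Notation mR := (measurableTypeR R).

Lemma continuous_sumR (T : topologicalType) (I : Type) (r : seq I) (f : I -> T -> R) :
  (forall i, continuous (f i)) -> continuous (fun x => \sum_(i <- r) f i x).
Proof.
move=> cf x; elim: r => [|i r IH].
  rewrite (_ : (fun _ => _) = fun=> 0); first exact: cvg_cst.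
  by apply/funext => y; rewrite big_nil.
rewrite (_ : (fun _ => _) = (fun y => f i y + \sum_(j <- r) f j y)); last first.
  by apply/funext => y; rewrite big_cons.
by apply: cvgD; [exact: cf|exact: IH].
Qed.

Lemma continuous_dotv (T : topologicalType) n (f g : T -> 'rV[R]_n) :
  continuous f -> continuous g -> continuous (fun x => dotv (f x) (g x)).
Proof.
move=> cf cg; apply: continuous_sumR => i x; apply: cvgM.
  by apply: (@continuous_comp _ _ _ f (fun M : 'rV[R]_n => M 0 i) x); [exact: cf|exact: coord_continuous].
by apply: (@continuous_comp _ _ _ g (fun M : 'rV[R]_n => M 0 i) x); [exact: cg|exact: coord_continuous].
Qed.

Lemma continuous_dotr n (v : 'rV[R]_n) : continuous (fun x : 'rV[R]_n => dotv x v).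
Proof.
have h1 : continuous (id : 'rV[R]_n -> 'rV[R]_n) by move=> x; exact: cvg_id.
have h2 : continuous ((fun=> v) : 'rV[R]_n -> 'rV[R]_n) by exact: cst_continuous.
exact: (continuous_dotv h1 h2).
Qed.

Lemma continuous_enorm n : continuous (fun x : 'rV[R]_n => enorm x).
Proof.
move=> x; apply: (continuous_comp (f := fun x : 'rV[R]_n => dotv x x)).
  by apply: continuous_dotv => y; exact: cvg_id.
exact: sqrt_continuous.
Qed.

Lemma open_dotv_gt n (v : 'rV[R]_n) (c : R) : open [set x : 'rV[R]_n | c < dotv x v].
Proof.
apply: (@open_comp _ _ (fun x : 'rV[R]_n => dotv x v) [set y | c < y]); last exact: open_gt.
by move=> x _; exact: continuous_dotr.
Qed.

Definition convexV n (U : set 'rV[R]_n) :=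
  forall x y t, U x -> U y -> 0 <= t <= 1 -> U (t *: x + (1 - t) *: y).

(** Open bodies have lower semicontinuous indicators, so the equality case can speak about one
    individual slice. *)
Definition sbody n (U : set 'rV[R]_n) :=
  [/\ open U, convexV U, (forall x, U x -> U (- x)), boundedV U & U 0].

Definition midpts n (U V M : set 'rV[R]_n) :=
  forall x y, U x -> V y -> M (2^-1 *: (x + y)).

Lemma convex_midpts n (U : set 'rV[R]_n) : convexV U -> midpts U U U.
Proof.
move=> cU x y Ux Uy; rewrite scalerDr; have := cU x y 2^-1 Ux Uy.
rewrite (_ : 1 - 2^-1 = 2^-1 :> R); last by field.
by apply; lra.
Qed.

Lemma sbody_measurable n (U : set 'rV[R]_n) : sbody U -> measurable (U : set (borelRV R n)).
Proof. by case=> oU _ _ _ _; exact: measurable_open. Qed.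

Lemma bounded_dotv n (U : set 'rV[R]_n) (v : 'rV[R]_n) : boundedV U ->
  exists2 C : R, 0 < C & forall x, U x -> `|dotv x v| <= C.
Proof.
move=> [C C0 UC]; exists (1 + \sum_i C * `|v 0 i|).
  by rewrite ltr_pwDl// sumr_ge0// => i _; rewrite mulr_ge0// ltW.
move=> x Ux; rewrite ler_wpDl//; apply: le_trans (ler_norm_sum _ _ _) _.
by apply: ler_sum => i _; rewrite normrM ler_wpM2r// ltW// UC.
Qed.

Lemma momf_finite n (U : set (borelRV R n)) v j y : measurable U -> boundedV U ->
  (\int[lebV n]_x (momf U v j y x)%:E < +oo)%E.
Proof.
move=> mU bU; have [C C0 hC] := bounded_dotv v bU.
apply: (@le_lt_trans _ _ (\int[lebV n]_x ((C ^+ j)%:E * (\1_U x)%:E))%E).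
  apply: ge0_le_integral => //.
  - by move=> x _; rewrite lee_fin momf_ge0.
  - exact: measurable_momf.
  - by apply: measurable_funeM; exact/measurable_EFinP/measurable_indic.
  move=> x _; rewrite -EFinM lee_fin momfE; case: asboolP => [[Ux h]|_]; last first.
    by rewrite mulr_ge0// exprn_ge0// ltW.
  rewrite indicE mem_set// mulr1; apply: lerXn2r; rewrite ?nnegrE ?(ltW C0)//.
    by rewrite ltW// (le_lt_trans _ h).
  by rewrite (le_trans (ler_norm _))// hC.
rewrite ge0_integralZl//; last 2 first.
- exact/measurable_EFinP/measurable_indic.
- by rewrite lee_fin exprn_ge0// ltW.
by rewrite -measure_indicE// lte_mul_pinfty// ?lee_fin ?exprn_ge0 ?ltW//; exact: lebV_bounded.
Qed.

Lemma momf_pos n (U : set (borelRV R n)) v j : v != 0 -> open (U : set 'rV[R]_n) -> U 0 ->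
  (0 < \int[lebV n]_x (momf U v j 0%R x)%:E)%E.
Proof.
move=> v0 oU U0; have mU := measurable_open oU.
have vv : 0 < dotv v v by rewrite lt0r dotvv_eq0 v0 dotvv_ge0.
have [e e0 Ue] : exists2 e : R, 0 < e & U (e *: v).
  have c0 : continuous (fun t : R => t *: v) by move=> t; apply: cvgZr_tmp; exact: cvg_id.
  have : \forall t \near (0 : R), U (t *: v).
    have := c0 0; rewrite /continuous_at scale0r => h; apply: h; exact: open_nbhs_nbhs.
  move=> /nbhs_ballP [d /= d0 hd]; exists (d / 2); first by rewrite divr_gt0.
  apply: hd; rewrite -ball_normE/= sub0r normrN gtr0_norm ?divr_gt0//.
  by rewrite ltr_pdivrMr// ltr_pMr// ltr1n.
(* Half the value of [<x,v>] at [x = e *: v], so that [O] below is an open neighbourhood of that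
   point. *)
pose d := e * dotv v v / 2.
have d0 : 0 < d by rewrite divr_gt0// mulr_gt0.
pose O : set (borelRV R n) := U `&` [set x | d < dotv x v].
have oO : open (O : set 'rV[R]_n) by apply: openI => //; exact: open_dotv_gt.
have mO := measurable_open oO.
have Oev : O (e *: v).
  by split => //=; rewrite dotvZl /d ltr_pdivrMr// ltr_pMr ?ltr1n// mulr_gt0.
apply: (@lt_le_trans _ _ ((d ^+ j)%:E * lebV n O)%E).
  by rewrite mule_gt0 ?lte_fin ?exprn_gt0//; exact: lebV_open_gt0 oO Oev.
rewrite measure_indicE// -ge0_integralZl//; last 2 first.
- exact/measurable_EFinP/measurable_indic.
- by rewrite lee_fin exprn_ge0// ltW.
apply: ge0_le_integral => //.
- by move=> x _; rewrite mule_ge0// lee_fin exprn_ge0// ltW.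
- by apply: measurable_funeM; exact/measurable_EFinP/measurable_indic.
- exact: measurable_momf.
move=> x _; rewrite -EFinM lee_fin momfE indicE; have [[Ux dx]|nO] := pselect (O x); last first.
  by rewrite memNset// mulr0; case: asboolP => // -[_ h]; rewrite exprn_ge0// ltW// (le_lt_trans _ h).
rewrite mem_set// mulr1 asboolT; last by split => //; rewrite normr0 (lt_trans d0).
by apply: lerXn2r; rewrite ?nnegrE ?(ltW d0)// ltW// (lt_trans d0).
Qed.

Lemma momf_pl n (U V M : set (borelRV R n)) v j s t :
  measurable U -> measurable V -> measurable M -> midpts U V M ->
  ((\int[lebV n]_x (momf U v j s x)%:E) * (\int[lebV n]_x (momf V v j t x)%:E) <=
   (\int[lebV n]_x (momf M v j ((s + t) / 2) x)%:E) * (\int[lebV n]_x (momf M v j ((s + t) / 2) x)%:E))%E.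
Proof.
move=> mU mV mM UVM; apply: prekopa_leindler; try exact: measurable_momf;
  try by move=> x; rewrite lee_fin momf_ge0.
by move=> x y; rewrite -!EFinM lee_fin -[leRHS]expr2; exact: momf_mid.
Qed.

Lemma momf_le0 n (U : set (borelRV R n)) v j y x : momf U v j y x <= momf U v j 0 x.
Proof.
rewrite [leLHS]momfE; case: asboolP => [[Ux yx]|_]; last exact: momf_ge0.
by rewrite momfE asboolT//; split => //; rewrite normr0 (le_lt_trans _ yx).
Qed.

(** The condition [|y| < <x,v>] is strict, hence stable near [y = 0]. *)
Lemma momf_near n (U : set (borelRV R n)) v j x : \forall y \near (0 : R), momf U v j 0 x <= momf U v j y x.
Proof.
rewrite momfE; case: asboolP => [[Ux]|_]; last by apply: filterE => y; exact: momf_ge0.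
rewrite normr0 => wx; apply/nbhs_ballP; exists (dotv x v) => //= y.
by rewrite -ball_normE/= sub0r normrN => yx; rewrite momfE asboolT.
Qed.

(** As a function of [y], the integral of [momf] is largest at 0 and has total mass twice the moment
    of order [j.+1]. One-dimensional equality therefore applies to it and compares the values at 0,
    which are the moments of order [j]. *)
Lemma momf_descent n (U V M : set (borelRV R n)) v j (I : R) :
  measurable U -> measurable V -> measurable M -> boundedV U -> boundedV V ->
  midpts U V M -> 0 < I ->
  (\int[lebV n]_x (momf U v j.+1 0%R x)%:E = I%:E)%E ->
  (\int[lebV n]_x (momf V v j.+1 0%R x)%:E = I%:E)%E ->
  (\int[lebV n]_x (momf M v j.+1 0%R x)%:E = I%:E)%E ->
  (\int[lebV n]_x (momf U v j 0%R x)%:E = \int[lebV n]_x (momf V v j 0%R x)%:E)%E /\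
  (\int[lebV n]_x (momf M v j 0%R x)%:E = \int[lebV n]_x (momf U v j 0%R x)%:E)%E.
Proof.
move=> mU mV mM bU bV UVM I0 UI VI MI.
pose f (A : set (borelRV R n)) (y : mR) := (\int[lebV n]_x (momf A v j y x)%:E)%E.
have mf A : measurable A -> measurable_fun setT (f A).
  move=> mA.
  have mj := @measurable_momf2 _ _ A v j mA.
  by apply: (@measurable_fun_fubini_tonelli_F _ _ _ _ _ (lebV n) (fun p => (momf A v j p.1 p.2)%:E)) => // p; rewrite lee_fin momf_ge0.
have f0 A y : (0 <= f A y)%E by apply: integral_ge0 => x _; rewrite lee_fin momf_ge0.
have f1 A y : measurable A -> (0 <= f A y <= f A 0%R)%E.
  move=> mA; rewrite f0/=; apply: ge0_le_integral => //; try exact: measurable_momf.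
  - by move=> x _; rewrite lee_fin momf_ge0.
  - by move=> x _; rewrite lee_fin momf_le0.
have I20 : 0 < 2 * I by rewrite mulr_gt0.
apply: (@prekopa_leindler_equality _ (f U) (f V) (f M) (2 * I)) => //.
- exact: mf.
- exact: mf.
- exact: mf.
- by move=> y; exact: f1.
- by move=> y; exact: f1.
- exact: momf_finite.
- exact: momf_finite.
- by move=> x y; exact: momf_pl.
- apply: integral_lsc => //.
  + by move=> y; exact: measurable_momf.
  + by move=> y x; rewrite lee_fin momf_ge0.
  + by move=> x; apply: filterS (momf_near M v j x) => y; rewrite lee_fin.
- by rewrite momf_fubini// UI EFinM.
- by rewrite momf_fubini// VI EFinM.
- by rewrite momf_fubini// MI EFinM.
Qed.


Lemma continuous_consv (T : topologicalType) n (f : T -> R) (g : T -> 'rV[R]_n) :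
  continuous f -> continuous g -> continuous (fun x => consv (f x) (g x)).
Proof.
move=> cf cg x; apply/cvgrPdist_lt => e e0.
have h i : \forall y \near x, `|consv (f x) (g x) 0 i - consv (f y) (g y) 0 i| < e.
  case: (unliftP ord0 i) => [j ->|->].
    have : (fun y => g y 0 j) @ x --> g x 0 j.
      by apply: (@continuous_comp _ _ _ g (fun M : 'rV[R]_n => M 0 j) x); [exact: cg|exact: coord_continuous].
    by move=> /cvgrPdist_lt/(_ e e0); apply: filterS => y; rewrite !consvS.
  by have /cvgrPdist_lt/(_ e e0) := cf x; apply: filterS => y; rewrite !consv0.
have : \forall y \near x, forall i, `|consv (f x) (g x) 0 i - consv (f y) (g y) 0 i| < e.
  exact: filter_forall.
by apply: filterS => y hy; apply: rV_norm_lt => // i; rewrite !mxE in hy *; have := hy i; rewrite !mxE.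
Qed.

Lemma consvD n s t (x y : 'rV[R]_n) : consv s x + consv t y = consv (s + t) (x + y).
Proof. by apply/rowP => i; rewrite !mxE; case: (unlift ord0 i) => [j|]; rewrite ?mxE. Qed.

Lemma consvZ n c t (x : 'rV[R]_n) : c *: consv t x = consv (c * t) (c *: x).
Proof. by apply/rowP => i; rewrite !mxE; case: (unlift ord0 i) => [j|]; rewrite ?mxE. Qed.

Lemma consvN n t (x : 'rV[R]_n) : - consv t x = consv (- t) (- x).
Proof. by rewrite -[in LHS]scaleN1r consvZ mulN1r scaleN1r. Qed.

(* v is chosen later so that the hyperplane t = 0 contains a given point. *)
Definition slice n (v : 'rV[R]_n) (U : set 'rV[R]_n.+1) (t : R) : set 'rV[R]_n :=
  [set x | U (consv (t + dotv x v) x)].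

Lemma open_slice n (v : 'rV[R]_n) U t : open U -> open (slice v U t).
Proof.
move=> oU; apply: (@open_comp _ _ (fun x : 'rV[R]_n => consv (t + dotv x v) x) U) => // x _.
apply: (@continuous_consv _ _ (fun x => t + dotv x v) id) => y; last exact: cvg_id.
apply: (@continuousD _ _ _ (fun=> t) (fun x : 'rV[R]_n => dotv x v) y); first exact: cst_continuous.
exact: continuous_dotr.
Qed.

Lemma measurable_sliceV n (v : 'rV[R]_n) (U : set 'rV[R]_n.+1) t : open U ->
  measurable (slice v U t : set (borelRV R n)).
Proof. by move=> oU; apply: measurable_open; exact: open_slice. Qed.

Lemma slice_midpts n (v : 'rV[R]_n) (U V M : set 'rV[R]_n.+1) s t : midpts U V M ->
  midpts (slice v U s) (slice v V t) (slice v M ((s + t) / 2)).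
Proof.
move=> UVM x y Ux Vy; rewrite /slice /=; have := UVM _ _ Ux Vy.
rewrite consvD consvZ dotvZl dotvDl; by congr (M (consv _ _)); field.
Qed.

Lemma sbody_slice n (v : 'rV[R]_n) (U : set 'rV[R]_n.+1) : sbody U -> sbody (slice v U 0).
Proof.
case=> oU cU sU [C C0 bU] U0; split.
- exact: open_slice.
- move=> x y t Ux Uy t01; rewrite /slice /=; have := cU _ _ t Ux Uy t01.
  rewrite !consvZ consvD dotvDl !dotvZl; congr (U (consv _ _)); ring.
- by move=> x /sU; rewrite consvN /slice /= dotvNl !add0r.
- by exists C => // x Ux i; have := bU _ Ux (lift ord0 i); rewrite consvS.
- rewrite /slice /= dotvC -[X in dotv _ X](scale0r 0) dotvZr mul0r addr0.
  by rewrite (_ : consv 0 0 = 0)//; apply/rowP => i; rewrite !mxE; case: unlift => // j; rewrite mxE.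
Qed.

Lemma slice_fubini n (v : 'rV[R]_n) (U : set (borelRV R n.+1)) : open (U : set 'rV[R]_n.+1) ->
  (\int[la]_t lebV n (slice v U t) = lebV n.+1 U)%E.
Proof.
move=> oU; have mU := measurable_open oU.
rewrite [RHS]measure_indicE// -(lebV_shear (measurable_dotr v))//; last first.
  exact/measurable_EFinP/measurable_indic.
apply: eq_integral => t _; rewrite measure_indicE; last exact: measurable_sliceV.
by apply: eq_integral => x _; congr EFin; exact: indic_iff.
Qed.

Lemma measurable_slice n (v : 'rV[R]_n) (U : set (borelRV R n.+1)) : open (U : set 'rV[R]_n.+1) ->
  measurable_fun setT (fun t : mR => lebV n (slice v U t)).
Proof.
move=> oU; have mU := measurable_open oU.
apply: (@eq_measurable_funT _ _ _ _ _ (fun t : mR => \int[lebV n]_x (\1_U (consv (t + dotv x v) x))%:E)%E).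
  move=> t; rewrite measure_indicE; last exact: measurable_sliceV.
  by apply: eq_integral => x _; congr EFin; exact: indic_iff.
apply: (@measurable_fun_fubini_tonelli_F _ _ _ _ _ (lebV n)
  (fun p : mR * borelRV R n => (\1_U (consv (p.1 + dotv p.2 v) p.2))%:E)) => //.
apply/measurable_EFinP.
have h : measurable_fun setT (fun p : mR * borelRV R n => ((p.1 + dotv p.2 v : mR), p.2)).
  apply: measurable_fun_pair => //; apply: measurable_funD => //.
  exact: (measurable_compT (measurable_dotr v) measurable_snd).
exact: (measurable_compT (measurable_indic mU) (measurable_compT (@measurable_consv R n) h)).
Qed.

Lemma lebV_midpts n (U V M : set (borelRV R n)) :
  measurable U -> measurable V -> measurable M -> midpts U V M ->
  (lebV n U * lebV n V <= lebV n M * lebV n M)%E.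
Proof.
move=> mU mV mM UVM; rewrite !(measure_indicE (lebV n))//; apply: prekopa_leindler;
  try (exact/measurable_EFinP/measurable_indic); try by move=> x; rewrite lee_fin.
move=> x y; rewrite -!EFinM lee_fin; case: (pselect (U x)) => Ux; last first.
  by rewrite indicE memNset// mul0r.
case: (pselect (V y)) => Vy; last by rewrite mulrC indicE memNset// mul0r.
rewrite !indicE !mem_set ?mulr1//; exact: UVM.
Qed.

Lemma lebV_oppset n (U : set (borelRV R n)) : measurable U ->
  lebV n [set x | U (- x)%R] = lebV n U.
Proof.
move=> mU; rewrite [RHS]measure_indicE// -lebV_opp//; last first.
  exact/measurable_EFinP/measurable_indic.
rewrite measure_indicE; last by rewrite -[X in measurable X]setTI; exact: measurable_oppV.
by apply: eq_integral => x _; congr EFin; exact: indic_iff.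
Qed.

(** The slices at [t] and [- t] are mirror images, and their midpoints lie in the central slice. *)
Lemma slice_le0 n (v : 'rV[R]_n) (U : set (borelRV R n.+1)) t : sbody U ->
  (lebV n (slice v U t) <= lebV n (slice v U 0))%E.
Proof.
move=> sbU; have [oU cU sU bU U0] := sbU.
have mS s : measurable (slice v U s : set (borelRV R n)) by exact: measurable_sliceV.
have eN : lebV n (slice v U (- t)) = lebV n (slice v U t).
  rewrite -(lebV_oppset (mS t)); congr (lebV n _); apply/seteqP; split => x; rewrite /slice /= dotvNl.
    by move=> /sU; rewrite consvN opprD opprK.
  by move=> /sU; rewrite consvN opprD !opprK.
have := lebV_midpts (mS t) (mS (- t)) (mS ((t - t) / 2)) (slice_midpts (convex_midpts cU)).
rewrite subrr mul0r eN => h; rewrite leNgt; apply/negP => h2.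
move: h; rewrite leNgt => /negP; apply.
have f0 : lebV n (slice v U 0) \is a fin_num by rewrite ge0_fin_numE// (lt_le_trans h2)// leey.
case: (lebV n (slice v U t)) h2 => [r| |]; last 2 first.
- by move=> _; rewrite mulyy ltey_eq fin_numM.
- by rewrite ltNge leNye.
rewrite -(fineK f0) lte_fin => h2; rewrite -!EFinM lte_fin ltr_pM ?fine_ge0//.
Qed.

(** Slicing parallel to a hyperplane through 0 and [u], one-dimensional equality passes the equal
    volumes on to the central slices, which contain the projection of [u]. In dimension one,
    symmetric intervals of equal length coincide. The last coordinate of [u] is never dropped, so
    its being nonzero persists through the induction and allows the tilt. *)
Lemma sbody_volume_eq n (U V M : set (borelRV R n.+1)) : sbody U -> sbody V ->
  open (M : set 'rV[R]_n.+1) -> midpts U V M ->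
  lebV n.+1 U = lebV n.+1 V -> lebV n.+1 M = lebV n.+1 U ->
  forall u : 'rV[R]_n.+1, u 0 ord_max != 0 -> U u -> V u.
Proof.
elim: n U V M => [|n IH] U V M sbU sbV oM UVM UV MU u u0 Uu.
  have o0 : 0 = ord_max :> 'I_1 by apply: val_inj.
  rewrite -o0 in u0.
  have [oU cU sU bU U0] := sbU; have [oV cV sV bV V0] := sbV.
  apply: contrapT => nVu.
  (* A symmetric interval that misses [u] stays within distance [|u|] of 0. *)
  have hV (x : 'rV[R]_1) : V x -> `|x 0 0| < `|u 0 0|.
    move=> Vx; rewrite ltNge; apply/negP => ux; apply: nVu.
    have x0 : x 0 0 != 0 by rewrite -normr_gt0 (lt_le_trans _ ux)// normr_gt0.
    pose c := u 0 0 / x 0 0.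
    have uE : u = c *: x by apply/rowP => i; rewrite ord1 mxE divfK.
    have c1 : `|c| <= 1 by rewrite normrM normfV ler_pdivrMr ?normr_gt0// mul1r.
    have e2 : u = ((1 + c) / 2) *: x + (1 - (1 + c) / 2) *: (- x).
      by rewrite scalerN -scalerBl uE; congr (_ *: _); field.
    rewrite e2; apply: cV => //; first exact: sV.
    by move: c1; rewrite ler_norml => /andP[c1 c2]; lra.
  have u00 : 0 < `|u 0 0| by rewrite normr_gt0.
  (* Openness lets [U] reach strictly beyond [u], which makes it longer than [V]. *)
  have [d d1 Ud] : exists2 d : R, 1 < d & U (d *: u).
    have c1 : continuous (fun t : R => t *: u) by move=> t; apply: cvgZr_tmp; exact: cvg_id.
    have : \forall t \near (1 : R), U (t *: u).
      have := c1 1; rewrite /continuous_at scale1r => h; apply: h; exact: open_nbhs_nbhs.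
    move=> /nbhs_ballP [d /= d0 hd]; exists (1 + d / 2); first by rewrite ltrDl divr_gt0.
    apply: hd; rewrite -ball_normE/= opprD addrA subrr sub0r normrN gtr0_norm ?divr_gt0//.
    by rewrite ltr_pdivrMr// ltr_pMr// ltr1n.
  have d0 : 0 < d by rewrite (lt_trans _ d1).
  pose r : R := `|u 0 0|.
  have : (lebV 1 U <= lebV 1 (boxV (0 : 'rV[R]_1) r))%E.
    rewrite UV; apply: le_measure; rewrite ?inE; [exact: sbody_measurable|exact: measurable_boxV|].
    by move=> x /hV h i; rewrite ord1 mxE sub0r normrN.
  have : (lebV 1 (boxV (0 : 'rV[R]_1) (d * r)%R) <= lebV 1 U)%E.
    apply: le_measure; rewrite ?inE; [apply: measurable_boxV; exact: mulr_gt0|exact: sbody_measurable|].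
    move=> x /(_ 0); rewrite mxE sub0r normrN => xu.
    have u00' : u 0 0 != 0 by rewrite -normr_gt0.
    pose c := x 0 0 / (d * u 0 0).
    have du0 : d * u 0 0 != 0 by rewrite mulf_neq0// gt_eqF.
    have uE : x = c *: (d *: u) by apply/rowP => i; rewrite ord1 !mxE divfK.
    have c1 : `|c| <= 1 by rewrite normrM normfV ler_pdivrMr normrM (gtr0_norm d0) ?mul1r ?ltW// mulr_gt0.
    have e2 : x = ((1 + c) / 2) *: (d *: u) + (1 - (1 + c) / 2) *: (- (d *: u)).
      by rewrite scalerN -scalerBl {1}uE; congr (_ *: _); field.
    rewrite e2; apply: cU => //; first exact: sU.
    by move: c1; rewrite ler_norml => /andP[c1 c2]; lra.
  rewrite !lebV_box ?mulr_gt0// => h1 h2; have := le_trans h1 h2.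
  by rewrite lee_fin !expr1 -/r; rewrite -/r in u00; nra.
have [oU cU sU bU U0] := sbU; have [oV cV sV bV V0] := sbV.
(* The slope that tilts the central hyperplane, where the first coordinate equals [<x,v>], until it
   passes through [u]. *)
pose c := u 0 ord0 / u 0 ord_max.
pose v : 'rV[R]_n.+1 := c *: delta_mx 0 ord_max.
pose u' : 'rV[R]_n.+1 := \row_j u 0 (lift ord0 j).
have lm : lift ord0 (ord_max : 'I_n.+1) = ord_max by apply: val_inj.
have u'm : u' 0 ord_max = u 0 ord_max by rewrite mxE lm.
have dv : dotv u' v = u 0 ord0.
  rewrite dotvZr /dotv (bigD1 ord_max)//= big1 ?addr0 => [|i /negbTE ni]; last first.
    by rewrite mxE [X in _ * X]mxE ni andbF mulr0.
  by rewrite u'm [X in _ * (_ * X)]mxE !eqxx mulr1 divfK.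
have uE : u = consv (0 + dotv u' v) u'.
  rewrite add0r dv; apply/rowP => i; case: (unliftP ord0 i) => [j ->|->].
    by rewrite consvS mxE.
  by rewrite consv0.
have sS A : sbody A -> sbody (slice v A 0) by exact: sbody_slice.
have mS t (A : set (borelRV R n.+2)) : open (A : set 'rV[R]_n.+2) -> measurable (slice v A t : set (borelRV R n.+1)).
  by move=> oA; exact: measurable_sliceV.
have Upos : (0 < lebV n.+2 U)%E by exact: lebV_open_gt0 oU Uu.
have Ufin : lebV n.+2 U \is a fin_num.
  by rewrite ge0_fin_numE//; apply: lebV_bounded => //; exact: sbody_measurable.
pose I := fine (lebV n.+2 U).
have IE : lebV n.+2 U = I%:E by rewrite fineK.
have I0 : 0 < I by rewrite -lte_fin -IE.
have Sfin (A : set (borelRV R n.+2)) : sbody A -> (lebV n.+1 (slice v A 0) < +oo)%E.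
  move=> sbA; apply: lebV_bounded; first by apply: mS; case: sbA.
  by have [] := sS _ sbA.
have [e1 e2] : lebV n.+1 (slice v U 0) = lebV n.+1 (slice v V 0) /\
    lebV n.+1 (slice v M 0) = lebV n.+1 (slice v U 0).
  apply: (@prekopa_leindler_equality _ (fun t => lebV n.+1 (slice v U t))
    (fun t => lebV n.+1 (slice v V t)) (fun t => lebV n.+1 (slice v M t)) I) => //.
  - exact: measurable_slice.
  - exact: measurable_slice.
  - exact: measurable_slice.
  - by move=> t; rewrite measure_ge0/=; exact: slice_le0.
  - by move=> t; rewrite measure_ge0/=; exact: slice_le0.
  - exact: Sfin.
  - exact: Sfin.
  - by move=> s t; apply: lebV_midpts; [exact: mS..|exact: slice_midpts].
  - have eI t : lebV n.+1 (slice v M t) = (\int[lebV n.+1]_x (\1_(slice v M t) x)%:E)%E.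
      by rewrite measure_indicE//; exact: mS.
    move=> d; rewrite eI => hd.
    apply: (@filterS _ _ _ (fun y => d < \int[lebV n.+1]_x (\1_(slice v M y) x)%:E)%E).
      by move=> y; rewrite -eI.
    apply: (@integral_lsc R _ _ (lebV n.+1) (fun t x => (\1_(slice v M t) x)%:E)) => //.
    + by move=> t; apply/measurable_EFinP/measurable_indic; exact: mS.
    + move=> x; have [Mx|nMx] := pselect (slice v M 0 x); last first.
        by apply: filterE => y; rewrite lee_fin indicE memNset.
      have cc : continuous (fun t : R => consv (t + dotv x v) x).
        apply: (@continuous_consv _ _ (fun t => t + dotv x v) (fun=> x)); last exact: cst_continuous.
        by move=> t; apply: cvgD; [exact: cvg_id|exact: cvg_cst].
      have : \forall t \near (0 : R), M (consv (t + dotv x v) x).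
        by apply: (cc 0); exact: open_nbhs_nbhs.
      by apply: filterS => t Mt; rewrite !indicE !mem_set.
  - by rewrite slice_fubini.
  - by rewrite slice_fubini// -UV.
  - by rewrite slice_fubini// MU.
rewrite uE; apply: (IH (slice v U 0) (slice v V 0) (slice v M 0)) => //.
- exact: sS.
- exact: sS.
- exact: open_slice.
- by have := slice_midpts (v := v) (s := 0) (t := 0) UVM; rewrite addr0 mul0r.
- by rewrite u'm.
- by rewrite /slice /= -uE.
Qed.

End bodies.

(** * Moments of inertia *)

Section frames.
Context {R : realType} {n : nat}.
Local Notation Rn := (borelRV R n).

(** For [n] vectors this is orthonormality, in the form that expresses a trace as a sum over the
    frame. *)
Definition parseval (e : 'I_n -> 'rV[R]_n) :=
  forall x, \sum_i dotv x (e i) ^+ 2 = dotv x x.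

(** As [p] and [q] have opposite signs, the quadratic [p + 2 r B + r^2 q] has a real root [r]; the
    pair [(c, s)] is [(1, r)] normalised. *)
Lemma rotate_to_zero (p q B : R) : 0 < p -> q < 0 ->
  exists c s : R, c ^+ 2 + s ^+ 2 = 1 /\ c ^+ 2 * p + 2 * c * s * B + s ^+ 2 * q = 0.
Proof.
move=> p0 q0; pose D := B ^+ 2 - p * q.
have D0 : 0 <= D by rewrite /D; have := sqr_ge0 B; nra.
pose r := (- B - Num.sqrt D) / q.
have rE : p + 2 * r * B + r ^+ 2 * q = 0.
  have sD : Num.sqrt D ^+ 2 = D by rewrite sqr_sqrtr.
  have -> : p + 2 * r * B + r ^+ 2 * q = (Num.sqrt D ^+ 2 - D) / q.
    by rewrite /r /D; field; rewrite lt_eqF.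
  by rewrite sD subrr mul0r.
have r1 : 0 < 1 + r ^+ 2 by rewrite ltr_pwDl// sqr_ge0.
exists (Num.sqrt (1 + r ^+ 2))^-1, (r * (Num.sqrt (1 + r ^+ 2))^-1).
have s1 : (Num.sqrt (1 + r ^+ 2))^-1 ^+ 2 = (1 + r ^+ 2)^-1 by rewrite exprVn sqr_sqrtr// ltW.
set c := (Num.sqrt _)^-1 in s1 *.
have c2 : c ^+ 2 * (1 + r ^+ 2) = 1 by rewrite s1 mulVf// gt_eqF.
split; first by rewrite -c2; ring.
have -> : c ^+ 2 * p + 2 * c * (r * c) * B + (r * c) ^+ 2 * q = c ^+ 2 * (p + 2 * r * B + r ^+ 2 * q) by ring.
by rewrite rE mulr0.
Qed.

Lemma sum0_neg (Q : 'I_n -> R) : \sum_i Q i = 0 -> (exists i, Q i != 0) ->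
  (exists i, 0 < Q i) /\ (exists j, Q j < 0).
Proof.
move=> Q0 [i Qi].
have key (P : 'I_n -> R) : \sum_i P i = 0 -> P i != 0 -> exists k, 0 < P k.
  move=> P0 Pi; apply: contrapT => h.
  have Ple k : P k <= 0 by rewrite leNgt; apply/negP => hk; apply: h; exists k.
  have h0 : \sum_i (- P i) = 0 by rewrite sumrN P0 oppr0.
  have : - P i = 0 by have /psumr_eq0P := h0; apply => // k _; rewrite oppr_ge0.
  by move/eqP; rewrite oppr_eq0 (negbTE Pi).
split; first exact: key.
have [||k hk] := key (fun k => - Q k); rewrite ?sumrN ?Q0 ?oppr0 ?oppr_eq0//.
by exists k; rewrite -oppr_gt0.
Qed.

(** Rotating, in their plane, two vectors on which [Q] has opposite signs makes [Q] vanish on one of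
    them and keeps the sum of [Q], so the number of vectors with [Q] nonzero drops. *)
Lemma balanced_frame (Q : 'rV[R]_n -> R) (B : 'rV[R]_n -> 'rV[R]_n -> R) (e : 'I_n -> 'rV[R]_n) :
  (forall c s v w, Q (c *: v + s *: w) = c ^+ 2 * Q v + 2 * c * s * B v w + s ^+ 2 * Q w) ->
  parseval e -> \sum_i Q (e i) = 0 ->
  exists e' : 'I_n -> 'rV[R]_n, parseval e' /\ forall i, Q (e' i) = 0.
Proof.
move=> QB; have [k] := ubnP #|[pred i | Q (e i) != 0]|.
elim: k e => // k IH e; rewrite ltnS => ek pe Qe.
have [h|h] := pselect (exists i, Q (e i) != 0); last first.
  exists e; split => // i; apply/eqP/negPn/negP => hi; apply: h; by exists i.
have [[i Qi] [j Qj]] := sum0_neg Qe h.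
have ij : i != j by apply: contraTneq Qi => ->; rewrite -leNgt ltW.
have [c [s [cs Qcs]]] := rotate_to_zero (B (e i) (e j)) Qi Qj.
pose ei := c *: e i + s *: e j; pose ej := (- s) *: e i + c *: e j.
pose e' l := if l == i then ei else if l == j then ej else e l.
have e'i : e' i = ei by rewrite /e' eqxx.
have e'j : e' j = ej by rewrite /e' eq_sym (negbTE ij) eqxx.
have e'l l : l != i -> l != j -> e' l = e l by move=> /negbTE li /negbTE lj; rewrite /e' li lj.
have sumE (F : 'rV[R]_n -> R) : F ei + F ej = F (e i) + F (e j) -> \sum_l F (e' l) = \sum_l F (e l).
  move=> FE; rewrite (bigD1 i)//= (bigD1 j) 1?eq_sym//= [RHS](bigD1 i)//= [in RHS](bigD1 j) 1?eq_sym//=.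
  rewrite e'i e'j !addrA FE; congr (_ + _); apply: eq_bigr => l /andP[li lj].
  by rewrite e'l.
have Qei : Q ei = 0 by rewrite QB.
have Qej : Q ej = Q (e i) + Q (e j).
  rewrite -[LHS]add0r -Qei /ei /ej !QB.
  have -> : Q (e i) + Q (e j) = (c ^+ 2 + s ^+ 2) * (Q (e i) + Q (e j)) by rewrite cs mul1r.
  ring.
apply: (IH e').
- apply: leq_trans ek; apply: proper_card; apply/properP; split.
    apply/fintype.subsetP => l; rewrite !inE; have [->|li] := eqVneq l i; first by rewrite e'i Qei eqxx.
    have [->|lj] := eqVneq l j; first by move=> _; rewrite lt_eqF.
    by rewrite e'l.
  exists i; first by rewrite inE gt_eqF.
  by rewrite inE e'i Qei eqxx.
- move=> x; rewrite -pe; apply: (sumE (fun v => dotv x v ^+ 2)).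
  rewrite /ei /ej !dotvDr !dotvZr.
  have -> : dotv x (e i) ^+ 2 + dotv x (e j) ^+ 2 = (c ^+ 2 + s ^+ 2) * (dotv x (e i) ^+ 2 + dotv x (e j) ^+ 2).
    by rewrite cs mul1r.
  ring.
- by rewrite (sumE Q) ?Qe// Qei Qej add0r.
Qed.

Lemma parseval_delta : parseval (fun i => delta_mx 0 i).
Proof.
move=> x; apply: eq_bigr => i _; rewrite expr2.
have -> : dotv x (delta_mx 0 i) = x 0 i; last by [].
rewrite /dotv (bigD1 i)//= big1 ?addr0 => [|j /negbTE ji]; first by rewrite mxE !eqxx mulr1.
by rewrite mxE ji andbF mulr0.
Qed.

End frames.

Section inertia.
Context {R : realType} {n : nat}.
Local Notation Rn := (borelRV R n).
Implicit Types U V M : set Rn.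

Definition mom2 U (v w : 'rV[R]_n) : R := \int[lebV n]_(x in U) (dotv x v * dotv x w).

Definition inertia U : R := \int[lebV n]_(x in U) dotv x x.

Lemma integrable_bounded_poly U (f : Rn -> R) (C : R) : measurable U -> boundedV U ->
  measurable_fun setT f -> (forall x, U x -> `|f x| <= C) ->
  (lebV n).-integrable U (EFin \o f).
Proof.
move=> mU bU mf fC; apply: measurable_bounded_integrable => //.
- exact: lebV_bounded.
- exact: measurable_funTS.
- exists C; split; first exact: num_real.
  by move=> r Cr x /= Ux; rewrite (le_trans (fC _ Ux))// ltW.
Qed.

Lemma integrable_mom2 U v w : measurable U -> boundedV U ->
  (lebV n).-integrable U (EFin \o (fun x : Rn => dotv x v * dotv x w)).
Proof.
move=> mU bU.
have [C C0 hC] := bounded_dotv v bU; have [D D0 hD] := bounded_dotv w bU.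
apply: (@integrable_bounded_poly _ _ (C * D)) => //.
  by apply: measurable_funM; exact: measurable_dotr.
by move=> x Ux; rewrite normrM ler_pM// ?hC ?hD.
Qed.

Lemma mom2_quadratic U c s v w : measurable U -> boundedV U ->
  mom2 U (c *: v + s *: w) (c *: v + s *: w) =
  c ^+ 2 * mom2 U v v + 2 * c * s * mom2 U v w + s ^+ 2 * mom2 U w w.
Proof.
move=> mU bU; have I := integrable_mom2 _ _ mU bU.
have IZ k f : (lebV n).-integrable U (EFin \o f) -> (lebV n).-integrable U (EFin \o (fun x => k * f x)).
  by move=> If; have := integrableZl mU k If; apply: eq_integrable => // x _ /=.
rewrite /mom2 -!RintegralZl// -!RintegralD//; try exact: IZ; last first.
  by have := integrableD mU (IZ (c ^+ 2) _ (I v v)) (IZ (2 * c * s) _ (I v w)); apply: eq_integrable.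
apply: eq_Rintegral => x _; rewrite !dotvDr !dotvZr; ring.
Qed.

Lemma inertia_parseval U e : measurable U -> boundedV U -> parseval e ->
  inertia U = \sum_i mom2 U (e i) (e i).
Proof.
move=> mU bU pe; rewrite /inertia /mom2.
transitivity (\int[lebV n]_(x in U) \sum_i (dotv x (e i) * dotv x (e i))).
  by apply: eq_Rintegral => x _; rewrite -pe; apply: eq_bigr => i _; rewrite expr2.
have I i := integrable_mom2 (e i) (e i) mU bU.
suff h : forall s : seq 'I_n, (lebV n).-integrable U (EFin \o (fun x : Rn => \sum_(i <- s) (dotv x (e i) * dotv x (e i)))) /\
   \int[lebV n]_(x in U) (\sum_(i <- s) (dotv x (e i) * dotv x (e i))) = \sum_(i <- s) \int[lebV n]_(x in U) (dotv x (e i) * dotv x (e i)).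
  by have [] := h (index_enum 'I_n).
elim => [|i s [IH1 IH2]].
  split.
    rewrite (_ : (fun x => _) = fun=> 0); last by apply/funext => x; rewrite big_nil.
    by apply: (@integrable_bounded_poly _ _ 0) => // x _; rewrite normr0.
  rewrite big_nil; under eq_Rintegral do rewrite big_nil.
  by rewrite /Rintegral integral0.
split.
  by have := integrableD mU (I i) IH1; apply: eq_integrable => // x _ /=; rewrite big_cons.
under eq_Rintegral do rewrite big_cons.
by rewrite RintegralD// big_cons IH2.
Qed.

Lemma mom2E U v : measurable U -> boundedV U ->
  ((mom2 U v v)%:E = \int[lebV n]_x (\1_U x * dotv x v ^+ 2)%:E)%E.
Proof.
move=> mU bU; rewrite /mom2 /Rintegral fineK; last first.
  exact/integrable_fin_num/integrable_mom2.
rewrite integral_mkcond; apply: eq_integral => x _; rewrite patchE indicE.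
by case: ifP => _; rewrite ?mul0r ?mul1r ?expr2.
Qed.

(** The two open half-spaces contribute equally, by symmetry of [U] and evenness of [j]; the
    hyperplane between them is null. *)
Lemma sym_split U (v : 'rV[R]_n) j : sbody U -> v != 0 ->
  ~~ odd j -> (\int[lebV n]_x (\1_U x * dotv x v ^+ j)%:E = 2%:E * \int[lebV n]_x (momf U v j 0%R x)%:E)%E.
Proof.
move=> sbU v0 ej; have mU := sbody_measurable sbU; have [oU cU sU bU U0] := sbU.
have mH : measurable ([set x | dotv x v = 0] : set Rn).
  by have := measurable_dotr v measurableT (measurable_set1 (0 : R)); rewrite setTI.
have eN : (\int[lebV n]_x (momf U (- v) j 0%R x)%:E = \int[lebV n]_x (momf U v j 0%R x)%:E)%E.
  rewrite -[RHS]lebV_opp; last 2 first.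
  - exact: measurable_momf.
  - by move=> x; rewrite lee_fin momf_ge0.
  apply: eq_integral => x _; congr EFin; rewrite !momfE dotvNl dotvNr.
  congr (if _ then _ else _); apply: asbool_equiv_eq; split => -[Ux h]; split => //; first exact: sU.
  by rewrite -[x]opprK; exact: sU.
(* The factor [0 ^+ j] is 1 for [j = 0], so the hyperplane does enter the integrand when the moment
   is the volume. *)
transitivity (\int[lebV n]_x ((momf U v j 0%R x)%:E + ((momf U (- v) j 0%R x)%:E + (0 ^+ j * \1_(U `&` [set x | dotv x v = 0%R]) x)%:E)))%E.
  apply: eq_integral => x _; rewrite -!EFinD; congr EFin; rewrite !momfE !indicE normr0 dotvNr oppr_gt0.
  have [Ux|nUx] := pselect (U x); last first.
    by rewrite !asboolF ?memNset ?mul0r ?mulr0 ?addr0// => -[].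
  rewrite mem_set// mul1r; have [w0|w0|w0] := ltgtP (dotv x v) 0.
  - rewrite asboolF ?asboolT// ?memNset; last 2 first.
      by case=> _ /=; move=> h; rewrite h ltxx in w0.
      by case.
    by rewrite mulr0 addr0 add0r -mulN1r exprMn -signr_odd (negbTE ej) expr0 mul1r.
  - rewrite asboolT// asboolF ?memNset ?mulr0 ?addr0//; last by case.
    by case=> _ /= h; rewrite h ltxx in w0.
  - by rewrite !asboolF ?mem_set ?mulr1 ?add0r ?w0// => -[].
rewrite ge0_integralD//; last 4 first.
- by move=> x _; rewrite lee_fin momf_ge0.
- exact: measurable_momf.
- by move=> x _; rewrite -EFinD lee_fin addr_ge0// ?momf_ge0// mulr_ge0// exprn_ge0.
- apply: emeasurable_funD; first exact: measurable_momf.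
  apply/measurable_EFinP; apply: measurable_funM => //; apply: measurable_indic; exact: measurableI.
rewrite ge0_integralD//; last 3 first.
- by move=> x _; rewrite lee_fin momf_ge0.
- exact: measurable_momf.
- apply/measurable_EFinP; apply: measurable_funM => //; apply: measurable_indic; exact: measurableI.
rewrite eN; under [X in (_ + (_ + X))%E]eq_integral do rewrite EFinM.
rewrite ge0_integralZl ?lee_fin ?exprn_ge0//; last first.
  by apply/measurable_EFinP/measurable_indic; exact: measurableI.
have -> : (\int[lebV n]_x (\1_(U `&` [set x | dotv x v = 0%R]) x)%:E = 0)%E.
  rewrite -measure_indicE; last exact: measurableI.
  apply/eqP; rewrite eq_le measure_ge0 andbT -(lebV_hyperplane 0 v0).
  by apply: le_measure; rewrite ?inE//; exact: measurableI.
by rewrite mule0 adde0 mule_natl mule2n.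
Qed.


Lemma mom2_momf U v : sbody U -> v != 0 ->
  ((mom2 U v v)%:E = 2%:E * \int[lebV n]_x (momf U v 2 0%R x)%:E)%E.
Proof.
move=> sbU v0; have mU := sbody_measurable sbU; have [_ _ _ bU _] := sbU.
by rewrite mom2E// sym_split.
Qed.

Lemma mom2_gt0 U v : sbody U -> v != 0 -> 0 < mom2 U v v.
Proof.
move=> sbU v0; rewrite -lte_fin mom2_momf// mule_gt0//.
by have [oU _ _ _ U0] := sbU; exact: momf_pos.
Qed.

Lemma mom2_ge0 U v : sbody U -> 0 <= mom2 U v v.
Proof.
move=> sbU; have [->|v0] := eqVneq v 0; last by rewrite ltW// mom2_gt0.
by apply: Rintegral_ge0 => x _; rewrite -expr2 sqr_ge0.
Qed.

Lemma mom2_pl U V M v : sbody U -> sbody V -> sbody M -> midpts U V M ->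
  mom2 U v v * mom2 V v v <= mom2 M v v ^+ 2.
Proof.
move=> sbU sbV sbM UVM; have [->|v0] := eqVneq v 0.
  have m0 A : mom2 A 0 0 = 0.
    rewrite /mom2; under eq_Rintegral do rewrite -[0](scale0r 0) dotvZr !mul0r.
    by rewrite /Rintegral integral0.
  by rewrite !m0 mul0r sqr_ge0.
have [mU mV mM] := And3 (sbody_measurable sbU) (sbody_measurable sbV) (sbody_measurable sbM).
rewrite -lee_fin expr2 !EFinM !mom2_momf//.
have := momf_pl v 2 0 0 mU mV mM UVM; rewrite addr0 mul0r.
move=> h; rewrite muleACA [leRHS]muleACA; exact: lee_wpmul2l.
Qed.

Lemma parseval_nonzero (e : 'I_n -> 'rV[R]_n) : (0 < n)%N -> parseval e -> exists i, e i != 0.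
Proof.
move=> n0 pe; apply: contrapT => h.
have e0 i : e i = 0 by apply/eqP/negPn/negP => hi; apply: h; exists i.
pose x : 'rV[R]_n := const_mx 1.
have x0 : x != 0 by apply/eqP => /rowP/(_ (Ordinal n0)); rewrite !mxE => /eqP; rewrite oner_eq0.
have := pe x; rewrite big1; last first.
  by move=> i _; rewrite e0 -[0](scale0r 0) dotvZr mul0r expr0n.
by move/esym/eqP; rewrite dotvv_eq0 (negbTE x0).
Qed.

Lemma inertia_gt0 U : (0 < n)%N -> sbody U -> 0 < inertia U.
Proof.
move=> n0 sbU; have [_ _ _ bU _] := sbU.
have pe := @parseval_delta R n; have [i ei] := parseval_nonzero n0 pe.
rewrite (inertia_parseval (sbody_measurable sbU) bU pe) (bigD1 i)//=.
by rewrite ltr_pwDl ?mom2_gt0// sumr_ge0// => j _; exact: mom2_ge0.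
Qed.

(* A traceless quadratic form vanishes along some orthonormal basis; apply this
   to a combination of the two inertia forms. *)
Lemma common_frame U V : sbody U -> sbody V -> 0 < inertia U ->
  exists e : 'I_n -> 'rV[R]_n, parseval e /\
    forall i, mom2 V (e i) (e i) = inertia V / inertia U * mom2 U (e i) (e i).
Proof.
move=> sbU sbV U0; have [mU mV] := (sbody_measurable sbU, sbody_measurable sbV).
have [[_ _ _ bU _] [_ _ _ bV _]] := (sbU, sbV).
pose Q v := inertia V * mom2 U v v - inertia U * mom2 V v v.
have [||e [pe Qe]] := @balanced_frame R n Q
    (fun v w => inertia V * mom2 U v w - inertia U * mom2 V v w) _ _ (@parseval_delta R n).
- by move=> c s v w; rewrite /Q !mom2_quadratic//; ring.
- have pd := @parseval_delta R n.
  rewrite /Q sumrB -!big_distrr/= -(inertia_parseval mU bU pd) -(inertia_parseval mV bV pd).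
  by rewrite mulrC subrr.
exists e; split => // i; have /eqP := Qe i; rewrite /Q subr_eq0 => /eqP h.
by rewrite mulrAC h mulrAC divff ?mul1r// gt_eqF.
Qed.

Lemma inertia_log_concave U V M : (0 < n)%N -> sbody U -> sbody V -> sbody M -> midpts U V M ->
  inertia U * inertia V <= inertia M ^+ 2.
Proof.
move=> n0 sbU sbV sbM UVM.
have [U0 V0] := (inertia_gt0 n0 sbU, inertia_gt0 n0 sbV).
have [mU mM] := (sbody_measurable sbU, sbody_measurable sbM).
have [[_ _ _ bU _] [_ _ _ bM _]] := (sbU, sbM).
have [e [pe he]] := common_frame sbU sbV U0.
(* In every direction of the frame, [k] times the moment of [U] is the geometric mean of the moments
   of [U] and [V]. With one [k] for all directions, the sum over the frame is the geometric mean of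
   the inertias. *)
pose k := Num.sqrt (inertia V / inertia U).
have k2 : k ^+ 2 = inertia V / inertia U by rewrite sqr_sqrtr// divr_ge0 ?ltW.
have hi i : k * mom2 U (e i) (e i) <= mom2 M (e i) (e i).
  have k0 : 0 <= k * mom2 U (e i) (e i) by rewrite mulr_ge0 ?sqrtr_ge0 ?mom2_ge0.
  rewrite -ler_sqr ?nnegrE ?mom2_ge0//.
  apply: le_trans (mom2_pl (e i) sbU sbV sbM UVM); rewrite he exprMn k2 expr2 mulrA.
  by rewrite [leLHS]mulrC.
have : k * inertia U <= inertia M.
  rewrite (inertia_parseval mU bU pe) (inertia_parseval mM bM pe) big_distrr/=.
  by apply: ler_sum.
move=> h; have : (k * inertia U) ^+ 2 <= inertia M ^+ 2.
  by rewrite ler_sqr ?nnegrE ?mulr_ge0 ?sqrtr_ge0 ?(ltW U0)// ltW// inertia_gt0.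
apply: le_trans; rewrite exprMn k2 expr2 le_eqVlt; apply/orP; left; apply/eqP.
by field; rewrite gt_eqF.
Qed.

(** The directional gaps are nonnegative and sum to 0, so every direction of the frame has equality;
    one nonzero direction is enough to descend from second moments to volumes. *)
Lemma inertia_equality U V M : (0 < n)%N -> sbody U -> sbody V -> sbody M -> midpts U V M ->
  inertia V = inertia U -> inertia M = inertia U ->
  lebV n U = lebV n V /\ lebV n M = lebV n U.
Proof.
move=> n0 sbU sbV sbM UVM VU MU.
have [U0 V0] := (inertia_gt0 n0 sbU, inertia_gt0 n0 sbV).
have [mU mV mM] := And3 (sbody_measurable sbU) (sbody_measurable sbV) (sbody_measurable sbM).
have [[_ _ _ bU _] [_ _ _ bV _] [_ _ _ bM _]] := And3 sbU sbV sbM.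
have [e [pe he]] := common_frame sbU sbV U0.
have {}he i : mom2 V (e i) (e i) = mom2 U (e i) (e i) by rewrite he VU divff ?mul1r// gt_eqF.
have hi i : mom2 U (e i) (e i) <= mom2 M (e i) (e i).
  rewrite -ler_sqr ?nnegrE ?mom2_ge0//.
  by apply: le_trans (mom2_pl (e i) sbU sbV sbM UVM); rewrite he expr2.
have eM i : mom2 M (e i) (e i) = mom2 U (e i) (e i).
  have : \sum_i (mom2 M (e i) (e i) - mom2 U (e i) (e i)) = 0.
    by rewrite sumrB -(inertia_parseval mU bU pe) -(inertia_parseval mM bM pe) MU subrr.
  by move=> /psumr_eq0P h; apply/eqP; rewrite -subr_eq0; apply/eqP; apply: h => // j _; rewrite subr_ge0.
have [i ei] := parseval_nonzero n0 pe.
set v := e i in ei; pose I j A := (\int[lebV n]_x (momf A v j 0%R x)%:E)%E.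
have If j A : sbody A -> I j A \is a fin_num.
  move=> sbA; have [_ _ _ bA _] := sbA; rewrite ge0_fin_numE; first exact: momf_finite (sbody_measurable sbA) bA.
  by apply: integral_ge0 => x _; rewrite lee_fin momf_ge0.
have Ipos j A : sbody A -> 0 < fine (I j A).
  by move=> sbA; rewrite -lte_fin fineK ?If//; have [oA _ _ _ A0] := sbA; exact: momf_pos.
have I2 A : sbody A -> (mom2 A v v)%:E = (2%:E * I 2%N A)%E by move=> sbA; rewrite mom2_momf.
have cancel2 (a b : \bar R) : a \is a fin_num -> b \is a fin_num -> (2%:E * a = 2%:E * b)%E -> a = b.
  move=> fa fb; rewrite -(fineK fa) -(fineK fb) -!EFinM => -[h]; congr EFin.
  by apply: (@mulfI _ 2 _ _ _ h); rewrite pnatr_eq0.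
have desc j : I j.+1 V = I j.+1 U /\ I j.+1 M = I j.+1 U -> I j V = I j U /\ I j M = I j U.
  move=> [hV hM].
  have e1 : I j.+1 U = (fine (I j.+1 U))%:E by rewrite fineK ?If.
  have [h1 h2] := momf_descent mU mV mM bU bV UVM (Ipos j.+1 U sbU) e1 (etrans hV e1) (etrans hM e1).
  by split => //; rewrite /I h1.
have [e0V e0M] : I 0 V = I 0 U /\ I 0 M = I 0 U.
  (* Two descents, from exponent 2 to 1 to 0; the half-space moment of exponent 0 is half the
     volume. *)
  by apply/desc/desc; split; apply: cancel2; rewrite ?If// -!I2// ?he ?eM.
have vol A : sbody A -> lebV n A = (2%:E * I 0%N A)%E.
  move=> sbA; rewrite (measure_indicE _ (sbody_measurable sbA)) -sym_split//.
  by apply: eq_integral => x _; rewrite expr0 mulr1.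
by rewrite !vol// e0V e0M.
Qed.

End inertia.

(** * Polar coordinates *)

Section polar.
Context {R : realType} {n : nat}.
Local Notation Rn := (borelRV R n).
Local Notation la := (@lebesgue_measure R).
Local Notation mR := (measurableTypeR R).

Lemma enorm_ge0 (x : 'rV[R]_n) : 0 <= enorm x. Proof. exact: sqrtr_ge0. Qed.

Lemma enorm_sqr (x : 'rV[R]_n) : enorm x ^+ 2 = dotv x x.
Proof. by rewrite sqr_sqrtr// dotvv_ge0. Qed.

Lemma enormZ (c : R) (x : 'rV[R]_n) : enorm (c *: x) = `|c| * enorm x.
Proof. by rewrite /enorm dotvZl dotvZr mulrA -expr2 sqrtrM ?sqr_ge0// sqrtr_sqr. Qed.

Lemma enorm_eq0 (x : 'rV[R]_n) : (enorm x == 0) = (x == 0).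
Proof. by rewrite /enorm sqrtr_eq0 le_eqVlt ltNge dotvv_ge0 orbF dotvv_eq0. Qed.

Lemma enorm0 : enorm (0 : 'rV[R]_n) = 0.
Proof. by apply/eqP; rewrite enorm_eq0. Qed.

(** The origin is sent to 0 because [0^-1 = 0], in agreement with [sphere_measure]. *)
Definition dirv (x : Rn) : Rn := (enorm x)^-1 *: x.

Lemma dirvZ (c : R) x : 0 < c -> dirv (c *: x) = dirv x.
Proof.
move=> c0; by rewrite /dirv enormZ gtr0_norm// scalerA invfM mulrAC mulVf ?mul1r// gt_eqF.
Qed.

Lemma dirv_sphere x : x != 0 -> usphere R n (dirv x).
Proof.
move=> x0; rewrite /usphere /= /dirv enormZ ger0_norm ?invr_ge0 ?enorm_ge0// mulVf//.
by rewrite enorm_eq0.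
Qed.

Lemma measurable_dirv : measurable_fun setT dirv.
Proof.
apply: measurable_scaleV; last exact: measurable_id.
apply: (@eq_measurable_funT _ _ _ _ _ (fun x : Rn => enorm x `^ (-1))) => [x|].
  by rewrite powR_inv1 ?enorm_ge0.
exact: (measurable_compT (measurable_powR (-1)) (@measurable_enorm R n)).
Qed.

Definition cone (A : set Rn) (t : R) : set Rn :=
  [set x | A (dirv x) /\ enorm x < t].

Lemma measurable_cone A t : measurable A -> measurable (cone A t).
Proof.
move=> mA; rewrite /cone; apply: measurableI.
  by rewrite -[X in measurable X]setTI; exact: measurable_dirv.
rewrite -[X in measurable X]setTI.
apply: (measurable_fun_ltr (g := fun=> t)) => //; exact: measurable_enorm.
Qed.

Lemma coneZ A t x : 0 < t -> cone A t x <-> cone A 1 (t^-1 *: x).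
Proof.
move=> t0; rewrite /cone /= dirvZ ?invr_gt0// enormZ gtr0_norm ?invr_gt0//.
by rewrite mulrC ltr_pdivrMr// mul1r.
Qed.

Lemma cone_volume A t : (0 < n)%N -> measurable A -> 0 <= t ->
  lebV n (cone A t) = ((t ^+ n)%:E * lebV n (cone A 1))%E.
Proof.
move=> n0 mA; rewrite le_eqVlt => /predU1P[<-|t0].
  rewrite expr0n eqn0Ngt n0 mul0e (_ : cone A 0 = set0) ?measure0//.
  by rewrite -subset0 => x [_]; rewrite ltNge enorm_ge0.
rewrite !(measure_indicE (lebV n)); [|exact: measurable_cone..].
have := @lebV_scale R n t^-1 (fun x => (\1_(cone A 1) x)%:E).
rewrite invr_gt0 => /(_ t0).
rewrite exprVn invrK => <-//.
- by apply: eq_integral => x _; congr EFin; apply: indic_iff; exact: coneZ.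
- by apply/measurable_EFinP/measurable_indic; exact: measurable_cone.
Qed.

Lemma cone_finite A t : measurable A -> (lebV n (cone A t) < +oo)%E.
Proof.
move=> mA; apply: lebV_bounded; first exact: measurable_cone.
exists (`|t| + 1); first by rewrite ltr_wpDl.
move=> x [_ xt] i; rewrite ltr_pwDr// (le_trans _ (ler_norm t))// ltW//.
apply: le_lt_trans xt; rewrite -ler_sqr ?nnegrE ?enorm_ge0// enorm_sqr real_normK ?num_real//.
rewrite /dotv (bigD1 i)//= -expr2 lerDl sumr_ge0// => j _; by rewrite -expr2 sqr_ge0.
Qed.

(** The closed cone lies in all slightly larger open cones, whose volumes tend to that of the open
    cone of radius [t] by homogeneity. *)
Lemma cone_closed A t : (0 < n)%N -> measurable A -> 0 <= t ->
  lebV n [set x | A (dirv x) /\ enorm x <= t] = lebV n (cone A t).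
Proof.
move=> n0 mA t0.
have mC : measurable ([set x | A (dirv x) /\ enorm x <= t] : set Rn).
  apply: measurableI.
    by rewrite -[X in measurable X]setTI; exact: measurable_dirv.
  rewrite -[X in measurable X]setTI.
  apply: (measurable_fun_ler (g := fun=> t)) => //; exact: measurable_enorm.
apply/eqP; rewrite eq_le; apply/andP; split; last first.
  apply: le_measure; rewrite ?inE//; first exact: measurable_cone.
  by move=> x [? /ltW].
apply/lee_addgt0Pr => e e0.
have f1 : lebV n (cone A 1) \is a fin_num by rewrite ge0_fin_numE ?cone_finite.
have cv : (s ^+ n * fine (lebV n (cone A 1))) @[s --> t] --> t ^+ n * fine (lebV n (cone A 1)).
  by apply: cvgM; [exact: exprn_continuous|exact: cvg_cst].
have /cvgrPdist_lt/(_ e e0) /nbhs_ballP [d /= d0 hd] := cv.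
pose s := t + d / 2.
have s0 : 0 <= s by rewrite addr_ge0// divr_ge0// ltW.
have ts : t < s by rewrite ltrDl divr_gt0.
have := hd s; rewrite -ball_normE/= opprD addrA subrr sub0r normrN gtr0_norm ?divr_gt0//.
rewrite ltr_pdivrMr// ltr_pMr// ltr1n => /(_ isT).
rewrite ltr_distlC => /andP[_ h].
apply: (@le_trans _ _ (lebV n (cone A s))).
  apply: le_measure; rewrite ?inE//; first exact: measurable_cone.
  by move=> x [? xt]; split => //; exact: le_lt_trans ts.
rewrite (cone_volume n0 mA s0) (cone_volume n0 mA t0) -(fineK f1) -!EFinM -EFinD lee_fin ltW//.
Qed.

Lemma sphm_exists : exists m : {measure set Rn -> \bar R},
  (m : set _ -> \bar R) = @sphere_measure R n.
Proof.
pose B : set Rn := [set x | enorm x <= 1].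
have mB : measurable B.
  rewrite -[X in measurable X]setTI.
  apply: (measurable_fun_ler (g := fun=> 1)) => //; exact: measurable_enorm.
pose m0 : {measure set Rn -> \bar R} := mrestr (lebV n) mB.
pose m1 : {measure set Rn -> \bar R} :=
  measure_function_pushforward__canonical__measure_function_Measure m0 measurable_dirv.
pose m : {measure set Rn -> \bar R} := mscale (NngNum (ler0n R n)) m1.
exists m; apply/funext => A; rewrite /sphere_measure -lebVE /m /mscale /=.
congr (_ * _)%E; rewrite /m1 /= /pushforward /m0 /= /mrestr; congr (lebV n _).
by apply/seteqP; split => x [? ?]; split.
Qed.

Definition sphm : {measure set Rn -> \bar R} := projT1 (cid sphm_exists).

Lemma sphmE : (sphm : set _ -> \bar R) = @sphere_measure R n.
Proof. by rewrite /sphm; case: cid. Qed.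

Lemma sphm_cone A : (0 < n)%N -> measurable A -> sphm A = (n%:R%:E * lebV n (cone A 1))%E.
Proof.
move=> n0 mA; rewrite sphmE /sphere_measure -lebVE -(cone_closed n0 mA ler01).
by congr (_ * lebV n _)%E; apply/seteqP; split => x [? ?]; split.
Qed.

Definition wcone (A : set Rn) (t : R) : \bar R :=
  (\int[lebV n]_x (\1_(cone A t) x * enorm x ^+ 2)%:E)%E.

Lemma measurable_weight A : measurable A ->
  measurable_fun setT (fun x : Rn => (\1_A x * enorm x ^+ 2)%:E).
Proof.
move=> mA; apply/measurable_EFinP; apply: measurable_funM; first exact: measurable_indic.
by apply: measurable_funX; exact: measurable_enorm.
Qed.

Lemma wconeZ A t : measurable A -> 0 <= t ->
  wcone A t = ((t ^+ (n + 2))%:E * wcone A 1)%E.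
Proof.
move=> mA; rewrite le_eqVlt => /predU1P[<-|t0].
  rewrite expr0n addn2 mul0e; apply: integral0_eq => x _.
  by rewrite indicE memNset ?mul0r// => -[_]; rewrite ltNge enorm_ge0.
have := @lebV_scale R n t^-1 (fun x => (\1_(cone A 1) x * enorm x ^+ 2)%:E).
rewrite invr_gt0 => /(_ t0 (measurable_weight (measurable_cone 1 mA))) => /(_ (fun x => _))%E h.
rewrite -/(wcone A 1) in h.
have {}h := h (fun x => ltac:(by rewrite lee_fin mulr_ge0// sqr_ge0)).
rewrite addnC exprD EFinM -muleA; move: h; rewrite exprVn invrK => <-.
rewrite -ge0_integralZl//; last 3 first.
- have mS : measurable_fun setT (fun x : Rn => t^-1 *: x : Rn).
    by apply: measurable_scaleV => //; exact: measurable_id.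
  exact: (measurable_compT (measurable_weight (measurable_cone 1 mA)) mS).
- by move=> x _; rewrite lee_fin mulr_ge0// sqr_ge0.
- by rewrite lee_fin sqr_ge0.
apply: eq_integral => x _; rewrite -EFinM; congr EFin.
rewrite (@indic_iff R _ _ _ _ _ _ (coneZ A x t0)) [RHS]mulrCA; congr (_ * _).
by rewrite enormZ exprMn gtr0_norm ?invr_gt0// mulrA -exprMn divff ?expr1n ?mul1r// gt_eqF.
Qed.

Lemma integral_indic_itvoo (a b : R) : a <= b ->
  (\int[la]_l (\1_(`]a, b[%classic : set R) l)%:E = (b - a)%:E)%E.
Proof.
move=> ab; have -> : (b - a)%:E = la `]a, b[%classic.
  rewrite lebesgue_measure_itv/= lte_fin; case: ltP => // ba.
  by congr EFin; apply/eqP; rewrite subr_eq0 eq_le ab ba.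
by rewrite measure_indicE//; exact: measurable_itv.
Qed.

(** The removed cone of radius [sqrt l] is a scaled copy of the whole one, up to a null boundary. *)
Lemma annulus_volume A l : (0 < n)%N -> measurable A -> 0 < l < 1 ->
  lebV n [set x | cone A 1 x /\ (l < enorm x ^+ 2)%R] =
  ((1 - Num.sqrt l ^+ n)%:E * lebV n (cone A 1))%E.
Proof.
move=> n0 mA /andP[l0 l1].
have mC := measurable_cone 1 mA.
have s1 : Num.sqrt l < 1 by rewrite -sqrtr1 ltr_sqrt.
set D := [set x | _].
pose E : set Rn := [set x | A (dirv x) /\ enorm x <= Num.sqrt l].
have DE x : (l < enorm x ^+ 2) = ~~ (enorm x <= Num.sqrt l).
  by rewrite -ltNge -[X in X < _](sqr_sqrtr (ltW l0)) ltr_sqr ?nnegrE ?sqrtr_ge0 ?enorm_ge0.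
have mE : measurable E.
  apply: measurableI.
    by rewrite -[X in measurable X]setTI; exact: measurable_dirv.
  rewrite -[X in measurable X]setTI.
  apply: (measurable_fun_ler (g := fun=> Num.sqrt l)) => //; exact: measurable_enorm.
have DI : D = cone A 1 `\` E.
  apply/seteqP; split => x; rewrite /D /= DE.
    by move=> [h1 /negP h2]; split => // -[_ /h2].
  by move=> [[Ax x1] nE]; split => //; apply/negP => h; apply: nE.
have EC : E `<=` cone A 1 by move=> x [Ax xl]; split => //; exact: le_lt_trans s1.
rewrite DI measureD//; last exact: cone_finite.
rewrite setIidr//.
have eE : lebV n E = ((Num.sqrt l ^+ n)%:E * lebV n (cone A 1))%E.
  by rewrite /E cone_closed ?sqrtr_ge0// (cone_volume n0 mA (sqrtr_ge0 l)).
transitivity (lebV n (cone A 1) - (Num.sqrt l ^+ n)%:E * lebV n (cone A 1))%E.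
  by congr (_ - _)%E; exact: eE.
have f1 : lebV n (cone A 1) \is a fin_num by rewrite ge0_fin_numE ?cone_finite.
by rewrite -(fineK f1) -!EFinM -EFinB mulrBl mul1r.
Qed.

(** Slicing the weight [|x|^2] into levels [l] turns the weighted cone into shells, whose volumes
    are proportional to that of the cone. The constant [fine K / n%:R] has the value [1 / (n + 2)];
    what is used of it is positivity. *)
Lemma wcone_const : (0 < n)%N -> exists2 c : R, 0 < c &
  forall A, measurable A -> wcone A 1 = (c%:E * sphm A)%E.
Proof.
move=> n0.
pose k (l : mR) : R := \1_(`]0%R, 1%R[%classic : set R) l * (1 - Num.sqrt l ^+ n).
have k0 l : 0 <= k l.
  rewrite /k indicE; case: (boolP (_ \in _)) => [|_]; last by rewrite mul0r.
  rewrite inE /= in_itv/= mul1r => /andP[l0 l1]; rewrite subr_ge0 exprn_ile1 ?sqrtr_ge0//.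
  by rewrite -sqrtr1 ler_sqrt// ltW.
have mk : measurable_fun setT (fun l => (k l)%:E).
  apply/measurable_EFinP; apply: measurable_funM.
    by apply: measurable_indic; exact: measurable_itv.
  apply: measurable_funB => //; apply: measurable_funX.
  by apply: continuous_measurable_fun; exact: sqrt_continuous.
pose K := (\int[la]_l (k l)%:E)%E.
have Kfin : K \is a fin_num.
  rewrite ge0_fin_numE; last by apply: integral_ge0 => l _; rewrite lee_fin.
  apply: (@le_lt_trans _ _ (\int[la]_l (\1_(`]0%R, 1%R[%classic : set R) l)%:E)%E).
    apply: ge0_le_integral => //.
    - by move=> l _; rewrite lee_fin.
    - by apply/measurable_EFinP/measurable_indic; exact: measurable_itv.
    - move=> l _; rewrite lee_fin /k ler_piMr// gerBl// exprn_ge0// sqrtr_ge0//.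
  by rewrite integral_indic_itvoo// ltry.
have Kpos : (0 < K)%E.
  (* For [0 < l < 1/4] one has [sqrt l <= 1/2], so [k l] is at least [1/2] there. *)
  apply: (@lt_le_trans _ _ (2^-1%:E * \int[la]_l (\1_(`]0%R, 4^-1%R[%classic : set R) l)%:E)%E).
    by rewrite integral_indic_itvoo ?invr_ge0// subr0 -EFinM lte_fin mulr_gt0 ?invr_gt0.
  rewrite -ge0_integralZl ?lee_fin ?invr_ge0//; last first.
    by apply/measurable_EFinP/measurable_indic; exact: measurable_itv.
  apply: ge0_le_integral => //.
  - by apply: measurable_funeM; apply/measurable_EFinP/measurable_indic; exact: measurable_itv.
  move=> l _; rewrite -EFinM lee_fin; rewrite indicE.
  case: (boolP (_ \in _)) => [|_]; last by rewrite mulr0.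
  rewrite inE /= in_itv/= mulr1 => /andP[l0 l4].
  have l1 : l < 1 by apply: lt_trans l4 _; rewrite invf_lt1// ltr1n.
  rewrite /k indicE mem_set/= ?in_itv/= ?l0// mul1r.
  have s2 : Num.sqrt l <= 2^-1.
    have -> : 2^-1 = Num.sqrt (4^-1) :> R.
      by rewrite (_ : 4^-1 = 2^-1 ^+ 2) ?sqrtr_sqr ?gtr0_norm ?invr_gt0//; field.
    by rewrite ler_sqrt ?invr_ge0// ltW.
  have s3 : Num.sqrt l ^+ n <= Num.sqrt l.
    have s00 := sqrtr_ge0 l.
    have s11 : Num.sqrt l <= 1 by rewrite (le_trans s2)// invf_le1// ler1n.
    by apply: ler_iXnr.
  lra.
exists (fine K / n%:R).
  by rewrite divr_gt0 ?ltr0n// fine_gt0// Kpos ltey_eq Kfin.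
move=> A mA; rewrite sphm_cone// muleA -EFinM divfK ?pnatr_eq0 -?lt0n// fineK//.
pose S := [set p : Rn * mR | cone A 1 p.1 /\ (0 < p.2 < enorm p.1 ^+ 2)].
have mC := measurable_cone 1 mA.
have mS : measurable S.
  have m1 : measurable_fun setT (fun p : Rn * mR => enorm p.1 ^+ 2).
    apply: measurable_funX; exact: (measurable_compT (@measurable_enorm R n) measurable_fst).
  rewrite (_ : S = (fst @^-1` cone A 1) `&` ([set p | 0 < p.2] `&` [set p | p.2 < enorm p.1 ^+ 2])).
    apply: measurableI; first by rewrite -[X in measurable X]setTI; exact: measurable_fst.
    apply: measurableI; rewrite -[X in measurable X]setTI.
      by apply: (measurable_fun_ltr (f := fun=> 0) (g := snd)) => //.
    by apply: (measurable_fun_ltr (f := snd)) => //.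
  by apply/seteqP; split => p /=; [move=> [h1 /andP[h2 h3]]|move=> [h1 [h2 h3]]]; split => //; apply/andP.
have mI : measurable_fun setT (fun p : Rn * mR => (\1_S p : R)%:E).
  exact/measurable_EFinP/measurable_indic.
transitivity (\int[lebV n]_x \int[la]_l (\1_S (x, l) : R)%:E)%E.
  apply: eq_integral => x _; have [Cx|nC] := pselect (cone A 1 x); last first.
    rewrite indicE memNset// mul0r; apply/esym; apply: integral0_eq => l _.
    by rewrite indicE memNset// => -[].
  rewrite indicE mem_set// mul1r.
  transitivity (la `]0%R, (enorm x ^+ 2)%R[).
    rewrite lebesgue_measure_itv/= lte_fin; case: ltP => h; first by rewrite sube0.
    by congr EFin; apply: le_anti; rewrite h sqr_ge0.
  rewrite measure_indicE//; apply: eq_integral => l _; congr EFin; apply: indic_iff.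
  by rewrite /S /= in_itv/=; split => [h|[]].
rewrite (@fubini_tonelli _ _ _ _ _ (lebV n) la (fun p => (\1_S p)%:E))//.
rewrite muleC -ge0_integralZl//; last by move=> l _; rewrite lee_fin.
apply: eq_integral => l _; rewrite /k indicE.
case: (boolP (_ \in _)) => [|/negP]; rewrite inE /= in_itv/= => hl.
  rewrite mul1r muleC -annulus_volume// measure_indicE.
    by apply: eq_integral => x _; congr EFin; apply: indic_iff; rewrite /S /=; case/andP: hl => -> _; split.
  rewrite (_ : [set x | _] = cone A 1 `&` [set x | l < enorm x ^+ 2])//.
  apply: measurableI => //; rewrite -[X in measurable X]setTI.
  by apply: (measurable_fun_ltr (f := fun=> l)) => //; apply: measurable_funX; exact: measurable_enorm.
rewrite mul0r mule0; apply: integral0_eq => x _; rewrite indicE memNset// => -[[_ x1] /= /andP[l0 lx]].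
apply: hl; rewrite l0/= (lt_trans lx)//; rewrite expr_lt1 ?enorm_ge0//.
Qed.


Lemma fimfun_comp d (T : measurableType d) (f : {nnsfun T >-> R}) (g : R -> \bar R) (x : T) :
  g (f x) = (\sum_(y \in range f) (\1_(f @^-1` [set y]) x)%:E * g y)%E.
Proof.
rewrite (fsbigD1 (f x))//=; last by exists x.
rewrite indicE mem_set// mul1e fsbig1 ?adde0// => y [_ /= yfx].
by rewrite indicE memNset ?mul0e// => fy; apply: yfx.
Qed.

Lemma nnsfun_approx_real d (T : measurableType d) (G : T -> R) : measurable_fun setT G -> (forall x, 0 <= G x) ->
  exists f : {nnsfun T >-> R}^nat,
    (forall x, {homo (fun k => f k x) : i j / (i <= j)%N >-> i <= j}) /\
    (forall x, f k x @[k --> \oo] --> G x).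
Proof.
move=> mG G0; have mGE : measurable_fun setT (EFin \o G) by exact/measurable_EFinP.
exists (nnsfun_approx measurableT mGE); split => x.
  by move=> i j ij; have /lefP := nd_nnsfun_approx measurableT mGE ij; exact.
have h : (EFin \o (fun k => nnsfun_approx measurableT mGE k x)) @ \oo --> (G x)%:E.
  by apply: (cvg_nnsfun_approx measurableT mGE) => // y _; rewrite lee_fin.
exact: (fine_cvg h).
Qed.

Definition radial_region (r : Rn -> R) : set Rn :=
  [set x | enorm x < r (dirv x)].

Lemma measurable_radial_region r : measurable_fun setT r -> measurable (radial_region r).
Proof.
move=> mr; rewrite -[X in measurable X]setTI.
apply: (measurable_fun_ltr (f := fun x : Rn => enorm x)) => //; first exact: measurable_enorm.
exact: (measurable_compT mr measurable_dirv).
Qed.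

(** For a simple [r] the region is a disjoint union of cones over the level sets of [r]. *)
Lemma polar_nnsfun c (r : {nnsfun Rn >-> R}) : (0 < n)%N -> 0 < c ->
  (forall A, measurable A -> wcone A 1 = (c%:E * sphm A)%E) ->
  (\int[lebV n]_x (\1_(radial_region r) x * enorm x ^+ 2)%:E =
   c%:E * \int[sphm]_u (r u ^+ (n + 2))%:E)%E.
Proof.
move=> n0 c0 hc; have fR := @fimfunP _ _ r.
have mpre y : measurable (r @^-1` [set y]) by exact: measurable_sfunP.
transitivity (\sum_(y \in range r) wcone (r @^-1` [set y]) y)%E.
  rewrite -ge0_integral_fsum//; last 2 first.
  - by move=> y; apply: measurable_weight; exact: measurable_cone.
  - by move=> y x _; rewrite lee_fin mulr_ge0// sqr_ge0.
  apply: eq_integral => x _.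
  rewrite [LHS](_ : _ = (fun a : R => (\1_[set a | enorm x < a]%R a * enorm x ^+ 2)%:E) (r (dirv x))); last first.
    by congr (EFin (_ * _)); exact: indic_iff.
  rewrite (fimfun_comp r (fun a : R => (\1_[set a | enorm x < a]%R a * enorm x ^+ 2)%:E)).
  apply: eq_fsbigr => y _; rewrite -EFinM mulrA; congr (EFin (_ * _)).
  rewrite (@indic_iff R _ _ (r @^-1` [set y]) (dirv @^-1` (r @^-1` [set y])) _ x)//.
  rewrite (@indic_iff R _ _ [set a : R | enorm x < a] [set x : Rn | enorm x < y] _ x)//.
  by rewrite /cone -[RHS]/(\1_(dirv @^-1` (r @^-1` [set y]) `&` [set x : Rn | enorm x < y]) x) indicI.
rewrite (_ : \int[sphm]_u (r u ^+ (n + 2))%:E = \sum_(y \in range r) (y ^+ (n + 2))%:E * sphm (r @^-1` [set y]))%E; last first.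
  transitivity (\sum_(y \in range r) \int[sphm]_u ((y ^+ (n + 2))%:E * (\1_(r @^-1` [set y]) u)%:E))%E.
    rewrite -ge0_integral_fsum//; last 2 first.
    - move=> y; apply: measurable_funeM; apply/measurable_EFinP; exact: measurable_indic.
    - move=> y u _; have [y0|y0] := leP 0 y; first by rewrite -EFinM lee_fin mulr_ge0// exprn_ge0.
      by rewrite preimage_nnfun0// indic0 mule0.
    apply: eq_integral => u _; rewrite (fimfun_comp r (fun a : R => (a ^+ (n + 2))%:E)).
    by apply: eq_fsbigr => y _; rewrite muleC.
  apply: eq_fsbigr => y /set_mem [u _ ruy].
  rewrite ge0_integralZl ?lee_fin ?exprn_ge0// -?ruy//; last first.
    by apply/measurable_EFinP; exact: measurable_indic.
  by rewrite -measure_indicE.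
rewrite ge0_mule_fsumr; last first.
  move=> y; have [y0|y0] := leP 0 y; first by rewrite mule_ge0// lee_fin exprn_ge0.
  by rewrite preimage_nnfun0// measure0 mule0.
apply: eq_fsbigr => y /set_mem [u _ ruy].
by rewrite wconeZ// -?ruy// hc// muleCA.
Qed.

(** Simple functions increase to [r]; because the region is cut out by a strict inequality, its
    indicator is the limit of theirs. *)
Lemma polar c (r : Rn -> R) : (0 < n)%N -> 0 < c ->
  (forall A, measurable A -> wcone A 1 = (c%:E * sphm A)%E) ->
  measurable_fun setT r -> (forall u, 0 <= r u) ->
  (\int[lebV n]_x (\1_(radial_region r) x * enorm x ^+ 2)%:E =
   c%:E * \int[sphm]_u (r u ^+ (n + 2))%:E)%E.
Proof.
move=> n0 c0 hc mr r0.
have [f [fnd fcv]] := nnsfun_approx_real mr r0.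
have fle k u : f k u <= r u.
  have := @nondecreasing_cvgn_le _ (fun k => f k u) (fnd u) (cvgP _ (fcv u)) k.
  by rewrite (cvg_lim _ (fcv u)).
have cvL : (\int[lebV n]_x (\1_(radial_region (f k)) x * enorm x ^+ 2)%:E @[k --> \oo] -->
   \int[lebV n]_x (\1_(radial_region r) x * enorm x ^+ 2)%:E)%E.
  have pc x : ((\1_(radial_region (f k)) x * enorm x ^+ 2)%:E @[k --> \oo] -->
      (\1_(radial_region r) x * enorm x ^+ 2)%:E)%E.
    have [xr|nxr] := ltP (enorm x) (r (dirv x)).
      have : \forall k \near \oo, enorm x < f k (dirv x) by exact: (cvgr_gt _ (fcv (dirv x))).
      move=> h; apply: cvg_near_cst; apply: filterS h => k xf.
      have e : \1_(radial_region (f k)) x = \1_(radial_region r) x :> R by apply: indic_iff.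
      by rewrite e.
    apply: cvg_near_cst; apply: nearW => k.
    have e : \1_(radial_region (f k)) x = \1_(radial_region r) x :> R.
      apply: indic_iff; rewrite /radial_region /=; split => h.
        by have := lt_le_trans h (fle k _); rewrite ltNge nxr.
      by move: h; rewrite ltNge nxr.
    by rewrite e.
  rewrite (_ : \int[lebV n]_x (\1_(radial_region r) x * enorm x ^+ 2)%:E =
     \int[lebV n]_x limn (fun k => (\1_(radial_region (f k)) x * enorm x ^+ 2)%:E))%E; last first.
    by apply: eq_integral => x _; rewrite (cvg_lim _ (pc x)).
  apply: cvg_monotone_convergence => //.
  - by move=> k; apply: measurable_weight; exact: measurable_radial_region.
  - by move=> k x _; rewrite lee_fin mulr_ge0// sqr_ge0.
  - move=> x _ i j ij; rewrite lee_fin ler_wpM2r ?sqr_ge0// !indicE ler_nat.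
    have [xi|] := pselect (radial_region (f i) x); last by move=> ?; rewrite memNset.
    rewrite !mem_set//; exact: lt_le_trans xi (fnd _ _ _ ij).
have cvR : (\int[sphm]_u (f k u ^+ (n + 2))%:E @[k --> \oo] --> \int[sphm]_u (r u ^+ (n + 2))%:E)%E.
  have pc u : ((f k u ^+ (n + 2))%:E @[k --> \oo] --> (r u ^+ (n + 2))%:E)%E.
    have h : (fun k => f k u ^+ (n + 2)) @ \oo --> r u ^+ (n + 2).
      exact: (continuous_cvg _ (@exprn_continuous R (n + 2) (r u)) (fcv u)).
    by apply: cvg_EFin; [exact: nearW|exact: h].
  rewrite (_ : \int[sphm]_u (r u ^+ (n + 2))%:E = \int[sphm]_u limn (fun k => (f k u ^+ (n + 2))%:E))%E; last first.
    by apply: eq_integral => u _; rewrite (cvg_lim _ (pc u)).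
  apply: cvg_monotone_convergence => //.
  - by move=> k; apply/measurable_EFinP/measurable_funX; exact: measurable_funP.
  - by move=> k u _; rewrite lee_fin exprn_ge0.
  - by move=> u _ i j ij; rewrite lee_fin; apply: lerXn2r; rewrite ?nnegrE//; exact: fnd.
have cvR2 := cvgeZl (ltac:(by []) : c%:E \is a fin_num) cvR.
have e : (fun k => \int[lebV n]_x (\1_(radial_region (f k)) x * enorm x ^+ 2)%:E)%E =
    (fun k => c%:E * \int[sphm]_u (f k u ^+ (n + 2))%:E)%E.
  by apply/funext => k; exact: polar_nnsfun.
rewrite e in cvL.
have h1 := cvg_lim (@ereal_hausdorff R) cvL; have h2 := cvg_lim (@ereal_hausdorff R) cvR2.
by rewrite -h1 -h2.
Qed.

End polar.

(** * Convex bodies and their normals *)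

Lemma measurable_fun_gt {R : realType} d (T : measurableType d) (f : T -> R) :
  (forall a : R, measurable [set x | a < f x]) -> measurable_fun setT f.
Proof.
move=> h mT; apply: (measurability _ (RGenOInfty.measurableE R)) => // _ [_ [a ->] <-].
rewrite setTI (_ : _ @^-1` _ = [set x | a < f x]); first exact: h.
by apply/seteqP; split => x; rewrite /= in_itv/= andbT.
Qed.

Section symmetric_bodies.
Context {R : realType} {n : nat}.
Local Notation Rn := (borelRV R n).

Definition cbody (K : set 'rV[R]_n) :=
  [/\ compact K, convexV K, (forall x, K x -> K (- x)) & exists2 r : R, 0 < r & forall d : 'rV[R]_n, `|d| < r -> K d].

(** By symmetry a ball about an interior point [x0] moves to the origin: [d] is the midpoint of
    [x0 + d] and [- (x0 - d)]. *)
Lemma cbody_convex_body (K : set 'rV[R]_n) : convex_body K -> origin_symmetric K -> cbody K.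
Proof.
move=> [cK cvK [x0 ix0]] sK.
have sym x : K x -> K (- x) by rewrite {2}sK => Kx; exists x.
have cv : convexV K.
  move=> x y t Kx Ky /andP[t0 t1].
  pose l : {i01 R} := Itv01 t0 t1.
  by have := cvK x y l (mem_set Kx) (mem_set Ky); rewrite inE.
split => //.
have /nbhs_ballP[e /= e0 he] := ix0.
exists e => // d de.
have h1 : K (x0 + d) by apply: he; rewrite -ball_normE /= opprD addNKr normrN.
have h2 : K (- (x0 - d)) by apply/sym/he; rewrite -ball_normE /= opprB addrC subrK.
have := convex_midpts cv h1 h2.
rewrite (_ : 2^-1 *: _ = d)//; apply/rowP => i; rewrite !mxE; lra.
Qed.

(* The interior of K; dilations make openness and the radial description immediate. *)
Definition core (K : set 'rV[R]_n) : set 'rV[R]_n := [set x | exists2 s : R, 1 < s & K (s *: x)].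

Section one_body.
Variable K : set 'rV[R]_n.
Hypothesis bK : cbody K.

Lemma cbody_closed : closed K.
Proof. by case: bK => cK _ _ _; apply: compact_closed => //; exact: norm_hausdorff. Qed.

Lemma cbody_bounded : boundedV K.
Proof.
case: bK => cK _ _ _; have [M [_ hM]] := compact_bounded cK.
exists (`|M| + 2) => [|x Kx i]; first by rewrite ltr_wpDl.
apply: le_lt_trans (rV_normP x i) _.
have := hM (`|M| + 1) _ _ Kx; rewrite /= => /(_ _)/le_lt_trans; apply; last by rewrite ltrD2l ltr1n.
by rewrite (le_lt_trans (ler_norm M))// ltrDl.
Qed.

Lemma cbody0 : K 0.
Proof. by case: bK => _ _ _ [r r0]; apply; rewrite normr0. Qed.

Lemma cbody_star (c : R) x : 0 <= c <= 1 -> K x -> K (c *: x).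
Proof.
move=> c01 Kx; case: bK => _ cv _ _.
by have := cv x 0 c Kx cbody0 c01; rewrite scaler0 addr0.
Qed.

(** The convex hull of [p] and a ball about 0 contains a ball about [t *: p]. *)
Lemma cbody_fat (t : R) p : 0 <= t < 1 -> K p ->
  exists2 r : R, 0 < r & forall d, `|d| < r -> K (t *: p + d).
Proof.
move=> /andP[t0 t1] Kp; case: bK => _ cv _ [r r0 hr].
exists ((1 - t) * r) => [|d hd]; first by rewrite mulr_gt0// subr_gt0.
have t1' : 0 < 1 - t by rewrite subr_gt0.
have := cv p ((1 - t)^-1 *: d) t Kp _ _; rewrite scalerA divff ?scale1r ?gt_eqF//; apply.
  by apply: hr; rewrite normrZ gtr0_norm ?invr_gt0// mulrC ltr_pdivrMr// mulrC.
by rewrite t0 ltW.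
Qed.

Lemma core_fat x : core K x -> exists2 r : R, 0 < r & forall d, `|d| < r -> core K (x + d).
Proof.
move=> [s s1 Ksx].
have s0 : 0 < s by rewrite (lt_trans _ s1).
(* An intermediate factor: [q > 1] still witnesses membership in the core, and [q < s] leaves room
   for a ball. *)
pose q := (1 + s) / 2; have q1 : 1 < q by rewrite /q; lra.
have q0 : 0 < q by rewrite (lt_trans _ q1).
have qs : 0 <= q / s < 1.
  by rewrite divr_ge0 ?ltW//= ltr_pdivrMr// mul1r /q; lra.
have [r r0 hr] := cbody_fat qs Ksx.
exists (r / q) => [|d hd]; first exact: divr_gt0.
exists q => //; rewrite scalerDr.
have := hr (q *: d); rewrite scalerA divfK ?gt_eqF//; apply.
by rewrite normrZ gtr0_norm// mulrC -ltr_pdivlMr.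
Qed.

Lemma core_open : open (core K).
Proof.
rewrite openE => x /core_fat[r r0 hr].
apply/nbhs_ballP; exists r => //= y; rewrite -ball_normE /= => hy.
by rewrite -[y](subrKC x); apply: hr; rewrite distrC.
Qed.

Lemma core_sub : core K `<=` K.
Proof.
move=> x [s s1 Ks]; have s0 : 0 < s by rewrite (lt_trans _ s1).
have := @cbody_star s^-1 _ _ Ks; rewrite scalerA mulVf ?scale1r ?gt_eqF//; apply.
by rewrite invr_ge0 ltW//= invf_le1// ltW.
Qed.

Lemma core_sbody : sbody (core K).
Proof.
case: bK => _ cv sym _; split.
- exact: core_open.
- move=> x y t [s s1 Ks] [q q1 Kq] t01.
  (* The smaller of the two dilation factors serves for both points, since [K] is star-shaped about
     0. *)
  wlog sq : x y t t01 s q s1 q1 Ks Kq / s <= q.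
    move=> h; have [|/ltW] := leP s q; first exact: h.
    move=> qs; have t01' : 0 <= 1 - t <= 1 by lra.
    have := h y x (1 - t) t01' q s q1 s1 Kq Ks qs.
    by rewrite opprB addrCA subrr addr0 addrC.
  exists s => //; rewrite scalerDr !scalerA ![s * _]mulrC -!scalerA; apply: cv => //.
  have q0 : 0 < q by rewrite (lt_trans _ q1).
  have := @cbody_star (s / q) _ _ Kq; rewrite scalerA divfK ?gt_eqF//; apply.
  by rewrite ler_pdivrMr// mul1r sq andbT divr_ge0// ltW// (lt_trans _ s1).
- by move=> x [s s1 Ks]; exists s => //; rewrite scalerN; exact: sym.
- by have [C C0 hC] := cbody_bounded; exists C => // x /core_sub; exact: hC.
- by exists 2; [lra|rewrite scaler0; exact: cbody0].
Qed.

Lemma radial_has_sup u : u != 0 -> has_sup [set l : R | 0 < l /\ K (l *: u)].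
Proof.
move=> u0; split.
  case: bK => _ _ _ [r r0 hr].
  have nu : 0 < `|u| by rewrite normr_gt0.
  exists (r / 2 / `|u|); split; first by rewrite !divr_gt0.
  apply: hr; rewrite normrZ gtr0_norm ?divr_gt0// divfK ?gt_eqF//; lra.
have [C C0 hC] := cbody_bounded.
have [i ui] : exists i, u 0 i != 0.
  apply/existsP; apply: contraNT u0 => /existsPn h; apply/eqP/rowP => i; rewrite mxE.
  by apply/eqP; have := h i; rewrite negbK.
exists (C / `|u 0 i|) => l [l0 /hC /(_ i)]; rewrite mxE normrM gtr0_norm// => h.
by rewrite ler_pdivlMr ?normr_gt0// ltW.
Qed.

Lemma radial_gt0 u : u != 0 -> 0 < radial_fun K u.
Proof.
move=> u0; have hs := radial_has_sup u0; have [[l lP] _] := hs.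
by apply: lt_le_trans (sup_upper_bound hs lP); case: lP.
Qed.

Lemma radial_mem u : u != 0 -> K (radial_fun K u *: u).
Proof.
move=> u0; have hs := radial_has_sup u0.
have cl : closed [set l : R | K (l *: u)].
  apply: (@preimage_closed _ _ (fun l : R => l *: u) _ _ cbody_closed).
  by move=> l _; apply: cvgZr_tmp; exact: cvg_id.
apply: cl; have := closure_sup hs.1 hs.2; apply: closure_subset.
by move=> l [].
Qed.

Lemma radialP u (l : R) : u != 0 -> 0 < l -> K (l *: u) <-> l <= radial_fun K u.
Proof.
move=> u0 l0; split => [Kl|lr].
  by apply: sup_upper_bound; [exact: radial_has_sup|].
have r0 := radial_gt0 u0.
have := @cbody_star (l / radial_fun K u) _ _ (radial_mem u0).
rewrite scalerA divfK ?gt_eqF//; apply.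
by rewrite ler_pdivrMr// mul1r lr andbT divr_ge0// ltW.
Qed.

Lemma coreP u (l : R) : u != 0 -> 0 < l -> core K (l *: u) <-> l < radial_fun K u.
Proof.
move=> u0 l0; split=> [[s s1]|lr].
  rewrite scalerA => /(radialP u0 (mulr_gt0 (lt_trans ltr01 s1) l0)).
  by apply: lt_le_trans; rewrite ltr_pMl.
exists (radial_fun K u / l); first by rewrite ltr_pdivlMr// mul1r.
by rewrite scalerA divfK ?gt_eqF//; exact: radial_mem.
Qed.

(** For [a >= 0] a superlevel set is open: away from 0 it consists of the [u] with [a *: u] in the
    core. *)
Lemma measurable_radial_fun : measurable_fun setT (radial_fun K : Rn -> R).
Proof.
(* At [u = 0] every positive [l] is admissible, and [sup] of an unbounded set is 0. *)
have r0 : radial_fun K 0 = 0.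
  apply: sup_out => -[_ [C hC]].
  have : [set l : R | 0 < l /\ K (l *: (0 : 'rV[R]_n))] (`|C| + 1).
    by split; [rewrite ltr_wpDl|rewrite scaler0; exact: cbody0].
  by move=> /hC; have := ler_norm C; lra.
apply: measurable_fun_gt => a; have [a0|a0] := ltP a 0.
  rewrite (_ : [set x | _] = setT); first exact: measurableT.
  apply/seteqP; split => // u _ /=.
  by have [->|/radial_gt0 h] := eqVneq u 0; [rewrite r0|exact: lt_trans h].
rewrite (_ : [set x | _] = (~` [set 0]) `&` [set u : Rn | core K (a *: u)]).
  apply: measurableI.
    by apply: measurable_open; apply: closed_openC; apply: compact_closed; [exact: norm_hausdorff|exact: compact_set1].
  apply: measurable_open; apply: (@open_comp _ _ (fun u : 'rV[R]_n => a *: u) (core K)); last exact: core_open.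
  by move=> u _; apply: scaler_continuous.
apply/seteqP; split => u /=.
  move=> ar; have u0 : u != 0.
    by apply/eqP => u0; move: ar; rewrite u0 r0 ltNge a0.
  split; first exact/eqP.
  move: a0; rewrite le_eqVlt => /predU1P[<-|a0]; last exact/coreP.
  by rewrite scale0r; case: core_sbody.
move=> [/eqP u0 h]; move: a0; rewrite le_eqVlt => /predU1P[<-|a0]; first exact: radial_gt0.
exact/coreP.
Qed.

Lemma usphere_neq0 (u : 'rV[R]_n) : usphere R n u -> u != 0.
Proof. by move=> Su; rewrite -enorm_eq0 Su oner_eq0. Qed.

Lemma radial_boundary u : usphere R n u -> boundary K (radial_fun K u *: u).
Proof.
move=> /usphere_neq0 u0; have rm := radial_mem u0; have r0 := radial_gt0 u0.
split; first exact: subset_closure.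
move=> /nbhs_ballP[e /= e0 he].
have nu : 0 < `|u| by rewrite normr_gt0.
have : K ((radial_fun K u + e / 2 / `|u|) *: u).
  apply: he; rewrite -ball_normE /= scalerDl opprD addNKr normrN normrZ gtr0_norm ?divr_gt0//.
  by rewrite divfK ?gt_eqF//; lra.
have h : 0 < e / 2 / `|u| by rewrite !divr_gt0.
by move=> /(radialP u0 (addr_gt0 r0 h)); rewrite gerDl leNgt h.
Qed.

Lemma boundary_mem x : boundary K x -> K x.
Proof. by case=> cx _; exact: cbody_closed. Qed.

Lemma dotv_compact_max (v : 'rV[R]_n) : exists2 x, K x & forall y, K y -> dotv y v <= dotv x v.
Proof.
case: (bK) => cK _ _ _.
have [|c Kc hc] := @compact_EVT_max _ R (fun x : 'rV[R]_n => dotv x v) K (ex_intro _ 0 cbody0) cK.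
  by apply: continuous_subspaceT => x; exact: continuous_dotr.
by exists c => [|y Ky]; [rewrite -inE|apply: hc; rewrite inE].
Qed.

Lemma support_max (v : 'rV[R]_n) : exists2 x, K x & support_fun K v = dotv x v.
Proof.
have [x Kx hx] := dotv_compact_max v; exists x => //.
apply/eqP; rewrite eq_le; apply/andP; split.
  by apply: ge_sup; [exists (dotv x v), x|move=> _ [y Ky <-]; exact: hx].
apply: ub_le_sup; last by exists x.
by exists (dotv x v) => _ [y Ky <-]; exact: hx.
Qed.

Lemma support_ge x v : K x -> dotv x v <= support_fun K v.
Proof.
have [y _ hy] := dotv_compact_max v.
move=> Kx; apply: ub_le_sup; last by exists x.
by exists (dotv y v) => _ [z Kz <-]; exact: hy.
Qed.

(** A supremum of continuous functions has open superlevel sets. *)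
Lemma measurable_support : measurable_fun setT (support_fun K : Rn -> R).
Proof.
apply: measurable_fun_gt => a; apply: measurable_open.
rewrite (_ : [set x | _] = \bigcup_(x in K) [set v : 'rV[R]_n | a < dotv x v]).
  apply: bigcup_open => x _; rewrite (_ : [set v | _] = [set v | a < dotv v x]).
    exact: open_dotv_gt.
  by apply/seteqP; split => v /=; rewrite dotvC.
apply/seteqP; split => v /=.
  by have [x Kx ->] := support_max v; exists x.
by move=> [x Kx /= h]; apply: lt_le_trans h (support_ge _ Kx).
Qed.

Lemma coord_le_enorm (u : 'rV[R]_n) i : `|u 0 i| <= enorm u.
Proof.
rewrite -(@ler_pXn2r _ 2)// ?nnegrE ?enorm_ge0// enorm_sqr real_normK ?num_real// /dotv (bigD1 i)//= expr2.
by rewrite lerDl; apply: sumr_ge0 => j _; rewrite -expr2 sqr_ge0.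
Qed.

Lemma support_bounds : exists rho C : R, [/\ 0 < rho, 0 < C &
  forall v, usphere R n v -> rho <= support_fun K v <= C].
Proof.
have [C C0 hC] := cbody_bounded.
case: bK => _ _ _ [r r0 hr].
exists (r / 2), (\sum_(i < n) C + 1); split; [lra| |].
  by rewrite ltr_wpDl// sumr_ge0// => i _; exact: ltW.
move=> v Sv.
have v1 i : `|v 0 i| <= 1 by rewrite -Sv coord_le_enorm.
apply/andP; split.
  have Kv : K (r / 2 *: v).
    apply: hr; apply: rV_norm_lt => // i; rewrite mxE normrM gtr0_norm; last lra.
    apply: (@le_lt_trans _ _ (r / 2)); last lra.
    by rewrite ler_piMr//; lra.
  by have := support_ge v Kv; rewrite dotvZl -enorm_sqr Sv expr1n mulr1.
have [x Kx ->] := support_max v.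
apply: (@le_trans _ _ (\sum_(i < n) C)); last by rewrite lerDl.
apply: ler_sum => i _; apply: le_trans (ler_norm _) _; rewrite normrM.
by rewrite -[C]mulr1; apply: ler_pM => //; exact/ltW/hC.
Qed.

Lemma radial_bounded : exists2 C : R, 0 < C & forall u, usphere R n u -> radial_fun K u <= C.
Proof.
have [r [C [r0 C0 h]]] := support_bounds; exists C => // u Su.
have := support_ge u (radial_mem (usphere_neq0 Su)).
rewrite dotvZl -enorm_sqr Su expr1n mulr1 => /le_trans; apply.
by have /andP[] := h _ Su.
Qed.

End one_body.
End symmetric_bodies.

(** * Existence and uniqueness of the outer normal at a regular boundary point *)

Section normals.
Context {R : realType} {n : nat}.
Local Notation Rn := (borelRV R n).

Lemma is_derive_line (f : 'rV[R]_n -> R) p e (s : R) : derivable f (p + s *: e) e ->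
  is_derive s 1 (fun s : R => f (p + s *: e)) ('D_e f (p + s *: e)).
Proof.
move=> df.
have E : (fun h : R => h^-1 *: (((fun s : R => f (p + s *: e)) \o shift s) (h *: 1) - f (p + s *: e))) =
    (fun h => h^-1 *: ((f \o shift (p + s *: e)) (h *: e) - f (p + s *: e))).
  apply/funext => h /=; congr (_ *: (f _ - _)).
  have -> : h *: (1 : R) = h by exact: mulr1.
  by rewrite scalerDl addrCA.
by split; [rewrite /derivable E|rewrite /derive E].
Qed.

(** Mean value theorem along a coordinate line; a negative increment is handled by exchanging the
    end points. *)
Lemma partial_increment (f : 'rV[R]_n -> R) x (delta : R) i (c e : R) p (b : R) : 0 < delta ->
  (forall y, ball x delta y -> derivable f y (delta_mx 0 i) /\ `|partial i f y - c| <= e) ->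
  ball x delta p -> ball x delta (p + b *: delta_mx 0 i) ->
  `|f (p + b *: delta_mx 0 i) - f p - b * c| <= e * `|b|.
Proof.
move=> d0 h; wlog b0 : p b / 0 <= b.
  move=> hw; have [|/ltW b0 bp bq] := leP 0 b; first exact: hw.
  have b0' : 0 <= - b by rewrite oppr_ge0.
  have := hw (p + b *: delta_mx 0 i) (- b) b0' bq.
  rewrite scaleNr addrK => /(_ bp).
  rewrite (_ : f p - _ - _ = - (f (p + b *: delta_mx 0 i) - f p - b * c)) ?normrN//; ring.
move=> bp bq.
have hb s : 0 <= s <= b -> ball x delta (p + s *: delta_mx 0 i).
  move=> /andP[s0 sb]; apply/rV_ballP => // j.
  move: bp bq => /(rV_ballP _ _ d0)/(_ j) + /(rV_ballP _ _ d0)/(_ j).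
  rewrite !mxE /=; case: (j == i); rewrite ?mulr1 ?mulr0 ?addr0// !ltr_norml; lra.
have hd s : 0 <= s <= b -> is_derive s 1 (fun s : R => f (p + s *: delta_mx 0 i)) (partial i f (p + s *: delta_mx 0 i)).
  by move=> /hb/h[df _]; exact: is_derive_line.
have [s||s sI] := @MVT_segment R (fun s => f (p + s *: delta_mx 0 i))
   (fun s => partial i f (p + s *: delta_mx 0 i)) 0 b b0.
- by rewrite in_itv/= => /andP[s0 sb]; apply: hd; rewrite !ltW.
- by apply: derivable_within_continuous => s; rewrite in_itv/= => /hd[].
rewrite scale0r addr0 subr0 => ->.
move: sI; rewrite in_itv/= => /hb/h[_ hs].
by rewrite [b * c]mulrC -mulrBl normrM ler_wpM2r.
Qed.

(** [C1_on] speaks of partial derivatives only, so the displacement [t *: z] is made one coordinate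
    at a time and the mean value errors are added up. *)
Lemma C1_descent U (f : 'rV[R]_n -> R) x z : open U -> C1_on U f -> U x ->
  dotv z (gradient f x) < 0 ->
  exists2 t0 : R, 0 < t0 & forall t, 0 < t < t0 -> U (x + t *: z) /\ f (x + t *: z) < f x.
Proof.
move=> oU cf Ux gz.
pose S := \sum_i `|z 0 i|.
have S0 : 0 <= S by rewrite sumr_ge0.
(* Chosen so that the total error [e * S] stays below the rate of descent. *)
pose e := - dotv z (gradient f x) / (S + 1).
have e0 : 0 < e by rewrite divr_gt0 ?oppr_gt0// ltr_wpDl.
have eS : dotv z (gradient f x) + e * S < 0.
  have : e * (S + 1) = - dotv z (gradient f x) by rewrite /e divfK// gt_eqF// ltr_wpDl.
  by rewrite mulrDr mulr1; lra.
have : \forall y \near x, U y /\ forall i, `|partial i f x - partial i f y| < e.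
  apply: filterI; first by apply: open_nbhs_nbhs.
  have h i : \forall y \near x, `|partial i f x - partial i f y| < e.
    by have [_ ci] := cf i x Ux; move/cvgrPdist_lt : ci => /(_ e e0).
  exact: (@filter_forall _ _ _ (nbhs x) (nbhs_filter x) h).
move=> /nbhs_ballP[delta /= d0 hd].
exists (delta / (`|z| + 1)) => [|t /andP[t0 tz]]; first by rewrite divr_gt0// ltr_wpDl.
have tzd i : t * `|z 0 i| < delta.
  have z1 : 0 < `|z| + 1 by rewrite ltr_wpDl.
  move: tz; rewrite ltr_pdivlMr//; apply: le_lt_trans.
  by rewrite ler_pM2l// (le_trans (rV_normP _ _))// lerDl.
(* The [k]-th corner of the path: the first [k] coordinates have moved. *)
pose P k : 'rV[R]_n := \row_i (x 0 i + (if (i < k)%N then t * z 0 i else 0)).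
have Pb k : ball x delta (P k).
  apply/rV_ballP => // i; rewrite mxE opprD addNKr normrN.
  by case: ifP => _; rewrite ?normr0// normrM gtr0_norm.
have P0 : P 0%N = x by apply/rowP => i; rewrite mxE addr0.
have Pn : P n = x + t *: z by apply/rowP => i; rewrite !mxE ltn_ord.
have PS (k : 'I_n) : P k.+1 = P k + (t * z 0 k) *: delta_mx 0 k.
  apply/rowP => i; rewrite !mxE /= -addrA; congr (_ + _).
  by have [ik|ik|/val_inj ->] := ltngtP i k; rewrite ?eqxx ?ltnS ?leqnn ?ltnn ?(ltnW ik) ?add0r ?mulr1 //;
     [rewrite (_ : (i == k) = false) ?mulr0 ?addr0//; apply/eqP => ikE; rewrite ikE ltnn in ik
     |rewrite leqNgt ik/= (_ : (i == k) = false) ?mulr0//; apply/eqP => ikE; rewrite ikE ltnn in ik].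
split; first by rewrite -Pn; exact: (hd _ (Pb n)).1.
rewrite -subr_lt0 -Pn -P0.
have -> : f (P n) - f (P 0%N) = \sum_(k < n) (f (P k.+1) - f (P k)).
  by rewrite -(big_mkord xpredT (fun k => f (P k.+1) - f (P k))) telescope_sumr.
apply: (@le_lt_trans _ _ (\sum_(k < n) (t * (z 0 k * gradient f x 0 k + e * `|z 0 k|)))); last first.
  rewrite -mulr_sumr big_split/= -mulr_sumr -/S pmulr_rlt0//.
apply: ler_sum => k _.
have := @partial_increment f x delta k (partial k f x) e (P k) (t * z 0 k) d0 _ (Pb k).
rewrite -PS => /(_ _ (Pb _)); rewrite normrM gtr0_norm// mxE => h.
have {h} : `|f (P k.+1) - f (P k) - t * z 0 k * partial k f x| <= e * (t * `|z 0 k|).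
  apply: h => y /hd[Uy hy]; split; first by have [] := cf k y Uy.
  by rewrite distrC ltW.
by rewrite ler_norml => /andP[_]; rewrite lerBlDl mulrDr; congr (_ <= _); ring.
Qed.

Lemma unit_eq (u v : 'rV[R]_n) : usphere R n u -> usphere R n v -> u != v -> dotv u v < 1.
Proof.
move=> Su Sv uv.
have : 0 < dotv (u - v) (u - v) by rewrite lt_neqAle dotvv_ge0 eq_sym dotvv_eq0 subr_eq0 uv.
rewrite dotvDl !dotvDr !dotvNl !dotvNr -!enorm_sqr Su Sv (dotvC v u); lra.
Qed.

(** A factor close to 1 works whatever the sign of [b]: the loss [q * b] is less than half of
    [b - a]. It serves to move a point into the interior without crossing a hyperplane. *)
Lemma strict_shrink (a b : R) : a < b -> exists2 e : R, 0 < e < 1 & a < e * b.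
Proof.
move=> ab; pose q := (b - a) / (2 * (`|b| + (b - a))).
have b0 := normr_ge0 b; have d0 : 0 < `|b| + (b - a) by lra.
have q0 : 0 < q by rewrite divr_gt0//; lra.
have qe : q * (`|b| + (b - a)) = (b - a) / 2 by rewrite /q; field; rewrite gt_eqF.
exists (1 - q).
  have : q * (b - a) <= (b - a) / 2 by rewrite -qe ler_pM2l//; lra.
  rewrite [leRHS]mulrC ler_pM2r ?subr_gt0//; lra.
have : q * b <= q * `|b| by rewrite ler_pM2l// ler_norm.
have : 0 < q * (b - a) by rewrite mulr_gt0// subr_gt0.
move: qe; lra.
Qed.

(** A point [y] of [K] beyond the tangent hyperplane would make [x] interior: [x] lies between a
    ball about a shrunk [y] and a point of [K] reached by descent away from it. Another normal [v]
    fails because [v - m] is a descent direction for [f] along which the product with [v]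
    increases. *)
Lemma outer_normal_exists_unique (K : set 'rV[R]_n) x : cbody K -> C2_plus K -> boundary K x ->
  exists2 m, outer_unit_normal K x m & forall v, outer_unit_normal K x v -> v = m.
Proof.
move=> bK rK bx; have [U [f [[oU Ux] [cf gf fK] _]]] := rK x bx.
have Kx := boundary_mem bK bx.
pose g := gradient f x; have g0 : g != 0 by exact: gf.
have gn : 0 < enorm g by rewrite lt_neqAle eq_sym enorm_eq0 g0 enorm_ge0.
have desc z : dotv z g < 0 -> exists2 t : R, 0 < t & K (x + t *: z).
  move=> zg; have [t0 t00 h] := C1_descent oU cf.1 Ux zg; exists (t0 / 2); first lra.
  have [|Ut ft] := h (t0 / 2); first lra.
  by apply/fK => //; apply: le_trans (ltW ft) _; exact/fK.
have Sm : usphere R n ((enorm g)^-1 *: g) by exact: (dirv_sphere g0).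
exists ((enorm g)^-1 *: g).
  split => // y Ky; rewrite leNgt; apply/negP; rewrite !dotvZr ltr_pM2l ?invr_gt0// => xy.
  have [e e01 he] := strict_shrink xy; have /andP[e0 e1] := e01.
  have [t t0 Kt] : exists2 t : R, 0 < t & K (x + t *: (x - e *: y)).
    by apply: desc; rewrite dotvDl dotvNl dotvZl; lra.
  have [r r0 hr] : exists2 r : R, 0 < r & forall d : 'rV[R]_n, `|d| < r -> K (e *: y + d).
    by apply: (cbody_fat bK) => //; rewrite ltW.
  case: bx => _; apply.
  have t1 : 0 < 1 + t by lra.
  (* Every [w] this close to [x] is a convex combination, with weight [1 / (1 + t)] on the first, of
     [x + t *: (x - e *: y)] and a point of the ball about [e *: y]. *)
  apply/nbhs_ballP; exists (r * t / (1 + t)) => /=; first by rewrite divr_gt0// mulr_gt0.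
  move=> w; rewrite -ball_normE /= => hw.
  have Kd : K (e *: y + ((1 + t) / t) *: (w - x)).
    apply: hr; rewrite normrZ gtr0_norm ?divr_gt0// distrC.
    rewrite -ltr_pdivlMl ?divr_gt0// (_ : _^-1 * r = r * t / (1 + t))//; field.
    by rewrite !gt_eqF.
  case: bK => _ cv _ _.
  have := cv _ _ ((1 + t)^-1) Kt Kd _.
  rewrite (_ : (1 + t)^-1 *: _ + _ = w) => [|]; last first.
    by apply/rowP => i; rewrite !mxE; field; rewrite !gt_eqF.
  by apply; rewrite invr_ge0 ltW//= invf_le1//; lra.
move=> v [Sv _ hv]; apply/eqP/negPn/negP => vm.
have vm1 := unit_eq Sv Sm vm.
have mm : dotv ((enorm g)^-1 *: g) ((enorm g)^-1 *: g) = 1 by rewrite -enorm_sqr Sm expr1n.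
have vv : dotv v v = 1 by rewrite -enorm_sqr Sv expr1n.
pose m := (enorm g)^-1 *: g.
have [|t t0 /hv] := desc (v - m).
  suff : dotv (v - m) m < 0 by rewrite {2}/m dotvZr pmulr_rlt0// invr_gt0.
  by rewrite dotvDl dotvNl mm; lra.
rewrite dotvDl dotvZl gerDl pmulr_rle0// dotvDl dotvNl vv (dotvC m) -/m; lra.
Qed.

End normals.

(** * Integration against transported densities *)

Section density.
Context {R : realType}.

Lemma density_nnsfun d d' (T : measurableType d) (X : measurableType d') (m : {measure set T -> \bar R})
    (phi : T -> X) (g : T -> R) (G : {nnsfun X >-> R}) :
  measurable_fun setT phi -> measurable_fun setT g -> (forall x, 0 <= g x) ->
  (\int[m]_x (G (phi x) * g x)%:E =
   \sum_(y \in range G) y%:E * \int[m]_(x in phi @^-1` (G @^-1` [set y])) (g x)%:E)%E.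
Proof.
move=> mphi mg g0; have fR := @fimfunP _ _ G.
have mpre y : measurable (phi @^-1` (G @^-1` [set y])).
  by rewrite -[X in measurable X]setTI; apply: mphi => //; exact: measurable_sfunP.
have mi y : measurable_fun setT (fun x => (\1_(phi @^-1` (G @^-1` [set y])) x * (y * g x))%:E).
  apply/measurable_EFinP; apply: measurable_funM; first exact: measurable_indic.
  by apply: measurable_funM.
transitivity (\sum_(y \in range G) \int[m]_x (\1_(phi @^-1` (G @^-1` [set y])) x * (y * g x))%:E)%E.
  rewrite -ge0_integral_fsum//; last first.
    move=> y x _; have [y0|y0] := leP 0 y; first by rewrite lee_fin mulr_ge0// mulr_ge0.
    by rewrite preimage_nnfun0// preimage_set0 indic0 mul0r.
  apply: eq_integral => x _.
  rewrite (fimfun_comp G (fun a : R => (a * g x)%:E)).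
  by apply: eq_fsbigr => y _; rewrite -EFinM.
apply: eq_fsbigr => y /set_mem [u _ ruy].
rewrite [in RHS]integral_mkcond epatch_indic -ge0_integralZl//; last 3 first.
- apply: emeasurable_funM; first exact/measurable_EFinP.
  by apply/measurable_EFinP; exact: measurable_indic.
- by move=> x _; rewrite mule_ge0// lee_fin.
- by rewrite lee_fin -ruy.
by apply: eq_integral => x _; rewrite /= -!EFinM; congr EFin; ring.
Qed.

Lemma density_lim d d' (T : measurableType d) (X : measurableType d') (m : {measure set T -> \bar R})
    (phi : T -> X) (g : T -> R) (G : X -> R) (f : {nnsfun X >-> R}^nat) :
  measurable_fun setT phi -> measurable_fun setT g -> (forall x, 0 <= g x) ->
  (forall x, {homo (fun k => f k x) : i j / (i <= j)%N >-> i <= j}) ->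
  (forall x, f k x @[k --> \oo] --> G x) ->
  (\int[m]_x (f k (phi x) * g x)%:E @[k --> \oo] --> \int[m]_x (G (phi x) * g x)%:E)%E.
Proof.
move=> mphi mg g0 fnd fcv.
have pc x : ((f k (phi x) * g x)%:E @[k --> \oo] --> (G (phi x) * g x)%:E)%E.
  have h : (fun k => f k (phi x) * g x) @ \oo --> G (phi x) * g x.
    by apply: cvgMl; exact: fcv.
  by apply: cvg_EFin; [exact: nearW|exact: h].
rewrite (_ : \int[m]_x (G (phi x) * g x)%:E = \int[m]_x limn (fun k => (f k (phi x) * g x)%:E))%E; last first.
  by apply: eq_integral => x _; rewrite (cvg_lim _ (pc x)).
apply: cvg_monotone_convergence => //.
- move=> k; apply/measurable_EFinP; apply: measurable_funM => //.
  by apply: (measurable_compT (f := f k)) => //; exact: measurable_funP.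
- by move=> k x _; rewrite lee_fin mulr_ge0.
- by move=> x _ i j ij; rewrite lee_fin ler_wpM2r//; exact: fnd.
Qed.

(** Equality on sets extends to simple functions and then to monotone limits. Allowing a map and a
    density on each side lets it serve both for [dual_curvature] itself and for the comparison of
    two bodies. *)
Lemma density_transfer d1 d2 d' (T1 : measurableType d1) (T2 : measurableType d2) (X : measurableType d')
    (m1 : {measure set T1 -> \bar R}) (m2 : {measure set T2 -> \bar R})
    (phi1 : T1 -> X) (phi2 : T2 -> X) (g1 : T1 -> R) (g2 : T2 -> R) :
  measurable_fun setT phi1 -> measurable_fun setT phi2 ->
  measurable_fun setT g1 -> measurable_fun setT g2 ->
  (forall x, 0 <= g1 x) -> (forall x, 0 <= g2 x) ->
  (forall eta, measurable eta -> \int[m1]_(x in phi1 @^-1` eta) (g1 x)%:E = \int[m2]_(x in phi2 @^-1` eta) (g2 x)%:E)%E ->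
  forall G : X -> R, measurable_fun setT G -> (forall y, 0 <= G y) ->
  (\int[m1]_x (G (phi1 x) * g1 x)%:E = \int[m2]_x (G (phi2 x) * g2 x)%:E)%E.
Proof.
move=> mp1 mp2 mg1 mg2 g10 g20 h G mG G0.
have [f [fnd fcv]] := nnsfun_approx_real mG G0.
have c1 := density_lim (m := m1) mp1 mg1 g10 fnd fcv.
have c2 := density_lim (m := m2) mp2 mg2 g20 fnd fcv.
rewrite -(cvg_lim (@ereal_hausdorff R) c1) -(cvg_lim (@ereal_hausdorff R) c2).
apply: (congr1 (fun u : (\bar R)^nat => limn u)); apply/funext => k; rewrite !density_nnsfun//.
by apply: eq_fsbigr => y _; rewrite h//; exact: measurable_sfunP.
Qed.

End density.

Section gauss.
Context {R : realType} {n : nat}.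
Local Notation Rn := (borelRV R n).
Variable K : set 'rV[R]_n.
Hypotheses (bK : cbody K) (rK : C2_plus K).

(* The value 0 off the sphere is arbitrary: all integrands below vanish there. *)
Definition gaussmap (u : Rn) : Rn :=
  if `[< usphere R n u >] then xget 0 [set v | outer_unit_normal K (radial_fun K u *: u) v] else 0.

Lemma gaussmapP u : usphere R n u -> outer_unit_normal K (radial_fun K u *: u) (gaussmap u).
Proof.
move=> Su; rewrite /gaussmap asboolT//; case: xgetP => [y _ //|h].
have [m hm _] := outer_normal_exists_unique bK rK (radial_boundary bK Su).
by have := h m hm.
Qed.

Lemma gaussmap_unique u v : usphere R n u -> outer_unit_normal K (radial_fun K u *: u) v -> v = gaussmap u.
Proof.
move=> Su hv; have [m _ hm] := outer_normal_exists_unique bK rK (radial_boundary bK Su).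
by rewrite (hm _ hv) (hm _ (gaussmapP Su)).
Qed.

Lemma gaussmap_sphere u : usphere R n u -> usphere R n (gaussmap u).
Proof. by move=> /gaussmapP[]. Qed.

Lemma support_gaussmap u : usphere R n u ->
  support_fun K (gaussmap u) = radial_fun K u * dotv u (gaussmap u).
Proof.
move=> Su; have [_ _ hv] := gaussmapP Su; rewrite -dotvZl.
apply/eqP; rewrite eq_le (support_ge bK _ (radial_mem bK (usphere_neq0 Su))) andbT.
by have [x Kx ->] := support_max bK (gaussmap u); exact: hv.
Qed.

Lemma closed_usphere : closed (usphere R n).
Proof.
rewrite (_ : usphere R n = (fun x : 'rV[R]_n => enorm x) @^-1` [set 1])//.
apply: preimage_closed; first by move=> x _; exact: continuous_enorm.
exact: closed_eq.
Qed.

Lemma compact_usphere : compact (usphere R n).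
Proof.
apply: bounded_closed_compact; last exact: closed_usphere.
exists 1; split; first exact: num_real.
move=> M M1 x Sx; apply: (le_trans _ (ltW M1)); rewrite -[leRHS]Sx.
rewrite [`|x|]/Num.norm/= mx_normrE; apply: bigmax_le; first exact: enorm_ge0.
by move=> [i j] _ /=; rewrite ord1; exact: coord_le_enorm.
Qed.

(** The pairs of a point of [K] and a unit normal in [C] at that point form a compact set, and this
    is its projection. *)
Lemma closed_normal_contact (C : set 'rV[R]_n) : closed C ->
  closed [set x | exists2 v, C v /\ usphere R n v & K x /\ forall y, K y -> dotv y v <= dotv x v].
Proof.
move=> cC; have cK := let: And4 c _ _ _ := bK in c.
pose Z := \bigcap_(y in K) [set p : 'rV[R]_n * 'rV[R]_n | dotv y p.2 <= dotv p.1 p.2].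
have cZ : closed Z.
  apply: closed_bigI => y _.
  rewrite (_ : [set p | _] = (fun p : 'rV[R]_n * 'rV[R]_n => dotv p.1 p.2 - dotv y p.2) @^-1` [set t | 0 <= t]); last first.
    by apply/seteqP; split => p /=; rewrite subr_ge0.
  apply: preimage_closed; last exact: closed_ge.
  move=> p _; apply: cvgB.
    by apply: (continuous_dotv (f := fst) (g := snd)) => q; [exact: cvg_fst|exact: cvg_snd].
  by apply: (continuous_dotv (f := fun=> y) (g := snd)) => q; [exact: cvg_cst|exact: cvg_snd].
have cCS : compact (C `&` usphere R n).
  by apply: subclosed_compact (compact_usphere) _; [apply: closedI => //; exact: closed_usphere|exact: subIsetr].
have cP : compact (Z `&` (K `*` (C `&` usphere R n))).
  have cc := compact_setX cK cCS.
  apply: subclosed_compact (cc) _; last exact: subIsetr.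
  apply: closedI => //; apply: compact_closed cc.
  exact: norm_hausdorff.
have cI : compact (fst @` (Z `&` (K `*` (C `&` usphere R n)))).
  apply: continuous_compact cP; apply: continuous_subspaceT => p; exact: cvg_fst.
rewrite (_ : [set x | _] = fst @` (Z `&` (K `*` (C `&` usphere R n)))).
  by apply: compact_closed cI; exact: norm_hausdorff.
apply/seteqP; split => [x [v Cv [Kx hx]]|_ [[x v] [Zp [/= Kx Cv]] <-]].
  by exists (x, v).
by exists v => //; split => // y Ky; exact: (Zp y Ky).
Qed.

Lemma measurable_usphere : measurable (usphere R n : set Rn).
Proof. by apply: measurable_closed; exact: closed_usphere. Qed.

(** Since normals are unique, on the sphere the Gauss map lands in a closed [C] exactly when the
    boundary point has some normal in [C], and that is a closed condition on the boundary point. *)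
Lemma measurable_gaussmap : measurable_fun setT gaussmap.
Proof.
suff mC (C : set 'rV[R]_n) : closed C -> measurable (gaussmap @^-1` C).
  apply: (@measurability _ _ Rn Rn setT gaussmap (@open 'rV[R]_n)) => //.
  move=> _ [U oU <-]; rewrite setTI.
  rewrite (_ : gaussmap @^-1` U = ~` (gaussmap @^-1` (~` U))); last by rewrite preimage_setC setCK.
  apply: measurableC; apply: (mC (~` U)); exact: open_closedC.
move=> cC.
pose P := [set x | exists2 v, C v /\ usphere R n v & K x /\ forall y, K y -> dotv y v <= dotv x v].
have mS := measurable_usphere.
rewrite (_ : gaussmap @^-1` C = (usphere R n `&` [set u : Rn | P (radial_fun K u *: u)]) `|`
    (~` usphere R n `&` [set _ : Rn | C 0])).
  apply: measurableU; apply: measurableI => //.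
  - have ms : measurable_fun setT (fun u : Rn => radial_fun K u *: u : Rn).
      by apply: measurable_scaleV; [exact: measurable_radial_fun|exact: measurable_id].
    rewrite -[X in measurable X]setTI; apply: ms => //.
    by apply: measurable_closed; exact: closed_normal_contact.
  - exact: measurableC.
  - have [c0|c0] := pselect (C 0); [rewrite (_ : [set _ | _] = setT)//|rewrite (_ : [set _ | _] = set0)//].
      by apply/seteqP; split.
    by apply/seteqP; split.
apply/seteqP; split => [u /= Cu|u [[Su [v [Cv Sv] [Ku hv]]]|[nSu C0]]] /=.
- have [Su|nSu] := pselect (usphere R n u).
    left; split => //; have [Sv bv hv] := gaussmapP Su.
    exists (gaussmap u) => //; split => //; exact: (boundary_mem bK bv).
  by right; split => //; move: Cu; rewrite /gaussmap asboolF.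
- rewrite -(@gaussmap_unique u v)//; split => //; exact: radial_boundary.
- by rewrite /gaussmap asboolF.
Qed.

End gauss.

(** * Dual curvature measures *)

Section dual_curvature_density.
Context {R : realType}.

(** Supplies the countable additivity that the bare set function [dual_curvature] does not carry. *)
Lemma density_measure d d' (T : measurableType d) (X : measurableType d') (m : {measure set T -> \bar R})
    (phi : T -> X) (g : T -> R) :
  measurable_fun setT phi -> measurable_fun setT g -> (forall x, 0 <= g x) ->
  exists nu : {measure set X -> \bar R},
    (nu : set X -> \bar R) = (fun eta => \int[m]_(x in phi @^-1` eta) (g x)%:E)%E.
Proof.
move=> mphi mg g0.
pose mu (eta : set X) : \bar R := (\int[m]_(x in phi @^-1` eta) (g x)%:E)%E.
have mu0 : mu set0 = 0%E by rewrite /mu preimage_set0 integral_set0.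
have mu_ge0 A : (0 <= mu A)%E by apply: integral_ge0 => x _; rewrite lee_fin.
have mu_add : semi_sigma_additive mu.
  move=> F mF tF mUF.
  have -> : mu (\bigcup_k F k) = (\sum_(i <oo) mu (F i))%E.
    rewrite /mu preimage_bigcup ge0_integral_bigcup//.
    - by move=> k; rewrite -[X in measurable X]setTI; exact: mphi.
    - by apply/measurable_EFinP; exact: measurable_funTS.
    - by move=> x _; rewrite lee_fin.
    - apply/trivIsetP => i j _ _ ij; rewrite -preimage_setI.
      by move/trivIsetP : tF => /(_ _ _ _ _ ij) ->//; rewrite preimage_set0.
  by apply: is_cvg_ereal_nneg_natsum => k _.
pose M := isMeasure.Build d' X R mu mu0 mu_ge0 mu_add.
pose nu : {measure set X -> \bar R} := HB.pack mu M.
by exists nu.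
Qed.

Context {n : nat}.

(** The spherical measure lives on the Borel sets of the whole space, so functions on the sphere are
    extended by 0. This keeps them bounded, whereas [radial_fun] of a body blows up at the
    origin. *)
Definition radial0 (K : set 'rV[R]_n) (u : borelRV R n) : R := radial_fun K u * \1_(usphere R n) u.

(** [n] times the density of the dual curvature measure of order [n + 2], before its transport by
    the Gauss map. *)
Definition gweight (K : set 'rV[R]_n) (u : borelRV R n) : R := radial0 K u ^+ (n + 2).

Section one_body.
Variable K : set 'rV[R]_n.
Hypotheses (n0 : (0 < n)%N) (bK : cbody K) (rK : C2_plus K).

Lemma radial0E u : usphere R n u -> radial0 K u = radial_fun K u.
Proof. by move=> Su; rewrite /radial0 indicE mem_set// mulr1. Qed.

Lemma radial0_off u : ~ usphere R n u -> radial0 K u = 0.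
Proof. by move=> Su; rewrite /radial0 indicE memNset// mulr0. Qed.

Lemma radial0_ge0 u : 0 <= radial0 K u.
Proof.
have [Su|Su] := pselect (usphere R n u); last by rewrite radial0_off.
by rewrite radial0E// ltW// radial_gt0//; exact: usphere_neq0.
Qed.

Lemma measurable_radial0 : measurable_fun setT (radial0 K).
Proof.
apply: measurable_funM; first exact: measurable_radial_fun.
by apply: measurable_indic; exact: measurable_usphere.
Qed.

Lemma gweight_ge0 u : 0 <= gweight K u. Proof. by rewrite exprn_ge0// radial0_ge0. Qed.

Lemma gweight_off u : ~ usphere R n u -> gweight K u = 0.
Proof. by move=> Su; rewrite /gweight radial0_off// addn2 expr0n. Qed.

Lemma measurable_gweight : measurable_fun setT (gweight K).
Proof. by apply: measurable_funX; exact: measurable_radial0. Qed.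

Lemma support_ge0 v : 0 <= support_fun K v.
Proof. by have := support_ge bK v (cbody0 bK); rewrite -(scale0r v) dotvZl mul0r. Qed.

Lemma measurable_invr_fun (f : borelRV R n -> R) : measurable_fun setT f -> (forall u, 0 <= f u) ->
  measurable_fun setT (fun u => (f u)^-1).
Proof.
move=> mf f0; apply: (eq_measurable_funT (g := fun u => f u `^ (-1))); first by move=> u; rewrite powR_inv1.
by apply: (measurable_compT (f := fun x : R => x `^ (-1)) (g := f)) => //; exact: measurable_powR.
Qed.

(** By uniqueness of normals, having some normal in [eta] means that the Gauss map lands in
    [eta]. *)
Lemma dual_curvatureE eta :
  dual_curvature (n + 2)%:R K eta =
  (n%:R^-1%:E * \int[sphm]_(u in gaussmap K @^-1` eta) (gweight K u)%:E)%E.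
Proof.
rewrite /dual_curvature -sphmE; congr (_ * _)%E.
rewrite integral_mkcond [RHS]integral_mkcond; apply: eq_integral => u _.
rewrite !patchE; have [Su|Su] := pselect (usphere R n u); last first.
  by rewrite memNset ?gweight_off//; [case: ifP|move=> []].
have rE : radial_fun K u `^ (n + 2)%:R = gweight K u.
  by rewrite powR_mulrn ?ltW ?radial_gt0//; [rewrite /gweight radial0E|exact: usphere_neq0].
have [eu|eu] := pselect (eta (gaussmap K u)).
  rewrite mem_set; last by split => //; exists (gaussmap K u) => //; exact: gaussmapP.
  by rewrite mem_set// rE.
rewrite memNset; last by move=> [_ [v ev /gaussmap_unique hv]]; apply: eu; rewrite -hv.
by rewrite memNset.
Qed.

Lemma dual_curvature_measure : exists m : {measure set (borelRV R n) -> \bar R},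
  (m : set _ -> \bar R) = dual_curvature (n + 2)%:R K.
Proof.
have [nu hnu] := @density_measure _ _ _ _ sphm _ _ (measurable_gaussmap bK rK) measurable_gweight gweight_ge0.
have n1 : 0 <= n%:R^-1 :> R by rewrite invr_ge0 ler0n.
pose m : {measure set (borelRV R n) -> \bar R} := mscale (NngNum n1) nu.
exists m; apply/funext => eta; rewrite dual_curvatureE /m /mscale /=; congr (_ * _)%E.
by have := congr1 (fun f => f eta) hnu.
Qed.

Lemma dual_curvature_integral (G : borelRV R n -> R) : measurable_fun setT G -> (forall u, 0 <= G u) ->
  (\int[dual_curvature (n + 2)%:R K]_v (G v)%:E =
   \int[sphm]_u (G (gaussmap K u) * (n%:R^-1 * gweight K u))%:E)%E.
Proof.
move=> mG G0; have mg := measurable_gaussmap bK rK; have mw := measurable_gweight.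
have n1 : 0 <= n%:R^-1 :> R by rewrite invr_ge0 ler0n.
have [m hm] := dual_curvature_measure; rewrite -hm.
rewrite -(@density_transfer R _ _ _ _ _ (borelRV R n) m sphm id (gaussmap K) (fun=> 1) (fun u => n%:R^-1 * gweight K u))//.
- by apply: eq_integral => u _; rewrite mulr1.
- by apply: measurable_funM.
- by move=> x; rewrite mulr_ge0// gweight_ge0.
- move=> eta meta; rewrite preimage_id integral_cst// mul1e.
  rewrite [LHS](_ : _ = dual_curvature (n + 2)%:R K eta); last by rewrite -hm.
  rewrite dual_curvatureE -ge0_integralZl//.
  + by rewrite -[X in measurable X]setTI; exact: mg.
  + by apply/measurable_EFinP; exact: measurable_funTS.
  + by move=> u _; rewrite lee_fin gweight_ge0.
Qed.

Lemma dual_curvature1E eta : measurable eta ->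
  dual_curvature1 (n + 2)%:R K eta =
  (\int[sphm]_u (\1_eta (gaussmap K u) * (support_fun K (gaussmap K u))^-1 * (n%:R^-1 * gweight K u))%:E)%E.
Proof.
move=> meta; rewrite /dual_curvature1.
pose G v := \1_eta v * (support_fun K v)^-1.
transitivity (\int[dual_curvature (n + 2)%:R K]_v (G v)%:E)%E; last first.
  apply: dual_curvature_integral => [|v]; last by rewrite mulr_ge0// invr_ge0 support_ge0.
  apply: measurable_funM; first exact: measurable_indic.
  by apply: measurable_invr_fun => [|v]; [exact: measurable_support|exact: support_ge0].
have [m hm] := dual_curvature_measure; rewrite -hm integral_mkcond.
apply: eq_integral => v _; rewrite patchE /G indicE.
by case: ifP => _; rewrite ?mul1r ?mul0r.
Qed.

End one_body.

(** Arbitrary Borel sets reduce to subsets of the sphere, because the Gauss map preserves the sphere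
    and [gweight] vanishes off it. *)
Lemma dual_curvature1_transfer (K L : set 'rV[R]_n) (G : borelRV R n -> R) : (0 < n)%N ->
  cbody K -> C2_plus K -> cbody L -> C2_plus L ->
  (forall eta : set (borelRV R n), measurable eta -> eta `<=` usphere R n ->
     dual_curvature1 (n + 2)%:R K eta = dual_curvature1 (n + 2)%:R L eta) ->
  measurable_fun setT G -> (forall v, 0 <= G v) ->
  (\int[sphm]_u (G (gaussmap K u) / support_fun K (gaussmap K u) * gweight K u)%:E =
   \int[sphm]_u (G (gaussmap L u) / support_fun L (gaussmap L u) * gweight L u)%:E)%E.
Proof.
move=> n0 bK rK bL rL h mG G0.
pose g K u := (support_fun K (gaussmap K u))^-1 * (n%:R^-1 * gweight K u).
have mg K' : cbody K' -> C2_plus K' -> measurable_fun setT (g K').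
  move=> bK' rK'; apply: measurable_funM; last by apply: measurable_funM => //; exact: measurable_gweight.
  apply: (measurable_compT (f := fun v : borelRV R n => (support_fun K' v)^-1)); last exact: measurable_gaussmap.
  by apply: measurable_invr_fun => [|v]; [exact: measurable_support|exact: support_ge0].
have g0 K' : cbody K' -> forall u, 0 <= g K' u.
  by move=> bK' u; rewrite !mulr_ge0// ?invr_ge0 ?support_ge0 ?gweight_ge0.
have gE K' eta : cbody K' -> C2_plus K' -> measurable eta ->
  (\int[sphm]_(u in gaussmap K' @^-1` eta) (g K' u)%:E = dual_curvature1 (n + 2)%:R K' (eta `&` usphere R n))%E.
  move=> bK' rK' meta; rewrite dual_curvature1E//; last by apply: measurableI => //; exact: measurable_usphere.
  rewrite integral_mkcond epatch_indic; apply: eq_integral => u _.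
  rewrite -EFinM -mulrA -/(g K' u) mulrC; have [Su|Su] := pselect (usphere R n u).
    congr (EFin (_ * _)); apply: indic_iff => /=; split => [eu|[]//].
    by split => //; exact: gaussmap_sphere.
  by rewrite /g gweight_off// !mulr0.
have gw K' : cbody K' -> C2_plus K' ->
  (\int[sphm]_u (G (gaussmap K' u) / support_fun K' (gaussmap K' u) * gweight K' u)%:E =
   \int[sphm]_u (n%:R * G (gaussmap K' u) * g K' u)%:E)%E.
  move=> bK' rK'; apply: eq_integral => u _; congr EFin; rewrite /g.
  rewrite [RHS](_ : _ = (n%:R / n%:R) * (G (gaussmap K' u) / support_fun K' (gaussmap K' u) * gweight K' u)); last ring.
  by rewrite divff ?mul1r// pnatr_eq0 -lt0n.
rewrite !gw//.
apply: (@density_transfer R _ _ _ _ _ (borelRV R n) sphm sphm (gaussmap K) (gaussmap L) (g K) (g L) _ _ _ _ _ _ _ (fun v => n%:R * G v)).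
- exact: measurable_gaussmap.
- exact: measurable_gaussmap.
- exact: mg.
- exact: mg.
- exact: g0.
- exact: g0.
- move=> eta meta; apply: etrans (gE K eta bK rK meta) _; apply: esym; apply: etrans (gE L eta bL rL meta) _.
  apply: esym; apply: h; last exact: subIsetr.
  by apply: measurableI => //; exact: measurable_usphere.
- exact: measurable_funM.
- by move=> v; rewrite mulr_ge0.
Qed.

End dual_curvature_density.

(** * Integrals over the sphere, Minkowski averages and dilates *)

Section sphere_integral.
Context {R : realType} {n : nat}.
Local Notation Rn := (borelRV R n).
Hypothesis n0 : (0 < n)%N.
Implicit Types (U V : set Rn) (f g r : Rn -> R).

(** The spherical measure is finite, so these functions are integrable, and they are stable under
    sums and products. *)
Definition bmeas f := measurable_fun setT f /\ exists C, forall u, `|f u| <= C.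

Definition sint f : R := \int[sphm]_u f u.

Lemma sphm_finite : (@sphm R n setT < +oo)%E.
Proof. by rewrite sphm_cone// lte_mul_pinfty ?lee_fin// cone_finite. Qed.

Lemma bmeas_integrable f : bmeas f -> (@sphm R n).-integrable setT (EFin \o f).
Proof.
move=> [mf [C hC]]; apply: measurable_bounded_integrable => //; first exact: sphm_finite.
by exists C; split; [exact: num_real|move=> M CM u _; exact: le_trans (hC u) (ltW CM)].
Qed.

Lemma bmeas_cst (k : R) : bmeas (fun=> k).
Proof. by split => //; exists `|k|. Qed.

Lemma bmeasM f g : bmeas f -> bmeas g -> bmeas (fun u => f u * g u).
Proof.
move=> [mf [C hC]] [mg [D hD]]; split; first exact: measurable_funM.
by exists (C * D) => u; rewrite normrM ler_pM.
Qed.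

Lemma bmeasD f g : bmeas f -> bmeas g -> bmeas (fun u => f u + g u).
Proof.
move=> [mf [C hC]] [mg [D hD]]; split; first exact: measurable_funD.
by exists (C + D) => u; rewrite (le_trans (ler_normD _ _))// lerD.
Qed.

Lemma bmeasX f k : bmeas f -> bmeas (fun u => f u ^+ k).
Proof.
move=> bf; elim: k => [|k IH]; first by under eq_fun do rewrite expr0; exact: bmeas_cst.
by under eq_fun do rewrite exprS; exact: bmeasM.
Qed.

Lemma sintD f g : bmeas f -> bmeas g -> sint (fun u => f u + g u) = sint f + sint g.
Proof. by move=> bf bg; rewrite /sint RintegralD//; exact: bmeas_integrable. Qed.

Lemma sintB f g : bmeas f -> bmeas g -> sint (fun u => f u - g u) = sint f - sint g.
Proof. by move=> bf bg; rewrite /sint RintegralB//; exact: bmeas_integrable. Qed.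

Lemma sintZ k f : bmeas f -> sint (fun u => k * f u) = k * sint f.
Proof. by move=> bf; rewrite /sint RintegralZl//; exact: bmeas_integrable. Qed.

Lemma le_sint f g : bmeas f -> bmeas g -> (forall u, f u <= g u) -> sint f <= sint g.
Proof. by move=> bf bg fg; apply: le_Rintegral => //; exact: bmeas_integrable. Qed.

Lemma sint_ge0 f : (forall u, 0 <= f u) -> 0 <= sint f.
Proof. by move=> f0; apply: Rintegral_ge0 => // u _. Qed.

Lemma sintE f : bmeas f -> ((sint f)%:E = \int[sphm]_u (f u)%:E)%E.
Proof.
move=> bf; rewrite /sint /Rintegral fineK//.
by apply: integrable_fin_num => //; exact: bmeas_integrable.
Qed.

Lemma inertiaE U : measurable U -> boundedV U ->
  ((inertia U)%:E = \int[lebV n]_x (\1_U x * enorm x ^+ 2)%:E)%E.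
Proof.
move=> mU [C C0 hC].
have iU : (lebV n).-integrable U (EFin \o (fun x : Rn => dotv x x)).
  apply: (@integrable_bounded_poly _ _ _ _ (\sum_(i < n) C * C)) => //; first by exists C.
    apply: (eq_measurable_funT (g := fun x : Rn => enorm x ^+ 2)); first by move=> x; rewrite enorm_sqr.
    by apply: measurable_funX; exact: measurable_enorm.
  move=> x Ux; rewrite ger0_norm ?dotvv_ge0//; apply: ler_sum => i _.
  rewrite (le_trans (ler_norm _))// normrM ler_pM//; exact/ltW/hC.
rewrite /inertia /Rintegral fineK; last exact: integrable_fin_num.
rewrite integral_mkcond epatch_indic; apply: eq_integral => x _.
by rewrite /= -EFinM mulrC enorm_sqr.
Qed.

Section polar_real.
Variable c : R.
Hypotheses (c0 : 0 < c) (hc : forall A : set Rn, measurable A -> wcone A 1 = (c%:E * sphm A)%E).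

Lemma radial_region_inertia r : bmeas r -> (forall u, 0 <= r u) ->
  (\int[lebV n]_x (\1_(radial_region r) x * enorm x ^+ 2)%:E = (c * sint (fun u => r u ^+ (n + 2)))%:E)%E.
Proof.
move=> br r0; rewrite (polar n0 c0 hc br.1 r0) EFinM sintE//; exact: bmeasX.
Qed.

(** One inclusion gives the upper bound; it is applied to Minkowski averages, whose radial function
    is only estimated. *)
Lemma inertia_radial_le U r : measurable U -> boundedV U -> bmeas r -> (forall u, 0 <= r u) ->
  (forall x, x != 0 -> U x -> enorm x < r (dirv x)) ->
  inertia U <= c * sint (fun u => r u ^+ (n + 2)).
Proof.
move=> mU bU br r0 h; rewrite -lee_fin inertiaE// -radial_region_inertia//.
apply: ge0_le_integral => //.
- by move=> x _; rewrite lee_fin mulr_ge0// sqr_ge0.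
- exact: measurable_weight.
- by apply: measurable_weight; apply: measurable_radial_region; case: br.
move=> x _; rewrite lee_fin; have [->|x0] := eqVneq x 0; first by rewrite enorm0 expr0n !mulr0.
rewrite ler_wpM2r ?sqr_ge0// !indicE ler_nat.
have [Ux|Ux] := pselect (U x); last by rewrite memNset.
by rewrite !mem_set//; exact: h.
Qed.

Lemma inertia_radial U r : measurable U -> boundedV U -> bmeas r -> (forall u, 0 <= r u) ->
  (forall x, x != 0 -> U x <-> enorm x < r (dirv x)) ->
  inertia U = c * sint (fun u => r u ^+ (n + 2)).
Proof.
move=> mU bU br r0 h; apply/EFin_inj; rewrite inertiaE// -radial_region_inertia//.
apply: eq_integral => x _; have [->|x0] := eqVneq x 0; first by rewrite enorm0 expr0n !mulr0.
by congr (EFin (_ * _)); apply: indic_iff; exact: h.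
Qed.

End polar_real.

Definition midset (U V : set 'rV[R]_n) : set 'rV[R]_n :=
  [set m | exists x y, [/\ U x, V y & m = 2^-1 *: (x + y)]].

Lemma midset_midpts (U V : set 'rV[R]_n) : midpts U V (midset U V).
Proof. by move=> x y Ux Vy; exists x, y. Qed.

Lemma sbody_midset (U V : set 'rV[R]_n) : sbody U -> sbody V -> sbody (midset U V).
Proof.
move=> [oU cU sU [C C0 bU] U0] [oV cV sV [D D0 bV] V0]; split.
- rewrite openE => _ [x [y [Ux Vy ->]]].
  move: oU; rewrite openE => /(_ _ Ux) /nbhs_ballP[e /= e0 he].
  apply/nbhs_ballP; exists (e / 2) => /=; first by rewrite divr_gt0.
  move=> m; rewrite -ball_normE /= => hm.
  exists (2 *: m - y), y; split => //; last by rewrite subrK scalerA mulVf ?scale1r.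
  apply: he; rewrite -ball_normE /= (_ : x - _ = 2 *: (2^-1 *: (x + y) - m)); last first.
    by apply/rowP => i; rewrite !mxE; field.
  by rewrite normrZ ger0_norm// mulrC -ltr_pdivlMr.
- move=> _ _ t [x [y [Ux Vy ->]]] [x' [y' [Ux' Vy' ->]]] t01.
  exists (t *: x + (1 - t) *: x'), (t *: y + (1 - t) *: y'); split; [exact: cU|exact: cV|].
  by apply/rowP => i; rewrite !mxE; field.
- move=> _ [x [y [Ux Vy ->]]]; exists (- x), (- y); split; [exact: sU|exact: sV|].
  by rewrite -opprD scalerN.
- exists (C + D); first exact: addr_gt0.
  move=> _ [x [y [Ux Vy ->]]] i; rewrite !mxE normrM ger0_norm ?invr_ge0// mulrC ltr_pdivrMr//.
  by rewrite (le_lt_trans (ler_normD _ _))//; have := bU _ Ux i; have := bV _ Vy i; lra.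
- by exists 0, 0; split; rewrite // addr0 scaler0.
Qed.

Definition scaleset (s : R) (U : set 'rV[R]_n) : set 'rV[R]_n := [set x | U (s^-1 *: x)].

Lemma sbody_scaleset s (U : set 'rV[R]_n) : 0 < s -> sbody U -> sbody (scaleset s U).
Proof.
move=> s0 [oU cU sU [C C0 bU] U0]; split.
- apply: (@open_comp _ _ (fun u : 'rV[R]_n => s^-1 *: u) U) => // u _; exact: scaler_continuous.
- move=> x y t Ux Uy t01; rewrite /scaleset /=.
  rewrite (_ : s^-1 *: _ = t *: (s^-1 *: x) + (1 - t) *: (s^-1 *: y)); first exact: cU.
  by apply/rowP => i; rewrite !mxE; ring.
- by move=> x Ux; rewrite /scaleset /= scalerN; exact: sU.
- exists (s * C); first exact: mulr_gt0.
  by move=> x /bU h i; have := h i; rewrite mxE normrM gtr0_norm ?invr_gt0// ltr_pdivrMl.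
- by rewrite /scaleset /= scaler0.
Qed.

Lemma inertia_scaleset s (U : set Rn) : 0 < s -> sbody U ->
  inertia (scaleset s U : set Rn) = s ^+ (n + 2) * inertia U.
Proof.
move=> s0 bU; have bsU := sbody_scaleset s0 bU.
have [mU msU] := (sbody_measurable bU, sbody_measurable bsU).
apply/EFin_inj; rewrite EFinM !inertiaE//; [|by case: bU|by case: bsU].
have := @lebV_scale R n s (fun x => (\1_(scaleset s U) x * enorm x ^+ 2)%:E) s0 (measurable_weight msU).
rewrite (_ : (\int[lebV n]_x _)%E = ((s ^+ 2)%:E * \int[lebV n]_x (\1_U x * enorm x ^+ 2)%:E)%E); last first.
  rewrite -ge0_integralZl//; last 3 first.
  - exact: measurable_weight.
  - by move=> x _; rewrite lee_fin mulr_ge0// sqr_ge0.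
  - by rewrite lee_fin sqr_ge0.
  apply: eq_integral => x _; rewrite -EFinM enormZ gtr0_norm// exprMn mulrCA; congr (EFin (_ * (_ * _))).
  by apply: indic_iff; rewrite /scaleset /= scalerA mulVf ?scale1r// gt_eqF.
move=> h; rewrite exprD EFinM -muleA h; last by move=> x; rewrite lee_fin mulr_ge0// sqr_ge0.
by rewrite muleA -EFinM divff ?mul1e// expf_neq0// gt_eqF.
Qed.

End sphere_integral.

(** * The Minkowski inequality and uniqueness *)

Section minkowski.
Context {R : realType} {n : nat}.
Local Notation Rn := (borelRV R n).
Hypothesis n0 : (0 < n)%N.

(** The constant depends on neither [t] nor [a], so the estimate can be integrated over the sphere
    with [a] a function of the direction. *)
Lemma expr1D_le (A : R) (N : nat) : 0 <= A -> exists2 C : R, 0 <= C &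
  forall t a : R, 0 <= t <= 1 -> `|a| <= A -> 0 <= 1 + t * a ->
    (1 + t * a) ^+ N <= 1 + N%:R * t * a + C * t ^+ 2.
Proof.
move=> A0; elim: N => [|N [C C0 IH]].
  by exists 0 => // t a _ _ _; rewrite expr0 !mul0r !addr0.
(* The first term comes from the product of the two linear terms, the second from the old remainder
   times [1 + t * a <= 1 + A]. *)
exists (N%:R * A ^+ 2 + C * (1 + A)); first by rewrite addr_ge0// mulr_ge0// ?addr_ge0// sqr_ge0.
move=> t a t01 aA ta0; have /andP[t0 t1] := t01.
rewrite exprSr; apply: le_trans (ler_wpM2r ta0 (IH t a t01 aA ta0)) _.
have aA2 : a ^+ 2 <= A ^+ 2 by rewrite -real_normK ?num_real// lerXn2r ?nnegrE.
have taA : t * a <= A.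
  apply: le_trans (ler_norm _) _; rewrite normrM ger0_norm// -[A]mul1r ler_pM//.
have h1 : N%:R * (t ^+ 2 * a ^+ 2) <= N%:R * (t ^+ 2 * A ^+ 2).
  by rewrite ler_wpM2l// ler_wpM2l// sqr_ge0.
have h2 : C * t ^+ 2 * (1 + t * a) <= C * t ^+ 2 * (1 + A).
  by rewrite ler_wpM2l ?lerD2l// mulr_ge0// sqr_ge0.
rewrite -(addn1 N) natrD; move: h1 h2; lra.
Qed.

Variable K : set 'rV[R]_n.
Hypotheses (bK : cbody K) (rK : C2_plus K).

Lemma bmeas_radial0 : bmeas (radial0 K).
Proof.
split; first exact: measurable_radial0.
have [C C0 hC] := radial_bounded bK; exists C => u.
rewrite ger0_norm ?radial0_ge0//.
have [Su|Su] := pselect (usphere R n u); last by rewrite radial0_off// ltW.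
by rewrite radial0E//; exact: hC.
Qed.

Lemma bmeas_gweight : bmeas (gweight K).
Proof. by apply: bmeasX; exact: bmeas_radial0. Qed.

Lemma radial0_dirv x : x != 0 -> radial0 K (dirv x) = radial_fun K (dirv x).
Proof. by move=> x0; rewrite radial0E//; exact: dirv_sphere. Qed.

Lemma dirvK (x : 'rV[R]_n) : enorm x *: dirv x = x.
Proof.
have [->|x0] := eqVneq x 0; first by rewrite enorm0 scale0r.
by rewrite scalerA divff ?scale1r// enorm_eq0.
Qed.

Lemma core_radial x : x != 0 -> core K x <-> enorm x < radial0 K (dirv x).
Proof.
move=> x0; rewrite radial0_dirv// -{1}(dirvK x); apply: coreP => //.
  exact/usphere_neq0/dirv_sphere.
by rewrite lt_neqAle enorm_ge0 eq_sym enorm_eq0 x0.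
Qed.

(** For [b] the support function of [V], this is [h_V / h_K] at the normal of [K] in direction [u],
    the ratio in the Minkowski inequality. *)
Definition gratio (b : Rn -> R) (u : Rn) : R :=
  \1_(usphere R n) u * (b (gaussmap K u) / support_fun K (gaussmap K u)).

Lemma gratioE b u : usphere R n u -> gratio b u = b (gaussmap K u) / support_fun K (gaussmap K u).
Proof. by move=> Su; rewrite /gratio indicE mem_set// mul1r. Qed.

Lemma gratio_off b u : ~ usphere R n u -> gratio b u = 0.
Proof. by move=> Su; rewrite /gratio indicE memNset// mul0r. Qed.

Section bound.
Variables (b : Rn -> R) (B : R).
Hypotheses (mb : measurable_fun setT b) (bB : forall v, usphere R n v -> 0 <= b v <= B).

Lemma support_gt0 v : usphere R n v -> 0 < support_fun K v.
Proof.
have [r [C [r0 C0 h]]] := support_bounds bK.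
by move=> /h /andP[+ _]; exact: lt_le_trans.
Qed.

Lemma gratio_ge0 u : 0 <= gratio b u.
Proof.
have [Su|Su] := pselect (usphere R n u); last by rewrite gratio_off.
rewrite gratioE// divr_ge0 ?support_ge0//.
by have /andP[] := bB (gaussmap_sphere bK rK Su).
Qed.

Lemma bmeas_gratio : bmeas (gratio b).
Proof.
have mg := measurable_gaussmap bK rK.
split.
  apply: measurable_funM; first by apply: measurable_indic; exact: measurable_usphere.
  apply: measurable_funM; first exact: (measurable_compT mb mg).
  apply: (measurable_compT (f := fun v : Rn => (support_fun K v)^-1)) => //.
  by apply: measurable_invr_fun => [|v]; [exact: measurable_support|exact: support_ge0].
have [r [C [r0 C0 h]]] := support_bounds bK.
exists (`|B| / r) => u; rewrite ger0_norm ?gratio_ge0//.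
have [Su|Su] := pselect (usphere R n u); last by rewrite gratio_off// divr_ge0// ltW.
have Sg := gaussmap_sphere bK rK Su.
have /andP[b0 b1] := bB Sg; have /andP[h0 _] := h _ Sg.
rewrite gratioE// ler_pM//; first by rewrite invr_ge0 support_ge0.
  exact: le_trans b1 (ler_norm _).
by rewrite lef_pV2// posrE// support_gt0.
Qed.

Variable V : set Rn.
Hypotheses (bV : sbody V) (Vb : forall x v, V x -> usphere R n v -> dotv x v <= b v)
  (KV : inertia (core K : set Rn) <= inertia V).

(* W is (1 - t) core K + t V with t = 2^-j, obtained by averaging repeatedly with core K. *)
Lemma halving_sequence j : exists W : set Rn,
  [/\ sbody W, inertia (core K : set Rn) <= inertia W &
    forall x v, W x -> usphere R n v ->
      dotv x v <= (1 - 2^-1 ^+ j) * support_fun K v + 2^-1 ^+ j * b v].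
Proof.
elim: j => [|j [W [bW KW hW]]].
  by exists V; split => // x v Vx Sv; rewrite expr0 subrr mul0r add0r mul1r; exact: Vb.
have bC := core_sbody bK; have bM := sbody_midset bC bW.
exists (midset (core K) W); split => //.
  have := inertia_log_concave n0 bC bW bM (@midset_midpts _ _ (core K) W).
  have G0 := inertia_gt0 n0 bC; have M0 := inertia_gt0 n0 bM.
  move=> h; rewrite -(@ler_pXn2r _ 2)// ?nnegrE; [|exact: ltW|exact: ltW].
  by apply: le_trans _ h; rewrite expr2 ler_pM2l.
move=> _ v [x [y [Kx Wy ->]]] Sv.
rewrite dotvZl dotvDl exprSr; have h1 := support_ge bK v (core_sub bK Kx); have h2 := hW y v Wy Sv.
apply: (@le_trans _ _ (2^-1 * (support_fun K v + ((1 - 2^-1 ^+ j) * support_fun K v + 2^-1 ^+ j * b v)))).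
  by rewrite ler_pM2l ?invr_gt0// lerD.
by rewrite le_eqVlt; apply/orP; left; apply/eqP; field.
Qed.

(** The half-space bounding [W] with normal [alpha_K(u)] cuts the ray through [u] at a radius affine
    in [t], because [h_K = rho_K <u, alpha_K(u)>] at that normal. *)
Lemma halving_radial W (t : R) x : sbody W -> 0 <= t <= 1 ->
  (forall x v, W x -> usphere R n v -> dotv x v <= (1 - t) * support_fun K v + t * b v) ->
  x != 0 -> W x -> enorm x < radial0 K (dirv x) * (1 + t * (gratio b (dirv x) - 1)).
Proof.
move=> [oW _ _ _ _] t01 hW x0 Wx.
have Su := dirv_sphere x0; set u := dirv x in Su *.
have x1 : 0 < enorm x by rewrite lt_neqAle enorm_ge0 eq_sym enorm_eq0 x0.
(* Openness of [W] supplies the strict inequality that [radial_region] asks for. *)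
have [e e0 We] : exists2 e : R, 0 < e & W ((1 + e) *: x).
  move: oW; rewrite openE => /(_ _ Wx) /nbhs_ballP[r /= r0 hr].
  have nx : 0 < `|x| by rewrite normr_gt0.
  exists (r / 2 / `|x|); first by rewrite !divr_gt0.
  apply: hr; rewrite -ball_normE /= scalerDl scale1r opprD addNKr normrN normrZ.
  by rewrite gtr0_norm ?divr_gt0// divfK ?gt_eqF//; lra.
have Sa := gaussmap_sphere bK rK Su; have h0 := support_gt0 Sa.
have E v : dotv x v = enorm x * dotv u v by rewrite -{1}(dirvK x) dotvZl.
have := hW _ _ We Sa; rewrite dotvZl E radial0E// gratioE//.
have := support_gaussmap bK rK Su; have r0 := radial_gt0 bK (usphere_neq0 Su).
set h := support_fun K _ in h0 *; set rr := radial_fun K u in r0 *; set d := dotv u _ => hE.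
have d0 : 0 < d by move: h0; rewrite hE pmulr_rgt0.
have -> : (1 - t) * h + t * b (gaussmap K u) = (rr * (1 + t * (b (gaussmap K u) / h - 1))) * d.
  rewrite [RHS](_ : _ = h * (1 + t * (b (gaussmap K u) / h - 1))); last by rewrite hE; ring.
  by field; rewrite gt_eqF.
rewrite mulrA ler_pM2r//; apply: lt_le_trans.
by rewrite ltr_pMl// ltrDl.
Qed.

(** With [Y] the left side, [X] the right side and [N = n + 2], integrating the radial bound for
    [t = 2^-j] gives [Y <= Y + N t (X - Y) + C t^2 Y], which fails for small [t] if [X < Y]. *)
Lemma dual_minkowski : sint (gweight K) <= sint (fun u => gweight K u * gratio b u).
Proof.
rewrite leNgt; apply/negP => hlt.
have [c c0 hc] := @wcone_const R n n0.
have [bF [Bd hBd]] := (bmeas_gratio, bmeas_gratio.2).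
have bw := bmeas_gweight.
pose Y := sint (gweight K); pose X := sint (fun u => gweight K u * gratio b u).
have Bd0 : 0 <= Bd by apply: le_trans (hBd 0).
have [C C0 hC] := @expr1D_le (Bd + 1) (n + 2) (addr_ge0 Bd0 ler01).
have Y0 : 0 <= Y by apply: sint_ge0 => u; exact: gweight_ge0.
(* The integrated bound with [Y] cancelled and divided by [t]. *)
have key j : 0 <= (n + 2)%:R * (X - Y) + C * Y * (2^-1 ^+ j).
  set t : R := 2^-1 ^+ j.
  have t0 : 0 < t by rewrite exprn_gt0// invr_gt0.
  have t1 : t <= 1 by rewrite exprn_ile1// invf_le1//; lra.
  have t01 : 0 <= t <= 1 by rewrite ltW.
  have [W [bW KW hW]] := halving_sequence j.
  have Wr x := @halving_radial W t x bW t01 hW.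
  pose r u := radial0 K u * (1 + t * (gratio b u - 1)).
  have ba : bmeas (fun u => gratio b u - 1) by apply: bmeasD => //; exact: bmeas_cst.
  have b1 : bmeas (fun u => 1 + t * (gratio b u - 1)).
    by apply: bmeasD; [exact: bmeas_cst|apply: bmeasM => //; exact: bmeas_cst].
  have br : bmeas r by apply: bmeasM => //; exact: bmeas_radial0.
  have a0 u : 0 <= 1 + t * (gratio b u - 1).
    by have := mulr_ge0 (ltW t0) (gratio_ge0 u); move: t1; lra.
  have r0 u : 0 <= r u by rewrite mulr_ge0 ?radial0_ge0.
  have := @inertia_radial_le R n n0 c c0 hc W r (sbody_measurable bW) _ br r0 Wr.
  have bdW : boundedV W by case: bW.
  move=> /(_ bdW)/(le_trans KW).
  have bC := core_sbody bK.
  rewrite (@inertia_radial R n n0 c c0 hc (core K) (radial0 K) (sbody_measurable bC) _ bmeas_radial0 (radial0_ge0 bK) core_radial); last by case: bC.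
  rewrite ler_pM2l// -/(gweight K) -/Y => YW.
  have bg : bmeas (fun u => gweight K u + ((n + 2)%:R * t) * (gweight K u * (gratio b u - 1)) + (C * t ^+ 2) * gweight K u).
    apply: bmeasD; last by apply: bmeasM => //; exact: bmeas_cst.
    by apply: bmeasD => //; apply: bmeasM; [exact: bmeas_cst|exact: bmeasM].
  have : sint (fun u => r u ^+ (n + 2)) <= sint (fun u => gweight K u + ((n + 2)%:R * t) * (gweight K u * (gratio b u - 1)) + (C * t ^+ 2) * gweight K u).
    apply: le_sint => //; first exact: bmeasX.
    move=> u; rewrite /r exprMn -/(gweight K u).
    have aB : `|gratio b u - 1| <= Bd + 1 by rewrite (le_trans (ler_normB _ _))// normr1 lerD2r.
    have := ler_wpM2l (gweight_ge0 bK u) (hC t (gratio b u - 1) t01 aB (a0 u)).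
    by move=> h; apply: le_trans h _; rewrite le_eqVlt; apply/orP; left; apply/eqP; ring.
  have bwa : bmeas (fun u => gweight K u * (gratio b u - 1)) by exact: bmeasM.
  have bwF : bmeas (fun u => gweight K u * gratio b u) by exact: bmeasM.
  have b2 : bmeas (fun u => ((n + 2)%:R * t) * (gweight K u * (gratio b u - 1))) by apply: bmeasM => //; exact: bmeas_cst.
  have b3 : bmeas (fun u => (C * t ^+ 2) * gweight K u) by apply: bmeasM => //; exact: bmeas_cst.
  have b12 := bmeasD bw b2; rewrite (sintD n0 b12 b3) (sintD n0 bw b2).
  rewrite !sintZ// (_ : sint (fun u => gweight K u * (gratio b u - 1)) = X - Y); last first.
    rewrite /X /Y -(sintB n0 bwF bw).
    by congr sint; apply/funext => u; ring.
  rewrite -/Y => hle; have {hle} := le_trans YW hle.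
  rewrite -addrA lerDl => hh; rewrite -(@pmulr_rge0 _ t)//; apply: le_trans hh _.
  by rewrite le_eqVlt; apply/orP; left; apply/eqP; ring.
have d0 : 0 < (n + 2)%:R * (Y - X) by rewrite mulr_gt0 ?ltr0n ?addn2// subr_gt0.
(* Below this threshold the quadratic term cannot make up for [X - Y]; the [+ 1] keeps the
   denominator positive. *)
pose q := (n + 2)%:R * (Y - X) / (C * Y + 1).
have CY : 0 <= C * Y by exact: mulr_ge0.
have q0 : 0 < q by rewrite divr_gt0// ltr_wpDl.
have [j hj] := @ltr_add_invr R 0 q q0.
rewrite add0r in hj.
have tq : 2^-1 ^+ j < q.
  apply: le_lt_trans hj; rewrite exprVn lef_pV2 ?posrE ?exprn_gt0// -natrX ler_nat.
  exact: ltn_expl.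
have := key j; rewrite leNgt => /negP; apply.
have : C * Y * 2^-1 ^+ j <= C * Y * q by rewrite ler_wpM2l// ltW.
have : q * (C * Y + 1) = (n + 2)%:R * (Y - X) by rewrite divfK// gt_eqF// ltr_wpDl.
move: q0; lra.
Qed.

End bound.
End minkowski.

(** * Equality of inertias and volumes for bodies with equal measures *)

Section uniqueness.
Context {R : realType} {n : nat}.
Local Notation Rn := (borelRV R n).
Hypothesis n0 : (0 < n)%N.

Definition gint (K : set 'rV[R]_n) (b : Rn -> R) := sint (fun u => gweight K u * gratio K b u).

(** The form in which the equality of the two measures enters the comparison of [K] and [L]. *)
Definition same_gint (K L : set 'rV[R]_n) := forall b : Rn -> R,
  measurable_fun setT b -> (forall v, 0 <= b v) -> gint K b = gint L b.

Definition sbounded (b : Rn -> R) := measurable_fun setT b /\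
  exists B, forall v, usphere R n v -> 0 <= b v <= B.

Lemma sbounded_support (L : set 'rV[R]_n) : cbody L -> sbounded (support_fun L).
Proof.
move=> bL; split; first exact: measurable_support.
have [r [C [r0 C0 h]]] := support_bounds bL; exists C => v Sv.
by rewrite support_ge0//; have /andP[] := h v Sv.
Qed.

Lemma sboundedZ s b : 0 <= s -> sbounded b -> sbounded (fun v => s * b v).
Proof.
move=> s0 [mb [B hB]]; split; first exact: measurable_funM.
by exists (s * B) => v /hB/andP[b0 b1]; rewrite mulr_ge0//= ler_wpM2l.
Qed.

Lemma sboundedD b1 b2 : sbounded b1 -> sbounded b2 -> sbounded (fun v => b1 v + b2 v).
Proof.
move=> [m1 [B1 h1]] [m2 [B2 h2]]; split; first exact: measurable_funD.
by exists (B1 + B2) => v Sv; have /andP[? ?] := h1 v Sv; have /andP[? ?] := h2 v Sv; rewrite addr_ge0//= lerD.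
Qed.

Lemma bernoulli (e : R) N : 0 <= e <= 1 -> 1 - N%:R * e <= (1 - e) ^+ N.
Proof.
move=> /andP[e0 e1]; elim: N => [|N IH]; first by rewrite mul0r subr0 expr0.
rewrite exprSr; apply: le_trans (ler_wpM2r _ IH); last by rewrite subr_ge0.
have : 0 <= N%:R * (e * e) by rewrite !mulr_ge0.
rewrite -(addn1 N) natrD; lra.
Qed.

Section one_body.
Variable K : set 'rV[R]_n.
Hypotheses (bK : cbody K) (rK : C2_plus K).

Lemma bmeas_gint b : sbounded b -> bmeas (fun u => gweight K u * gratio K b u).
Proof.
by move=> [mb [B hB]]; apply: bmeasM; [exact: bmeas_gweight|exact: (bmeas_gratio bK rK mb hB)].
Qed.

Lemma gintZ s b : sbounded b -> gint K (fun v => s * b v) = s * gint K b.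
Proof.
move=> hb; rewrite -(sintZ n0 _ (bmeas_gint hb)); congr sint; apply/funext => u.
rewrite /gratio; ring.
Qed.

Lemma gintD b1 b2 : sbounded b1 -> sbounded b2 ->
  gint K (fun v => b1 v + b2 v) = gint K b1 + gint K b2.
Proof.
move=> h1 h2; rewrite -(sintD n0 (bmeas_gint h1) (bmeas_gint h2)); congr sint.
by apply/funext => u; rewrite /gratio; ring.
Qed.

Lemma gint_support : gint K (support_fun K) = sint (gweight K).
Proof.
congr sint; apply/funext => u.
have [Su|Su] := pselect (usphere R n u); last by rewrite gweight_off// mul0r.
by rewrite gratioE// divff ?mulr1// gt_eqF// support_gt0//; exact: gaussmap_sphere.
Qed.

Lemma inertia_core c : 0 < c ->
  (forall A : set Rn, measurable A -> wcone A 1 = (c%:E * sphm A)%E) ->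
  inertia (core K : set Rn) = c * sint (gweight K).
Proof.
move=> c0 hc; have bC := core_sbody bK.
apply: (inertia_radial n0 c0 hc (sbody_measurable bC)).
- by case: bC.
- exact: bmeas_radial0.
- exact: radial0_ge0.
- by move=> x x0; exact: core_radial.
Qed.

Lemma scaled_minkowski (V : set Rn) b s : sbody V -> sbounded b -> 0 < s ->
  (forall x v, V x -> usphere R n v -> dotv x v <= b v) ->
  inertia (core K : set Rn) <= s ^+ (n + 2) * inertia V ->
  sint (gweight K) <= s * gint K b.
Proof.
move=> bV hb s0 Vb; rewrite -inertia_scaleset// => KV.
have [ms [B hB]] := sboundedZ (ltW s0) hb.
rewrite -gintZ//; apply: (dual_minkowski n0 bK rK ms hB (sbody_scaleset s0 bV) _ KV) => x v Vx Sv.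
by have := Vb _ _ Vx Sv; rewrite dotvZl ler_pdivrMl.
Qed.

Lemma gweight_gt0 : 0 < sint (gweight K).
Proof.
have [c c0 hc] := @wcone_const R n n0.
have := inertia_gt0 n0 (core_sbody bK).
by rewrite (inertia_core c0 hc) pmulr_rgt0.
Qed.
End one_body.

(** If [K] had the larger inertia, a dilate of [L] by a suitable [s] would have at least that
    inertia and yet violate the Minkowski inequality, whose right side the hypothesis evaluates as
    [s * B]. *)
Lemma transfer_le (K L : set 'rV[R]_n) : cbody K -> C2_plus K -> cbody L -> C2_plus L ->
  same_gint K L ->
  sint (gweight K) <= sint (gweight L).
Proof.
move=> bK rK bL rL tr; have [c c0 hc] := @wcone_const R n n0.
have [A0 B0] := (gweight_gt0 bK, gweight_gt0 bL).
set A := sint (gweight K) in A0 *; set B := sint (gweight L) in B0 *.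
rewrite leNgt; apply/negP => BA.
(* The mean of 1 and [A / B]: its square is at least [A / B], so the dilate is large enough as
   [n + 2 >= 2], while [s * B = (A + B) / 2] is still below [A]. *)
pose s := (1 + A / B) / 2.
have AB : 1 < A / B by rewrite ltr_pdivlMr// mul1r.
have s1 : 1 < s by rewrite /s; lra.
have hB : gint K (support_fun L) = B.
  by rewrite tr ?gint_support//; [exact: measurable_support|move=> v; exact: support_ge0].
have : A <= s * gint K (support_fun L).
  apply: (scaled_minkowski bK rK (core_sbody bL) (sbounded_support bL)); first lra.
    by move=> x v /(core_sub bL) Lx _; exact: support_ge.
  rewrite (inertia_core bK c0 hc) (inertia_core bL c0 hc) mulrCA ler_pM2l// -/A -/B.
  rewrite -ler_pdivrMr//; apply: (@le_trans _ _ (s ^+ 2)).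
    have : 0 <= (A / B - 1) ^+ 2 by exact: sqr_ge0.
    rewrite /s; lra.
  by apply: ler_weXn2l; [exact: ltW|rewrite addnC].
rewrite hB /s => h; move: h; rewrite mulrAC mulrDl mul1r divfK ?gt_eqF//; lra.
Qed.

(** Once [K] and [L] have equal inertia, a strictly larger inertia of [M] would leave room to shrink
    [M] by [1 - e] and still apply the Minkowski inequality; the integral of [gweight K] would then
    be at most [1 - e] times itself. *)
Lemma transfer_volume (K L : set 'rV[R]_n) : cbody K -> C2_plus K -> cbody L -> C2_plus L ->
  same_gint K L ->
  let M := midset (core K) (core L) : set Rn in
  lebV n (core K : set Rn) = lebV n (core L : set Rn) /\
  lebV n M = lebV n (core K : set Rn).
Proof.
move=> bK rK bL rL tr M; have [c c0 hc] := @wcone_const R n n0.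
have AB : sint (gweight K) = sint (gweight L).
  have tr' : same_gint L K by move=> b mb b0; apply/esym/tr.
  by apply: le_anti; rewrite (transfer_le bK rK bL rL tr) (transfer_le bL rL bK rK tr').
have [sK sL] := (core_sbody bK, core_sbody bL).
have sM := sbody_midset sK sL; have mM := @midset_midpts _ _ (core K) (core L).
have [iK iL] := (inertia_core bK c0 hc, inertia_core bL c0 hc).
have LK : inertia (core L : set Rn) = inertia (core K : set Rn) by rewrite iK iL AB.
have K0 := inertia_gt0 n0 sK; have M0 := inertia_gt0 n0 sM.
apply: (inertia_equality n0 sK sL sM mM LK).
have KM : inertia (core K : set Rn) <= inertia M.
  have := inertia_log_concave n0 sK sL sM mM.
  by rewrite LK -expr2 ler_pXn2r// ?nnegrE ltW.
apply/eqP; rewrite eq_le KM andbT leNgt; apply/negP => ltM.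
set gK := inertia (core K) in K0 KM ltM; set gM := inertia M in M0 KM ltM.
pose N := (n + 2)%N; have N1 : 1 <= N%:R :> R by rewrite ler1n /N addn2.
have N0 : 0 < N%:R :> R by lra.
(* By Bernoulli, [(1 - e) ^+ N] is at least [1 - N e], which this choice makes equal to
   [gK / gM]. *)
pose e := (1 - gK / gM) / N%:R.
have q1 : gK / gM < 1 by rewrite ltr_pdivrMr// mul1r.
have q0 : 0 < gK / gM by rewrite divr_gt0.
have eN : N%:R * e = 1 - gK / gM by rewrite /e mulrC divfK// gt_eqF.
have e0 : 0 < e by rewrite divr_gt0// subr_gt0.
have e1 : e < 1.
  have : e <= N%:R * e by rewrite ler_peMl// ltW.
  rewrite eN; lra.
have e01 : 0 <= e <= 1 by rewrite !ltW.
pose b := fun v : Rn => 2^-1 * (support_fun K v + support_fun L v).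
have [hK hL] := (sbounded_support bK, sbounded_support bL).
have hb : sbounded b by apply: sboundedZ; [rewrite invr_ge0|exact: sboundedD].
have Mb x v : M x -> usphere R n v -> dotv x v <= b v.
  move=> [y [z [Ky Lz ->]]] _; rewrite dotvZl dotvDl ler_pM2l ?invr_gt0//.
  by rewrite lerD// support_ge//; exact: core_sub.
have : sint (gweight K) <= (1 - e) * gint K b.
  apply: (scaled_minkowski bK rK sM hb _ Mb); first lra.
  have := bernoulli N e01; rewrite eN -/gK -/gM -/N => h.
  rewrite -ler_pdivrMr//; apply: le_trans h; lra.
rewrite (gintZ bK rK _ (sboundedD hK hL)) (gintD bK rK hK hL) gint_support//.
rewrite (tr (support_fun L)) ?gint_support//; last 2 first.
- exact: measurable_support.
- by move=> v; exact: support_ge0.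
rewrite -AB => h.
have := mulr_gt0 e0 (gweight_gt0 bK); move: h; lra.
Qed.

Lemma dual_curvature1_gint (K L : set 'rV[R]_n) : cbody K -> C2_plus K -> cbody L -> C2_plus L ->
  (forall eta : set Rn, measurable eta -> eta `<=` usphere R n ->
     dual_curvature1 (n + 2)%:R K eta = dual_curvature1 (n + 2)%:R L eta) ->
  same_gint K L.
Proof.
move=> bK rK bL rL h b mb b0.
have E (K' : set 'rV[R]_n) : gint K' b =
    fine (\int[sphm]_u (b (gaussmap K' u) / support_fun K' (gaussmap K' u) * gweight K' u)%:E)%E.
  congr fine; apply: eq_integral => u _; congr EFin.
  have [Su|Su] := pselect (usphere R n u); last by rewrite gweight_off// mul0r mulr0.
  by rewrite gratioE// mulrC.
by rewrite !E (dual_curvature1_transfer n0 bK rK bL rL h mb b0).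
Qed.

End uniqueness.

(** Closedness of [L] recovers the points of [K] outside its core as limits of their dilates, and
    the points of the excluded hyperplane as limits along segments leaving it. *)
Lemma cbody_sub_core (R : realType) n (K L : set 'rV[R]_n.+1) : cbody K -> cbody L ->
  (forall u : 'rV[R]_n.+1, u 0 ord_max != 0 -> core K u -> core L u) -> K `<=` L.
Proof.
move=> bK bL h.
have h1 (u : 'rV[R]_n.+1) : u 0 ord_max != 0 -> K u -> L u.
  move=> u0 Ku.
  have cl : closed [set l : R | L (l *: u)].
    apply: (@preimage_closed _ _ (fun l : R => l *: u) _ _ (cbody_closed bL)).
    by move=> l _; apply: cvgZr_tmp; exact: cvg_id.
  have : [set l : R | L (l *: u)] 1; last by rewrite /= scale1r.
  apply: cl => B /nbhs_ballP[e /= e0 he].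
  pose l := 1 - Num.min (e / 2) 2^-1.
  have m0 : 0 < Num.min (e / 2) 2^-1 by rewrite lt_min invr_gt0 ltr0n andbT; lra.
  have me : Num.min (e / 2) 2^-1 <= e / 2 by rewrite ge_min lexx.
  have m2 : Num.min (e / 2) 2^-1 <= 2^-1 by rewrite ge_min lexx orbT.
  have l0 : 0 < l by rewrite /l; lra.
  exists l; split.
    apply: (core_sub bL); apply: h; first by rewrite mxE mulf_neq0// gt_eqF.
    exists l^-1; first by rewrite invf_gt1// /l; lra.
    by rewrite scalerA mulVf ?scale1r// gt_eqF.
  by apply: he; rewrite -ball_normE /= /l opprB addrC subrK gtr0_norm//; lra.
move=> x Kx; have [x0|] := eqVneq (x 0 ord_max) 0; last by move=> ?; exact: h1.
have [cK cv _ [r r0 hr]] := bK.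
(* A point of [K] off the hyperplane; the segment from [w] to [x] approaches [x] through points with
   nonzero last coordinate. *)
pose w : 'rV[R]_n.+1 := (r / 2) *: delta_mx 0 ord_max.
have Kw : K w.
  apply: hr; apply: rV_norm_lt => // i; rewrite !mxE eqxx /=.
  by case: (i == ord_max); rewrite ?mulr0 ?normr0// mulr1 gtr0_norm; lra.
have cl : closed [set t : R | L (t *: w + (1 - t) *: x)].
  apply: (@preimage_closed _ _ (fun t : R => t *: w + (1 - t) *: x) _ _ (cbody_closed bL)).
  move=> t _; apply: cvgD; apply: cvgZr_tmp; first exact: cvg_id.
  by apply: cvgB; [exact: cvg_cst|exact: cvg_id].
have : [set t : R | L (t *: w + (1 - t) *: x)] 0; last by rewrite /= scale0r add0r subr0 scale1r.
apply: cl => B /nbhs_ballP[e /= e0 he].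
pose t := Num.min (e / 2) 2^-1.
have t0 : 0 < t by rewrite /t lt_min invr_gt0 ltr0n andbT; lra.
have te : t <= e / 2 by rewrite ge_min lexx.
have t2 : t <= 2^-1 by rewrite ge_min lexx orbT.
exists t; split.
  apply: h1; last by apply: cv => //; rewrite ltW//=; lra.
  by rewrite !mxE x0 mulr0 addr0 !eqxx /= mulr1 mulf_neq0// gt_eqF// divr_gt0.
by apply: he; rewrite -ball_normE /= sub0r normrN gtr0_norm//; lra.
Qed.

Theorem corollary8p5 (R : realType) (n : nat) (hn : (2 <= n)%N)
    (K L : set 'rV[R]_n)
    (bodyK : convex_body K) (symK : origin_symmetric K) (regK : C2_plus K)
    (bodyL : convex_body L) (symL : origin_symmetric L) (regL : C2_plus L)
    (eq_measures : forall eta : set (borelRV R n),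
       measurable eta -> eta `<=` usphere R n ->
       dual_curvature1 (n + 2)%:R K eta = dual_curvature1 (n + 2)%:R L eta) :
  K = L.
Proof.
have bK := cbody_convex_body bodyK symK; have bL := cbody_convex_body bodyL symL.
have n0 : (0 < n)%N by exact: ltnW.
(* The slicing argument yields one inclusion, so it is run once in each direction. *)
have sub (A B : set 'rV[R]_n) : cbody A -> C2_plus A -> cbody B -> C2_plus B ->
    same_gint A B -> A `<=` B.
  move=> bA rA bB rB tr.
  have [VU MU] := transfer_volume n0 bA rA bB rB tr.
  have [sA sB] := (core_sbody bA, core_sbody bB).
  have sM := sbody_midset sA sB; have mM := @midset_midpts _ _ (core A) (core B).
  move: n0 A B bA rA bB rB tr VU MU sA sB sM mM; clear; case: n => // m _ A B bA _ bB _ _ VU MU sA sB sM mM.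
  by apply: cbody_sub_core => //; apply: sbody_volume_eq sA sB _ mM VU MU; case: sM.
have tr := dual_curvature1_gint n0 bK regK bL regL eq_measures.
have tr' : same_gint L K by move=> b mb b0; apply/esym/tr.
by apply/seteqP; split; [exact: sub tr|exact: sub tr'].
Qed.
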